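(* Let $k\ge0$ be an integer. If $k$ is odd, the space of modes of wavenumber $k$ of $S^3/O^*$ is $\{0\}$. If $k$ is even, put $\tilde k=\lfloor\frac{k/2}{2}\rfloor+\lfloor\frac{k/2}{3}\rfloor+\lfloor\frac{k/2}{4}\rfloor-\frac k2$. For $i=0,\dots,\tilde k$ let $$B_i=(\alpha^8+14\alpha^4\beta^4+\beta^8)^{3i+\mathrm{mod}(k/2,3)}\,(\alpha^{10}\beta^2-2\alpha^6\beta^6+\alpha^2\beta^{10})^{2(\tilde k-i)+(\mathrm{mod}(k/2,4)-\mathrm{mod}(k/2,2))/2}\,(\alpha^{17}\beta-34\alpha^{13}\beta^5+34\alpha^5\beta^{13}-\alpha\beta^{17})^{\mathrm{mod}(k/2,2)}.$$ Then the siblings of $B_0,\dots,B_{\tilde k}$ (restricted to $S^3$) form a basis of the space of modes of wavenumber $k$ of $S^3/O^*$, which therefore has dimension $(\tilde k+1)(k+1)$ (zero when $\tilde k=-1$).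
   Context: Identify $\mathbb R^4$ with $\mathbb C^2$ via $\alpha=x+iy$, $\beta=z+iw$, $S^3=\{|\alpha|^2+|\beta|^2=1\}$. Wirtinger derivatives $\frac{\partial}{\partial\alpha}=\frac12(\partial_x-i\partial_y)$, similarly for $\beta$ with $(z,w)$. $\mathrm{twist}_-=-\bar\beta\frac{\partial}{\partial\alpha}+\bar\alpha\frac{\partial}{\partial\beta}$. For a polynomial $f$ in $\alpha,\beta$ only, homogeneous of degree $k$, its siblings are $\mathrm{twist}_-^j f$, $j=0,\dots,k$. $\gamma\in SU(2)$ acts on $\mathbb C^2$ by $(\alpha,\beta)^T\mapsto\gamma(\alpha,\beta)^T$ and on functions by $(R_\gamma F)(x)=F(\gamma^{-1}x)$. For a finite subgroup $\Gamma\subset SU(2)$, the space of modes of wavenumber $k$ of $S^3/\Gamma$ is the complex vector space of $\Gamma$-invariant $F:S^3\to\mathbb C$ with $\Delta_{S^3}F=-k(k+2)F$. $\mathrm{mod}(m,n)$ is the remainder of $m$ on division by $n$. A matrix $\begin{pmatrix}a&b\\c&d\end{pmatrix}\in SU(2)$ induces $z\mapsto\frac{az+b}{cz+d}$ on $\mathbb C\cup\{\infty\}$. Let $V_O=\{0,\infty,\pm1,\pm i\}$, $O$ the order-24 group of such Möbius maps preserving $V_O$ (octahedral rotation group), and $O^*\subset SU(2)$ (order 48) the matrices inducing elements of $O$. *)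

(* Defs.v *)
From HB Require Import structures.
From mathcomp Require Import all_boot all_order all_algebra.
From mathcomp Require Import all_classical all_reals all_analysis.
From mathcomp Require Import complex.

Set Implicit Arguments.
Unset Strict Implicit.
Unset Printing Implicit Defensive.

Import Order.TTheory GRing.Theory Num.Theory.
Import numFieldNormedType.Exports.
Local Open Scope ring_scope.
Local Open Scope complex_scope.

Section S3modes.
Variable R : realType.

Definition pt := 'rV[R]_4.
Definition cx (v : pt) : R := v 0 0.
Definition cy (v : pt) : R := v 0 (1%:R).
Definition cz (v : pt) : R := v 0 (2%:R).
Definition cw (v : pt) : R := v 0 (3%:R).

Definition alpha (v : pt) : R[i] := cx v +i* cy v.
Definition beta (v : pt) : R[i] := cz v +i* cw v.

Definition onS3 (v : pt) : Prop :=
  cx v ^+ 2 + cy v ^+ 2 + cz v ^+ 2 + cw v ^+ 2 = 1.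

Definition enorm (v : pt) : R := Num.sqrt (\sum_(j < 4) v 0 j ^+ 2).

(* complex-valued functions (on R^4; only the values on S^3 matter for
   functions on S^3) *)
Definition cfun := pt -> R[i].

Definition ebasis (j : 'I_4) : pt := delta_mx 0 j.

Definition rpd (j : 'I_4) (g : pt -> R) : pt -> R :=
  fun u => derive g u (ebasis j).

Definition cpd (j : 'I_4) (f : cfun) : cfun :=
  fun u => rpd j (fun w => complex.Re (f w)) u +i* rpd j (fun w => complex.Im (f w)) u.

Definition dalpha (f : cfun) : cfun :=
  fun u => 2^-1 * (cpd 0 f u - 'i * cpd (1%:R) f u).
Definition dbeta (f : cfun) : cfun :=
  fun u => 2^-1 * (cpd (2%:R) f u - 'i * cpd (3%:R) f u).

Definition twistm (f : cfun) : cfun :=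
  fun u => - (beta u)^* * dalpha f u + (alpha u)^* * dbeta f u.

Definition sibling (j : nat) (f : cfun) : cfun := iter j twistm f.

Definition ext0 (F : cfun) : cfun := fun u => F ((enorm u)^-1 *: u).

Definition itpd (s : seq 'I_4) (g : pt -> R) : pt -> R := foldr rpd g s.

Definition smooth_nz (g : pt -> R) : Prop :=
  forall (s : seq 'I_4) (u : pt), u != 0 ->
    {for u, continuous (itpd s g)} /\
    (forall j : 'I_4, derivable (itpd s g) u (ebasis j)).

Definition smoothS3 (F : cfun) : Prop :=
  smooth_nz (fun u => complex.Re (ext0 F u)) /\ smooth_nz (fun u => complex.Im (ext0 F u)).

(* Laplace-Beltrami operator of S^3: Euclidean Laplacian of the degree-0
   homogeneous extension, evaluated on S^3 *)
Definition lapS3 (F : cfun) : cfun :=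
  fun u => \sum_(j < 4) cpd j (cpd j (ext0 F)) u.

Definition adjmx (g : 'M[R[i]]_2) : 'M[R[i]]_2 := map_mx conjc g^T.
Definition inSU2 (g : 'M[R[i]]_2) : Prop :=
  g *m adjmx g = 1%:M /\ \det g = 1.

(* Riemann sphere C u {oo}: None = oo *)
Definition mobius (g : 'M[R[i]]_2) (p : option R[i]) : option R[i] :=
  let a := g 0 0 in let b := g 0 1 in let c := g 1 0 in let d := g 1 1 in
  match p with
  | Some z => if c * z + d == 0 then None else Some ((a * z + b) / (c * z + d))
  | None => if c == 0 then None else Some (a / c)
  end.

Definition VO (p : option R[i]) : bool :=
  (p == Some 0) || (p == None) || (p == Some 1) || (p == Some (-1))
  || (p == Some 'i) || (p == Some (- 'i)).

(* binary octahedral group O^*: matrices of SU(2) whose Mobius map preserves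
   V_O (i.e. induces an element of the octahedral rotation group O) *)
Definition inOstar (g : 'M[R[i]]_2) : Prop :=
  inSU2 g /\ forall p, VO (mobius g p) = VO p.

Definition toR4 (a b : R[i]) : pt :=
  \row_(j < 4) (if j == 0 :> nat then complex.Re a else if j == 1 :> nat then complex.Im a
                else if j == 2 :> nat then complex.Re b else complex.Im b).
Definition actpt (g : 'M[R[i]]_2) (v : pt) : pt :=
  let w := g *m (\col_(j < 2) (if j == 0 :> nat then alpha v else beta v)) in
  toR4 (w 0 0) (w 1 0).

Definition Ract (g : 'M[R[i]]_2) (F : cfun) : cfun :=
  fun v => F (actpt (invmx g) v).

Definition Ostar_invariant (F : cfun) : Prop :=
  forall g, inOstar g -> forall v, onS3 v -> Ract g F v = F v.

Definition mode (k : nat) (F : cfun) : Prop :=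
  smoothS3 F /\ Ostar_invariant F /\
  forall v, onS3 v -> lapS3 F v = - ((k * (k + 2))%:R) * F v.

Definition Pf (v : pt) : R[i] :=
  let a := alpha v in let b := beta v in
  a ^+ 8 + 14%:R * a ^+ 4 * b ^+ 4 + b ^+ 8.
Definition Pe (v : pt) : R[i] :=
  let a := alpha v in let b := beta v in
  a ^+ 10 * b ^+ 2 - 2%:R * a ^+ 6 * b ^+ 6 + a ^+ 2 * b ^+ 10.
Definition Pv (v : pt) : R[i] :=
  let a := alpha v in let b := beta v in
  a ^+ 17 * b - 34%:R * a ^+ 13 * b ^+ 5 + 34%:R * a ^+ 5 * b ^+ 13
  - a * b ^+ 17.

Definition ktilde (k : nat) : int :=
  let m := (k %/ 2)%N in ((m %/ 2 + m %/ 3 + m %/ 4)%N)%:Z - m%:Z.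

(* number of B_i's: k~ + 1 (truncated at 0; in fact k~ >= -1 always) *)
Definition nB (k : nat) : nat :=
  let m := (k %/ 2)%N in ((m %/ 2 + m %/ 3 + m %/ 4).+1 - m)%N.

Definition Bpoly (k i : nat) : cfun := fun v =>
  let m := (k %/ 2)%N in
  Pf v ^+ (3 * i + m %% 3)%N
  * Pe v ^+ (absz ((2%:Z * (ktilde k - i%:Z))%R) + ((m %% 4 - m %% 2) %/ 2))%N
  * Pv v ^+ (m %% 2)%N.

End S3modes.

(* Main.v *)
(** On R^4 minus the origin let u(x) = |x|^k F(x/|x|). For a mode F the function u is harmonic
    and homogeneous of degree k, so its partial derivatives of order k+1 are harmonic and
    homogeneous of degree -1; comparing such a function w with M/|x|, where M is its maximum on
    S^3, the maximum principle gives w = 0. Hence u is a polynomial. With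
    T- = twist_- and the adjoint operator T+ one has T- T+ = (p+1) q on harmonic polynomials of bidegree
    (p,q), so u is uniquely the sum of the T-^j f_j with binary forms f_j of degree k; since T-
    commutes with SU(2), F is invariant iff every f_j is. An invariant binary form that vanishes
    at one vertex of the octahedron is divisible by t = ab(a^4-b^4); subtracting a multiple of a
    power of W = a^8+14a^4b^4+b^8 (and, for forms that change sign, of chi W^i) and dividing by t^2, one
    sees by induction on the degree that the invariant forms are spanned by the W^i (t^2)^j (t chi)^l. *)
Require Import Defs.
From HB Require Import structures.
From mathcomp Require Import all_boot all_order all_algebra.
From mathcomp Require Import all_classical all_reals all_analysis.
From mathcomp Require Import complex.
From mathcomp Require Import ring lra zify.

Set Implicit Arguments.
Unset Strict Implicit.
Unset Printing Implicit Defensive.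
Import Order.TTheory GRing.Theory Num.Theory.
Import numFieldNormedType.Exports.
Local Open Scope ring_scope.
Local Open Scope complex_scope.

(** * Binary forms *)

(** In R^4 the Laplacian of |x|^p is p(p+2)|x|^(p-2), which is negative exactly for -2 < p < 0. So
    1/|x| is strictly superharmonic, and -1 is the integer degree at which comparison with a power
    of |x| works. The argument must stay off the origin, because the degree-0 extension that defines
    the Laplacian of S^3 is singular at 0. The twist calculus consists of ring identities and is
    carried out for commuting derivations of an abstract commutative ring; the ring of functions
    smooth off the origin, which contains 1/|x|, is substituted afterwards. The group enters in two
    ways. To bound the invariant forms from above, three matrices of O^* suffice. To show that the
    B_i are invariant, every matrix preserving V_O has to be treated, and its entries are first
    determined from the images of vertices. The forms t and chi change sign under the same matrices,
    which makes t^2 and t chi invariant. The sign-changing forms that survive at a vertex have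
    degree 4 modulo 8, while chi W^i starts at degree 12; degree 4 is the exceptional case of the
    induction. *)

Section HomogeneousForm.
Variables (C : nzRingType) (A : comNzRingType) (cst : {rmorphism C -> A}).

(** A binary form of degree [k] is stored as its dehomogenisation [p] at y = 1, with [k] kept apart
    because top coefficients may vanish. The target ring is arbitrary: the same [p] is evaluated on
    scalars, on smooth functions and on polynomials along a line. *)
Definition hform (k : nat) (p : {poly C}) (x y : A) : A :=
  \sum_(i < k.+1) cst p`_i * x ^+ i * y ^+ (k - i).

Lemma hformD k p q x y : hform k (p + q) x y = hform k p x y + hform k q x y.
Proof.
rewrite -big_split; apply: eq_bigr => i _ /=.
by rewrite coefD rmorphD -mulrA mulrDl -!mulrA.
Qed.

Lemma hformZ k c p x y : hform k (c *: p) x y = cst c * hform k p x y.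
Proof.
rewrite big_distrr; apply: eq_bigr => i _ /=.
by rewrite coefZ rmorphM -!mulrA.
Qed.

Lemma hform0 k x y : hform k 0 x y = 0.
Proof. by rewrite /hform big1 // => i _; rewrite coef0 rmorph0 !mul0r. Qed.

Lemma hformB k p q x y : hform k (p - q) x y = hform k p x y - hform k q x y.
Proof.
by apply/eqP; rewrite eq_sym subr_eq -hformD subrK.
Qed.

Lemma hform_sum k (I : Type) (r : seq I) (P : pred I) (f : I -> {poly C}) x y :
  hform k (\sum_(i <- r | P i) f i) x y = \sum_(i <- r | P i) hform k (f i) x y.
Proof.
elim/big_rec2: _ => [|i q p _ <-]; first exact: hform0.
by rewrite hformD.
Qed.

Lemma hformXn k i x y : (i <= k)%N -> hform k 'X^i x y = x ^+ i * y ^+ (k - i).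
Proof.
move=> ik; rewrite /hform (bigD1 (Ordinal (ik : (i < k.+1)%N))) //= coefXn eqxx.
rewrite rmorph1 mul1r big1 ?addr0 // => j; rewrite -val_eqE /= coefXn => /negPf ->.
by rewrite rmorph0 !mul0r.
Qed.

End HomogeneousForm.

Section HomogeneousFormMul.
Variables (C : comNzRingType) (A : comNzRingType) (cst : {rmorphism C -> A}).

Lemma hformM k l (p q : {poly C}) x y :
  (size p <= k.+1)%N -> (size q <= l.+1)%N ->
  hform cst (k + l) (p * q) x y = hform cst k p x y * hform cst l q x y.
Proof.
move=> sp sq.
have ep : p = \sum_(i < k.+1) p`_i *: 'X^i.
  by rewrite -poly_def; apply/polyP => i; rewrite coef_poly; case: ltnP => // h;
     rewrite nth_default // (leq_trans sp).
have eq : q = \sum_(i < l.+1) q`_i *: 'X^i.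
  by rewrite -poly_def; apply/polyP => i; rewrite coef_poly; case: ltnP => // h;
     rewrite nth_default // (leq_trans sq).
rewrite {1}ep {1}eq big_distrl [LHS]hform_sum [in RHS]/hform big_distrl /=.
apply: eq_bigr => i _; rewrite [in LHS]big_distrr [LHS]hform_sum [in RHS]big_distrr /=.
apply: eq_bigr => j _; rewrite -scalerAl -scalerAr scalerA -exprD hformZ.
have [hi hj] := (ltn_ord i, ltn_ord j).
rewrite hformXn; last lia.
have -> : (k + l - (i + j) = (k - i) + (l - j))%N by lia.
by rewrite rmorphM !exprD; ring.
Qed.

Lemma hformX k n (p : {poly C}) x y : (size p <= k.+1)%N ->
  hform cst (n * k) (p ^+ n) x y = hform cst k p x y ^+ n /\ (size (p ^+ n) <= (n * k).+1)%N.
Proof.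
move=> sp; elim: n => [|n [IH sn]].
  by rewrite mul0n !expr0 size_poly1 /hform big_ord1 coef1 rmorph1 !expr0 !mul1r.
rewrite !exprS mulSn hformM // IH; split=> //.
by apply: (leq_trans (size_polyMleq _ _)); lia.
Qed.

Lemma hform_scale k (p : {poly C}) c x y :
  hform cst k p (c * x) (c * y) = c ^+ k * hform cst k p x y.
Proof.
rewrite /hform big_distrr; apply: eq_bigr => i _ /=.
have hi := ltn_ord i; rewrite !exprMn.
have -> : c ^+ k = c ^+ i * c ^+ (k - i) by rewrite -exprD subnKC.
by ring.
Qed.

Lemma hform10 k (p : {poly C}) : hform cst k p 1 0 = cst p`_k.
Proof.
rewrite /hform big_ord_recr /= subnn expr0 expr1n !mulr1 big1 ?add0r // => i _.
by have hi := ltn_ord i; rewrite expr0n subn_eq0 leqNgt hi mulr0.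
Qed.

Lemma hform_y1 k (p : {poly C}) x : (size p <= k.+1)%N ->
  hform cst k p x 1 = (map_poly cst p).[x].
Proof.
move=> sp; rewrite (@horner_coef_wide _ k.+1).
  by apply: eq_bigr => i _; rewrite expr1n mulr1 coef_map.
exact: leq_trans (size_poly _ _) sp.
Qed.

Lemma hform_rmorph (B : comNzRingType) (f : {rmorphism A -> B})
    (cst' : {rmorphism C -> B}) k p x y :
  (forall c, f (cst c) = cst' c) ->
  f (hform cst k p x y) = hform cst' k p (f x) (f y).
Proof.
by move=> h; rewrite rmorph_sum; apply: eq_bigr => i _; rewrite !rmorphM !rmorphXn h.
Qed.
End HomogeneousFormMul.

(** * The twist operators as an sl2-action *)

Section Twist.
Variables (C : numFieldType) (A : comNzRingType) (cst : {rmorphism C -> A}).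
Variables d1 d2 d3 d4 : A -> A.

Definition derivation (d : A -> A) :=
  [/\ forall x y, d (x + y) = d x + d y,
      forall x y, d (x * y) = d x * y + x * d y & forall c, d (cst c) = 0].

Variables a a' b b' : A.

(** Wirtinger calculus on C^2 in abstract form: [d1, d2, d3, d4] stand for the derivatives in alpha,
    conj alpha, beta, conj beta, and [a, a', b, b'] for these coordinates. Conjugation itself does
    not occur, since all the operators below are C-linear. *)
Record twist_axioms : Prop := TwistAxioms {
  tw_der1 : derivation d1;
  tw_der2 : derivation d2;
  tw_der3 : derivation d3;
  tw_der4 : derivation d4;
  tw_d12 : forall x, d2 (d1 x) = d1 (d2 x);
  tw_d13 : forall x, d3 (d1 x) = d1 (d3 x);
  tw_d14 : forall x, d4 (d1 x) = d1 (d4 x);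
  tw_d23 : forall x, d3 (d2 x) = d2 (d3 x);
  tw_d24 : forall x, d4 (d2 x) = d2 (d4 x);
  tw_d34 : forall x, d4 (d3 x) = d3 (d4 x);
  tw_d1a : d1 a = 1;
  tw_d1a' : d1 a' = 0;
  tw_d1b : d1 b = 0;
  tw_d1b' : d1 b' = 0;
  tw_d2a : d2 a = 0;
  tw_d2a' : d2 a' = 1;
  tw_d2b : d2 b = 0;
  tw_d2b' : d2 b' = 0;
  tw_d3a : d3 a = 0;
  tw_d3a' : d3 a' = 0;
  tw_d3b : d3 b = 1;
  tw_d3b' : d3 b' = 0;
  tw_d4a : d4 a = 0;
  tw_d4a' : d4 a' = 0;
  tw_d4b : d4 b = 0;
  tw_d4b' : d4 b' = 1 }.

Hypothesis tw : twist_axioms.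
Let der1 := tw_der1 tw.
Let der2 := tw_der2 tw.
Let der3 := tw_der3 tw.
Let der4 := tw_der4 tw.
Let d12 := tw_d12 tw.
Let d13 := tw_d13 tw.
Let d14 := tw_d14 tw.
Let d23 := tw_d23 tw.
Let d24 := tw_d24 tw.
Let d34 := tw_d34 tw.
Let d1a := tw_d1a tw.
Let d1a' := tw_d1a' tw.
Let d1b := tw_d1b tw.
Let d1b' := tw_d1b' tw.
Let d2a := tw_d2a tw.
Let d2a' := tw_d2a' tw.
Let d2b := tw_d2b tw.
Let d2b' := tw_d2b' tw.
Let d3a := tw_d3a tw.
Let d3a' := tw_d3a' tw.
Let d3b := tw_d3b tw.
Let d3b' := tw_d3b' tw.
Let d4a := tw_d4a tw.
Let d4a' := tw_d4a' tw.
Let d4b := tw_d4b tw.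
Let d4b' := tw_d4b' tw.

Lemma derB d : derivation d -> forall x y, d (x - y) = d x - d y.
Proof.
by case=> dD _ _ x y; apply/eqP; rewrite eq_sym subr_eq -dD subrK.
Qed.
Lemma der0 d : derivation d -> d 0 = 0.
Proof. by move=> h; rewrite -[X in d X](subrr 0) derB // subrr. Qed.
Lemma derN d : derivation d -> forall x, d (- x) = - d x.
Proof. by move=> h x; rewrite -[- x]sub0r derB // der0 // sub0r. Qed.
Lemma derD d : derivation d -> forall x y, d (x + y) = d x + d y.
Proof. by case. Qed.
Lemma derM d : derivation d -> forall x y, d (x * y) = d x * y + x * d y.
Proof. by case. Qed.
Lemma derC d : derivation d -> forall c, d (cst c) = 0.
Proof. by case. Qed.
Lemma der1E d : derivation d -> d 1 = 0.
Proof. by move=> h; rewrite -(rmorph1 cst) derC. Qed.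
Lemma der_sum d (h : derivation d) (I : Type) (r : seq I) (P : pred I) (f : I -> A) :
  d (\sum_(i <- r | P i) f i) = \sum_(i <- r | P i) d (f i).
Proof.
elim/big_rec2: _ => [|i x y _ <-]; first exact: der0.
by rewrite derD.
Qed.
Lemma derMc d (h : derivation d) c x : d (cst c * x) = cst c * d x.
Proof. by rewrite derM // derC // mul0r add0r. Qed.

Let dE := (derB der1, derB der2, derB der3, derB der4,
  derN der1, derN der2, derN der3, derN der4,
  derD der1, derD der2, derD der3, derD der4,
  derM der1, derM der2, derM der3, derM der4,
  derC der1, derC der2, derC der3, derC der4,
  der0 der1, der0 der2, der0 der3, der0 der4,
  der1E der1, der1E der2, der1E der3, der1E der4,
  d1a, d1a', d1b, d1b', d2a, d2a', d2b, d2b', d3a, d3a', d3b, d3b',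
  d4a, d4a', d4b, d4b', (d12, d13, d14, d23, d24, d34)).

(** [Tm] is twist_-. Under the commutator, [Tm], [Tp] and [N1 - N2] span a copy of sl2. [N1] and
    [N2] measure the degrees in (a, b) and in (a', b'), and [Lap] is a quarter of the Euclidean
    Laplacian. *)
Definition Tm u := - b' * d1 u + a' * d3 u.
Definition Tp u := b * d2 u - a * d4 u.
Definition N1 u := a * d1 u + b * d3 u.
Definition N2 u := a' * d2 u + b' * d4 u.
Definition Lap u := d1 (d2 u) + d3 (d4 u).

Lemma derivation_comb d d' x y : derivation d -> derivation d' ->
  derivation (fun u => x * d u + y * d' u).
Proof.
move=> h h'; split=> [u v|u v|c]; rewrite ?(derD h, derD h', derM h, derM h', derC h, derC h');
  ring.
Qed.
Lemma Tm_derivation : derivation Tm.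
Proof. exact: derivation_comb. Qed.
Lemma Tp_derivation : derivation Tp.
Proof.
have := derivation_comb b (- a) der2 der4.
by case=> h1 h2 h3; split=> [u v|u v|c]; rewrite /Tp -!mulNr; auto.
Qed.
Lemma N1_derivation : derivation N1.
Proof. exact: derivation_comb. Qed.
Lemma N2_derivation : derivation N2.
Proof. exact: derivation_comb. Qed.

Lemma Lap_sum (I : Type) (r : seq I) (P : pred I) (f : I -> A) :
  Lap (\sum_(i <- r | P i) f i) = \sum_(i <- r | P i) Lap (f i).
Proof. by rewrite /Lap (der_sum der2) (der_sum der4) (der_sum der1) (der_sum der3) -big_split. Qed.

(** For arbitrary [u] the left side minus the right side is [- (a * a' + b * b') * Lap u]; this is a
    form of the Casimir relation of sl2. *)
Lemma TmTp u : Lap u = 0 -> Tm (Tp u) = N1 (N2 u) + N2 u.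
Proof.
move=> h; have e : d3 (d4 u) = - d1 (d2 u) by apply/eqP; rewrite -addr_eq0 addrC; apply/eqP.
by rewrite /Tm /Tp /N1 /N2 !dE e; ring.
Qed.

Lemma TpTm u : Tp (Tm u) = Tm (Tp u) + N1 u - N2 u.
Proof. by rewrite /Tm /Tp /N1 /N2 !dE; ring. Qed.

Lemma Lap_Tm u : Lap (Tm u) = Tm (Lap u).
Proof. by rewrite /Lap /Tm !dE; ring. Qed.
Lemma Lap_Tp u : Lap (Tp u) = Tp (Lap u).
Proof. by rewrite /Lap /Tp !dE; ring. Qed.
Lemma Lap_N2 u : Lap (N2 u) = N2 (Lap u) + Lap u.
Proof. by rewrite /Lap /N2 !dE; ring. Qed.
Lemma N1_Tm u : N1 (Tm u) = Tm (N1 u) - Tm u.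
Proof. by rewrite /N1 /Tm !dE; ring. Qed.
Lemma N2_Tm u : N2 (Tm u) = Tm (N2 u) + Tm u.
Proof. by rewrite /N2 /Tm !dE; ring. Qed.

Lemma cst_nat_mulI n u : n.+1%:R * u = 0 -> u = 0 :> A.
Proof.
move=> h; have : cst (n.+1%:R^-1) * (n.+1%:R * u) = 0 by rewrite h mulr0.
by rewrite mulrA -(rmorph_nat cst n.+1) -rmorphM mulVf ?pnatr_eq0 // rmorph1 mul1r.
Qed.
Lemma cst_int_mulI (c : C) u : c != 0 -> cst c * u = 0 -> u = 0 :> A.
Proof.
move=> c0 h; have : cst c^-1 * (cst c * u) = 0 by rewrite h mulr0.
by rewrite mulrA -rmorphM mulVf // rmorph1 mul1r.
Qed.

Lemma eigen_indep d n (l : nat -> C) (v : nat -> A) : derivation d ->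
  (forall i, (i < n)%N -> d (v i) = cst (l i) * v i) ->
  (forall i j, (i < j < n)%N -> l i != l j) ->
  \sum_(i < n) v i = 0 -> forall i, (i < n)%N -> v i = 0.
Proof.
move=> hd; elim: n v => [//|n IH] v hv hl hs i hi.
(* Applying [d] minus the last eigenvalue removes the last summand and rescales the others by
   nonzero scalars. *)
have e1 : \sum_(i < n) cst (l i - l n) * v i = 0.
  have : d (\sum_(i < n.+1) v i) - cst (l n) * \sum_(i < n.+1) v i = 0.
    by rewrite hs mulr0 (der0 hd) subr0.
  rewrite (der_sum hd) big_distrr -sumrB big_ord_recr /= hv // subrr addr0 => h; rewrite -[RHS]h.
  apply: eq_bigr => j _; rewrite hv ?rmorphB ?mulrBl //.
  exact: leq_trans (ltn_ord j) _.
have h0 : forall j, (j < n)%N -> v j = 0.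
  move=> j hj; apply: (@cst_int_mulI (l j - l n)).
    by rewrite subr_eq0 hl // hj /=.
  apply: (IH (fun j => cst (l j - l n) * v j)) => // [m hm|m m' /andP [hm hm']].
    by rewrite /= (derMc hd) hv; [rewrite mulrCA | apply: ltnW].
  by apply: hl; rewrite hm; apply: ltnW.
move: hi; rewrite ltnS leq_eqVlt => /orP [/eqP -> | /h0 //].
by move: hs; rewrite big_ord_recr /= big1 ?add0r // => j _; apply: h0.
Qed.

(** Being a binary form in (a, b) is expressed by differential equations, which forms in linearly
    transformed coordinates satisfy as well. *)
Definition holo k g := [/\ d2 g = 0, d4 g = 0 & N1 g = k%:R * g].

Lemma der_nat d (hd : derivation d) n x : d (n%:R * x) = n%:R * d x.
Proof. by rewrite -(rmorph_nat cst n) (derMc hd). Qed.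

Lemma iterTm_N2 k g j : holo k g -> N2 (iter j Tm g) = j%:R * iter j Tm g.
Proof.
case=> h2 h4 h1; elim: j => [|j IH]; first by rewrite /N2 /= h2 h4; ring.
by rewrite iterS N2_Tm IH (der_nat Tm_derivation) -natr1; ring.
Qed.
Lemma iterTm_N1 k g j : holo k g -> N1 (iter j Tm g) = (k%:R - j%:R) * iter j Tm g.
Proof.
case=> h2 h4 h1; elim: j => [|j IH]; first by rewrite /= h1; ring.
rewrite iterS N1_Tm IH mulrBl (derB Tm_derivation) !(der_nat Tm_derivation).
by rewrite -natr1; ring.
Qed.

(** [Tp] kills [g], and each commutation of [Tp] with a factor [Tm] contributes a weight [k - 2 i];
    the coefficient is the sum of these weights for [i = 0, ..., j]. It is nonzero for [j < k],
    which makes [Tm] injective along the string of siblings. *)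
Lemma TpTm_holo k g j : holo k g -> (j <= k)%N ->
  Tp (iter j.+1 Tm g) = (j.+1 * (k - j))%:R * iter j Tm g.
Proof.
move=> h; elim: j => [|j IH] jk.
  rewrite iterS TpTm; case: (h) => h2 h4 h1.
  have -> : Tp (iter 0 Tm g) = 0 by rewrite /Tp /= h2 h4; ring.
  by rewrite (der0 Tm_derivation) (iterTm_N1 0 h) (iterTm_N2 0 h) subn0 mul1n; ring.
rewrite iterS TpTm IH; last lia.
rewrite (der_nat Tm_derivation).
rewrite (iterTm_N1 _ h) (iterTm_N2 _ h) -iterS.
by rewrite !natrM !natrB //; [rewrite -!natr1; ring | lia].
Qed.

Lemma iterTm_inj k g j : holo k g -> (j <= k)%N -> iter j Tm g = 0 -> g = 0.
Proof.
move=> h; elim: j => [//|j IH] jk e; apply: IH; first lia.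
have := TpTm_holo h (ltnW jk); rewrite e (der0 Tp_derivation).
have [n ->] : exists n, (j.+1 * (k - j))%N = n.+1 by exists (j.+1 * (k - j)).-1; nia.
by move/esym/cst_nat_mulI.
Qed.

(** The [j]-th summand is an eigenvector of [N2] for the eigenvalue [j], so each summand vanishes,
    and the [j]-th power of [Tm] is injective on forms of degree [k] as long as [j <= k]. *)
Lemma twist_indep k (g : nat -> A) : (forall j, (j <= k)%N -> holo k (g j)) ->
  \sum_(j < k.+1) iter j Tm (g j) = 0 -> forall j, (j <= k)%N -> g j = 0.
Proof.
move=> hg hs j jk; apply: (iterTm_inj (hg j jk) jk).
apply: (@eigen_indep N2 k.+1 (fun j => j%:R) (fun j => iter j Tm (g j))) => //.
- exact: N2_derivation.
- by move=> i ik; rewrite (iterTm_N2 _ (hg i ik)) rmorph_nat.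
- by move=> i j'; rewrite eqr_nat; case: ltngtP.
Qed.

Lemma iterTm_sum j (I : Type) (r : seq I) (P : pred I) (f : I -> A) :
  iter j Tm (\sum_(i <- r | P i) f i) = \sum_(i <- r | P i) iter j Tm (f i).
Proof. by elim: j => //= j ->; rewrite (der_sum Tm_derivation). Qed.
Lemma iterTm_cst j c x : iter j Tm (cst c * x) = cst c * iter j Tm x.
Proof. by elim: j => //= j ->; rewrite (derMc Tm_derivation). Qed.
Lemma iterTmB j x y : iter j Tm (x - y) = iter j Tm x - iter j Tm y.
Proof. by elim: j => //= j ->; rewrite (derB Tm_derivation). Qed.
Lemma Lap_iterTm j x : Lap x = 0 -> Lap (iter j Tm x) = 0.
Proof. by move=> h; elim: j => //= j IH; rewrite Lap_Tm IH (der0 Tm_derivation). Qed.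

Lemma der_exp d (hd : derivation d) x n : d (x ^+ n.+1) = n.+1%:R * x ^+ n * d x.
Proof.
elim: n => [|n IH]; first by rewrite expr1 expr0; ring.
by rewrite exprS (derM hd) IH -[n.+2%:R]natr1 exprS; ring.
Qed.
Lemma der_exp0 d (hd : derivation d) x n : d x = 0 -> d (x ^+ n) = 0.
Proof.
by move=> h; case: n => [|n]; rewrite ?expr0 ?(der1E hd) // (der_exp hd) h mulr0.
Qed.
Lemma der_exp_eigen d (hd : derivation d) x n : d x = x -> d (x ^+ n) = n%:R * x ^+ n.
Proof.
move=> h; case: n => [|n]; first by rewrite expr0 (der1E hd) mul0r.
by rewrite (der_exp hd) h -mulrA -exprSr.
Qed.

Lemma hform_holo k p x y : d2 x = 0 -> d4 x = 0 -> d2 y = 0 -> d4 y = 0 ->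
  N1 x = x -> N1 y = y -> holo k (hform cst k p x y).
Proof.
move=> h2x h4x h2y h4y hx hy; split.
- rewrite /hform (der_sum der2) big1 // => i _.
  by rewrite !(derM der2) !(der_exp0 der2) // (derC der2); ring.
- rewrite /hform (der_sum der4) big1 // => i _.
  by rewrite !(derM der4) !(der_exp0 der4) // (derC der4); ring.
rewrite /hform (der_sum N1_derivation) big_distrr; apply: eq_bigr => i _ /=.
rewrite !(derM N1_derivation) !(der_exp_eigen N1_derivation) // (derC N1_derivation).
have hi := ltn_ord i; have -> : k%:R = i%:R + (k - i)%:R :> A.
  by rewrite -natrD subnKC.
ring.
Qed.

Lemma N1a : N1 a = a. Proof. by rewrite /N1 !dE; ring. Qed.
Lemma N1b : N1 b = b. Proof. by rewrite /N1 !dE; ring. Qed.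

Lemma hform_ab_holo k p : holo k (hform cst k p a b).
Proof. by apply: hform_holo; rewrite ?N1a ?N1b. Qed.

Lemma holo_Lap k g : holo k g -> Lap g = 0.
Proof. by case=> h2 h4 _; rewrite /Lap h2 h4 (der0 der1) (der0 der3) addr0. Qed.

(** Bihomogeneous polynomials of bidegree [(p, q)], as elements of [A]. The inductive form allows
    proofs by adding one variable at a time. *)
Inductive bih : nat -> nat -> A -> Prop :=
| bih_cst c : bih 0 0 (cst c)
| bih0 p q : bih p q 0
| bihD p q u v : bih p q u -> bih p q v -> bih p q (u + v)
| bih_a p q u : bih p q u -> bih p.+1 q (a * u)
| bih_b p q u : bih p q u -> bih p.+1 q (b * u)
| bih_a' p q u : bih p q u -> bih p q.+1 (a' * u)
| bih_b' p q u : bih p q u -> bih p q.+1 (b' * u).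

Lemma bihZ p q c u : bih p q u -> bih p q (cst c * u).
Proof.
elim=> {p q u} [c'|p q|p q u v _ hu _ hv|p q u _ h|p q u _ h|p q u _ h|p q u _ h].
- by rewrite -rmorphM; constructor.
- by rewrite mulr0; constructor.
- by rewrite mulrDr; constructor.
all: by rewrite mulrCA; constructor.
Qed.

Lemma bih_N p q u : bih p q u -> N1 u = p%:R * u /\ N2 u = q%:R * u.
Proof.
elim=> {p q u} [c'|p q|p q u v _ [h1 h2] _ [g1 g2]|p q u _ [h1 h2]|p q u _ [h1 h2]|p q u _ [h1 h2]|p q u _ [h1 h2]].
- by rewrite (derC N1_derivation) (derC N2_derivation) mul0r.
- by rewrite (der0 N1_derivation) (der0 N2_derivation) !mulr0.
- by rewrite (derD N1_derivation) (derD N2_derivation) h1 h2 g1 g2 !mulrDr.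
all: rewrite (derM N1_derivation) (derM N2_derivation) h1 h2 /N1 /N2 !dE -?natr1.
all: by split; ring.
Qed.

(** [Tp] is the derivation sending [a'] to [b] and [b'] to [- a] and killing [a] and [b]: it trades
    one conjugate variable for a holomorphic one, and nothing is left to trade when [q = 0]. *)
Lemma bih_Tp p q u : bih p q u ->
  if q is q'.+1 then bih p.+1 q' (Tp u) else Tp u = 0.
Proof.
have Tpa : Tp a = 0 by rewrite /Tp !dE; ring.
have Tpb : Tp b = 0 by rewrite /Tp !dE; ring.
have Tpa' : Tp a' = b by rewrite /Tp !dE; ring.
have Tpb' : Tp b' = - a by rewrite /Tp !dE; ring.
elim=> {p q u} [c'|p q|p q u v _ hu _ hv|p q u _ h|p q u _ h|p q u hu h|p q u hu h].
- exact: (derC Tp_derivation).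
- by rewrite (der0 Tp_derivation); case: q => // q; constructor.
- by rewrite (derD Tp_derivation); case: q hu hv => [-> ->|q hu hv]; [rewrite addr0|constructor].
- rewrite (derM Tp_derivation) Tpa mul0r add0r.
  by case: q h => [->|q h]; [rewrite mulr0 | constructor].
- rewrite (derM Tp_derivation) Tpb mul0r add0r.
  by case: q h => [->|q h]; [rewrite mulr0 | constructor].
- rewrite (derM Tp_derivation) Tpa'; apply: bihD; first exact: bih_b.
  by case: q h {hu} => [->|q h]; [rewrite mulr0|]; constructor.
- rewrite (derM Tp_derivation) Tpb'; apply: bihD.
    by rewrite mulNr -mulrN; apply: bih_a; rewrite -[- u]mulN1r -(rmorphN1 cst); apply: bihZ.
  by case: q h {hu} => [->|q h]; [rewrite mulr0|]; constructor.
Qed.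

Lemma bih_hform p u : bih p 0 u ->
  exists2 P : {poly C}, (size P <= p.+1)%N & u = hform cst p P a b.
Proof.
move: {1 3}0%N (erefl 0%N) => q eq h; move: eq.
elim: h => {p q u} [c'|p q|p q u v _ hu _ hv|p q u _ h|p q u _ h|//|//] eq.
- exists c'%:P; first by rewrite size_polyC; case: eqP.
  by rewrite /hform big_ord1 coefC !expr0 !mulr1.
- by exists 0; [rewrite size_poly0 | rewrite hform0].
- have [P sP ->] := hu eq; have [Q sQ ->] := hv eq.
  exists (P + Q); last by rewrite hformD.
  by apply: (leq_trans (size_polyD _ _)); rewrite geq_max sP.
- have [P sP ->] := h eq; exists ('X * P).
    by apply: (leq_trans (size_polyMleq _ _)); rewrite size_polyX; lia.
  rewrite -[p.+1]/(1 + p)%N hformM // ?size_polyX //; congr (_ * _).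
  by rewrite -['X]expr1 hformXn // subnn expr0 mulr1 expr1.
- have [P sP ->] := h eq; exists P; first lia.
  rewrite -[P in RHS]mul1r -[p.+1]/(1 + p)%N hformM // ?size_poly1 //; congr (_ * _).
  by rewrite -[1 : {poly C}](expr0 'X) hformXn // subn0 expr0 mul1r expr1.
Qed.

Definition bidec k u := exists2 w : nat -> A,
  forall q, (q <= k)%N -> bih (k - q) q (w q) & u = \sum_(q < k.+1) w q.

Lemma bidecD k u v : bidec k u -> bidec k v -> bidec k (u + v).
Proof.
move=> [w hw ->] [x hx ->]; exists (fun q => w q + x q); last by rewrite big_split.
by move=> q qk; constructor; auto.
Qed.
Lemma bidecZ k c u : bidec k u -> bidec k (cst c * u).
Proof.
move=> [w hw ->]; exists (fun q => cst c * w q); last by rewrite big_distrr.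
by move=> q qk; apply: bihZ; auto.
Qed.
Lemma bidec_mull k x u : (forall p q v, bih p q v -> bih p.+1 q (x * v)) ->
  bidec k u -> bidec k.+1 (x * u).
Proof.
move=> hx [w hw ->]; exists (fun q => if (q <= k)%N then x * w q else 0).
  by move=> q qk; case: ifP => h; [rewrite subSn //; auto | constructor].
rewrite [RHS]big_ord_recr /= ltnn addr0 big_distrr; apply: eq_bigr => i _ /=.
by rewrite -ltnS ltn_ord.
Qed.
Lemma bidec_mulr k x u : (forall p q v, bih p q v -> bih p q.+1 (x * v)) ->
  bidec k u -> bidec k.+1 (x * u).
Proof.
move=> hx [w hw ->]; exists (fun q => if q is q'.+1 then x * w q' else 0).
  by case=> [|q] qk; [constructor | rewrite subSS; auto].
by rewrite [RHS]big_ord_recl add0r big_distrr.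
Qed.

(** The degree is a scalar so that [c = 0] can produce degree -1, where the maximum principle
    applies. *)
Lemma euler_der c u : N1 u + N2 u = cst c * u ->
  [/\ N1 (d1 u) + N2 (d1 u) = cst (c - 1) * d1 u, N1 (d2 u) + N2 (d2 u) = cst (c - 1) * d2 u,
      N1 (d3 u) + N2 (d3 u) = cst (c - 1) * d3 u & N1 (d4 u) + N2 (d4 u) = cst (c - 1) * d4 u].
Proof.
have h d : derivation d -> N1 u + N2 u = cst c * u ->
    N1 (d u) + N2 (d u) = d (N1 u + N2 u) - d u -> N1 (d u) + N2 (d u) = cst (c - 1) * d u.
  by move=> hd e ->; rewrite e (derMc hd) rmorphB rmorph1 mulrBl mul1r.
move=> e; split; [apply: (h _ der1 e) | apply: (h _ der2 e) | apply: (h _ der3 e) | apply: (h _ der4 e)].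
all: by rewrite /N1 /N2 !dE; ring.
Qed.

Lemma Lap_der u : Lap u = 0 ->
  [/\ Lap (d1 u) = 0, Lap (d2 u) = 0, Lap (d3 u) = 0 & Lap (d4 u) = 0].
Proof.
move=> e; have e1 := congr1 d1 e; have e2 := congr1 d2 e; have e3 := congr1 d3 e; have e4 := congr1 d4 e.
move: e1 e2 e3 e4; rewrite (der0 der1) (der0 der2) (der0 der3) (der0 der4) /Lap !dE.
by move=> -> -> -> ->.
Qed.

(** The form in which polynomiality of [u] is first known: degree below [n], with no coefficients
    exhibited. *)
Fixpoint vanish n u := if n is n'.+1 then
  [/\ vanish n' (d1 u), vanish n' (d2 u), vanish n' (d3 u) & vanish n' (d4 u)] else u = 0.

Hypothesis der_const : forall u, vanish 1 u -> exists c, u = cst c.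

Lemma vanish_bidec k u : vanish k.+1 u -> N1 u + N2 u = k%:R * u -> bidec k u.
Proof.
elim: k u => [|k IH] u.
  move=> /der_const [c ->] _; exists (fun=> cst c); last by rewrite big_ord1.
  by case=> // _; constructor.
move=> [v1 v2 v3 v4] hE.
have [h1 h2 h3 h4] : [/\ N1 (d1 u) + N2 (d1 u) = k%:R * d1 u, N1 (d2 u) + N2 (d2 u) = k%:R * d2 u,
    N1 (d3 u) + N2 (d3 u) = k%:R * d3 u & N1 (d4 u) + N2 (d4 u) = k%:R * d4 u].
  have := @euler_der k.+1%:R u; rewrite !rmorph_nat => /(_ hE) [-> -> -> ->].
  by rewrite -natr1 addrK rmorph_nat.
(* Euler's identity rebuilds [u] from its first derivatives, which have degree [k] and are
   decomposed by induction. *)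
have -> : u = cst (k.+1%:R^-1) * (a * d1 u + b * d3 u + (a' * d2 u + b' * d4 u)).
  rewrite -/(N1 u) -/(N2 u) hE mulrA -(rmorph_nat cst k.+1) -rmorphM mulVf ?pnatr_eq0 //.
  by rewrite rmorph1 mul1r.
apply: bidecZ; apply: bidecD; apply: bidecD.
- by apply: (bidec_mull bih_a); apply: IH.
- by apply: (bidec_mull bih_b); apply: IH.
- by apply: (bidec_mulr bih_a'); apply: IH.
- by apply: (bidec_mulr bih_b'); apply: IH.
Qed.

Lemma Lap_nat n u : Lap (n%:R * u) = n%:R * Lap u.
Proof. by rewrite /Lap !(der_nat der2, der_nat der4, der_nat der1, der_nat der3) mulrDr. Qed.

(* [Tm (Tp u) = (p + 1) q u] on harmonic [u] of bidegree [(p, q)], so such a [u] is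
   recovered from the holomorphic form [Tp^q u]. *)
Lemma harmonic_bih p q u : bih p q u -> Lap u = 0 ->
  exists2 P : {poly C}, (size P <= (p + q).+1)%N & u = iter q Tm (hform cst (p + q) P a b).
Proof.
elim: q p u => [|q IH] p u hu hL; first by rewrite addn0; apply: bih_hform.
have [P sP eP] := IH _ _ (bih_Tp hu) (etrans (Lap_Tp u) (etrans (congr1 Tp hL) (der0 Tp_derivation))).
have [hN1 hN2] := bih_N hu.
have := TmTp hL; rewrite eP -iterS hN2 (der_nat N1_derivation) hN1 => e.
pose c : C := (p.+1%:R * q.+1%:R)^-1.
have c0 : c * (p.+1%:R * q.+1%:R) = 1 by rewrite mulVf // mulf_neq0 // pnatr_eq0.
rewrite -addSnnS; exists (c *: P); first exact: leq_trans (size_scale_leq _ _) sP.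
rewrite hformZ iterTm_cst e.
have -> : q.+1%:R * (p%:R * u) + q.+1%:R * u = cst (p.+1%:R * q.+1%:R) * u.
  by rewrite rmorphM !rmorph_nat -[p.+1%:R]natr1; ring.
by rewrite mulrA -rmorphM c0 rmorph1 mul1r.
Qed.

Theorem harmonic_decomp k u : vanish k.+1 u -> N1 u + N2 u = k%:R * u -> Lap u = 0 ->
  exists2 P : 'I_k.+1 -> {poly C}, forall j, (size (P j) <= k.+1)%N &
    u = \sum_(j < k.+1) iter j Tm (hform cst k (P j) a b).
Proof.
move=> hv hE hL; have [w hw hu] := vanish_bidec hv hE.
(* [Lap] lowers both degrees by one, so the [Lap (w q)] are eigenvectors of [N2] for the distinct
   eigenvalues [q - 1], and their sum is zero. Hence every bihomogeneous piece is harmonic by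
   itself. *)
have hLw : forall q, (q < k.+1)%N -> Lap (w q) = 0.
  apply: (@eigen_indep N2 k.+1 (fun q => q%:R - 1) (fun q => Lap (w q))).
  - exact: N2_derivation.
  - move=> q qk; have [_ h2] := bih_N (hw q qk).
    have := Lap_N2 (w q); rewrite h2 Lap_nat => e; apply: (addIr (Lap (w q))); rewrite -e.
    by rewrite rmorphB rmorph_nat rmorph1; ring.
  - by move=> i j; rewrite (inj_eq (addIr _)) eqr_nat; case: ltngtP.
  - by rewrite -Lap_sum -hu.
have h (j : 'I_k.+1) : exists P : {poly C}, (size P <= k.+1)%N /\
    w j = iter j Tm (hform cst k P a b).
  have jk : (j <= k)%N by rewrite -ltnS.
  have [P sP eP] := harmonic_bih (hw j jk) (hLw j (ltn_ord j)).
  by move: sP eP; rewrite subnK // => sP eP; exists P.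
have [P hP] := fin_all_exists h.
exists P; first by move=> j; have [] := hP j.
by rewrite hu; apply: eq_bigr => j _; have [] := hP j.
Qed.

Lemma hform_lin_holo k p m n m' n' :
  holo k (hform cst k p (cst m * a + cst n * b) (cst m' * a + cst n' * b)).
Proof.
apply: hform_holo; rewrite ?(derD der2) ?(derD der4) ?(derD N1_derivation) ?(derMc der2)
  ?(derMc der4) ?(derMc N1_derivation) ?N1a ?N1b ?d2a ?d2b ?d4a ?d4b ?mulr0 ?addr0 //.
Qed.

Lemma Tm_coord : [/\ Tm a = - b', Tm b = a', Tm a' = 0 & Tm b' = 0].
Proof. by rewrite /Tm !dE; split; ring. Qed.

(* [pull x y a2 a2' b2 b2']: [y] is the polynomial expression [x] in [a, a', b, b'] with
   [a2, a2', b2, b2'] substituted for the variables. *)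
Inductive pull (a2 a2' b2 b2' : A) : A -> A -> Prop :=
| pull_cst c : pull a2 a2' b2 b2' (cst c) (cst c)
| pull_a : pull a2 a2' b2 b2' a a2
| pull_a' : pull a2 a2' b2 b2' a' a2'
| pull_b : pull a2 a2' b2 b2' b b2
| pull_b' : pull a2 a2' b2 b2' b' b2'
| pullD x x' y y' : pull a2 a2' b2 b2' x x' -> pull a2 a2' b2 b2' y y' ->
    pull a2 a2' b2 b2' (x + y) (x' + y')
| pullM x x' y y' : pull a2 a2' b2 b2' x x' -> pull a2 a2' b2 b2' y y' ->
    pull a2 a2' b2 b2' (x * y) (x' * y').

Section Pull.
Variables a2 a2' b2 b2' : A.
Hypotheses (Tma : Tm a2 = - b2') (Tmb : Tm b2 = a2').
Hypotheses (Tma' : Tm a2' = 0) (Tmb' : Tm b2' = 0).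

(** By the hypotheses [Tm] acts on the new coordinates as on the old ones, and a derivation is
    determined by its values on generators; so [Tm] commutes with the substitution. This is the form
    in which twist_- commutes with SU(2). *)
Lemma pull_Tm x y : pull a2 a2' b2 b2' x y -> pull a2 a2' b2 b2' (Tm x) (Tm y).
Proof.
elim=> {x y} [c|||||x x' y y' _ h1 _ h2|x x' y y' h1 g1 h2 g2].
- by rewrite !(derC Tm_derivation) -(rmorph0 cst); constructor.
- rewrite Tma (_ : Tm a = - b'); last by rewrite /Tm !dE; ring.
  by rewrite -[- b']mulN1r -[- b2']mulN1r -(rmorphN1 cst); do !constructor.
- rewrite Tma' (_ : Tm a' = 0); last by rewrite /Tm !dE; ring.
  by rewrite -(rmorph0 cst); constructor.
- by rewrite Tmb (_ : Tm b = a'); [constructor | rewrite /Tm !dE; ring].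
- rewrite Tmb' (_ : Tm b' = 0); last by rewrite /Tm !dE; ring.
  by rewrite -(rmorph0 cst); constructor.
- by rewrite !(derD Tm_derivation); constructor.
- by rewrite !(derM Tm_derivation); do 2!constructor.
Qed.

Lemma pull_hform k p : pull a2 a2' b2 b2' (hform cst k p a b) (hform cst k p a2 b2).
Proof.
have pX n x y : pull a2 a2' b2 b2' x y -> pull a2 a2' b2 b2' (x ^+ n) (y ^+ n).
  move=> h; elim: n => [|n IH]; first by rewrite !expr0 -(rmorph1 cst); constructor.
  by rewrite !exprS; constructor.
apply: (big_ind2 (pull a2 a2' b2 b2')).
- by rewrite -(rmorph0 cst); constructor.
- by move=> *; apply: pullD.
move=> i _; apply: pullM; last by apply: pX; apply: pull_b.
by apply: pullM; [apply: pull_cst | apply: pX; apply: pull_a].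
Qed.

Lemma pull_iterTm_hform k p j :
  pull a2 a2' b2 b2' (iter j Tm (hform cst k p a b)) (iter j Tm (hform cst k p a2 b2)).
Proof. by elim: j => [|j IH]; [apply: pull_hform | apply: pull_Tm]. Qed.
End Pull.
End Twist.

(** * Wirtinger derivatives from real partial derivatives; the radial function *)

Section RealCoordinates.
Variables (C : numFieldType) (iC : C) (A : comNzRingType) (cst : {rmorphism C -> A}).
Variables (D : 'I_4 -> A -> A) (X : 'I_4 -> A) (Rh : A).
Hypothesis iC2 : iC ^+ 2 = -1.
Hypothesis hD : forall j, derivation cst (D j).
Hypothesis Dcomm : forall i j f, D i (D j f) = D j (D i f).
Hypothesis DX : forall i j, D i (X j) = (j == i)%:R.
Hypothesis DRh : forall j, D j Rh = - X j * Rh ^+ 3.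
Hypothesis Rh2 : Rh ^+ 2 * (\sum_(j < 4) X j ^+ 2) = 1.
Implicit Types f g : A.
Notation I1 := (1 : 'I_4).
Notation I2 := (2%:R : 'I_4).
Notation I3 := (3%:R : 'I_4).

Lemma sum4 (V : nmodType) (F : 'I_4 -> V) :
  \sum_(j < 4) F j = F 0 + F I1 + F I2 + F I3.
Proof.
rewrite !big_ord_recl big_ord0 addr0 !addrA.
by congr (_ + F _ + F _ + F _); apply: val_inj.
Qed.

Definition ii : A := cst iC.
Definition hh : A := cst 2^-1.
Lemma ii2 : ii ^+ 2 = -1.
Proof. by rewrite /ii -rmorphXn /= iC2 rmorphN1. Qed.
Lemma hh2 : hh * 2 = 1.
Proof. by rewrite /hh -(rmorph_nat cst 2) -rmorphM mulVf ?rmorph1 // pnatr_eq0. Qed.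

Definition al : A := X 0 + ii * X I1.
Definition al' : A := X 0 - ii * X I1.
Definition be : A := X I2 + ii * X I3.
Definition be' : A := X I2 - ii * X I3.

Definition da f : A := hh * D 0 f + - (hh * ii) * D I1 f.
Definition da' f : A := hh * D 0 f + hh * ii * D I1 f.
Definition db f : A := hh * D I2 f + - (hh * ii) * D I3 f.
Definition db' f : A := hh * D I2 f + hh * ii * D I3 f.

Lemma D_iiM j f : D j (ii * f) = ii * D j f.
Proof. exact: (derMc (hD j)). Qed.
Lemma D_hhM j f : D j (hh * f) = hh * D j f.
Proof. exact: (derMc (hD j)). Qed.
Lemma D_ii j : D j ii = 0. Proof. exact: (derC (hD j)). Qed.
Lemma D_hh j : D j hh = 0. Proof. exact: (derC (hD j)). Qed.

Let DE := (fun j => derD (hD j), fun j => derB (hD j), fun j => derN (hD j),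
  fun j => derM (hD j), D_ii, D_hh, DX).

Lemma comb_comm (i j k l : 'I_4) (x y z t : C) f :
  cst z * D k (cst x * D i f + cst y * D j f) + cst t * D l (cst x * D i f + cst y * D j f) =
  cst x * D i (cst z * D k f + cst t * D l f) + cst y * D j (cst z * D k f + cst t * D l f).
Proof.
rewrite !(derD (hD k), derD (hD l), derD (hD i), derD (hD j)).
rewrite !(derMc (hD k), derMc (hD l), derMc (hD i), derMc (hD j)).
rewrite (Dcomm k i) (Dcomm k j) (Dcomm l i) (Dcomm l j); ring.
Qed.

Lemma hhiiE : hh * ii = cst (2^-1 * iC). Proof. by rewrite rmorphM. Qed.
Lemma NhhiiE : - (hh * ii) = cst (- (2^-1 * iC)). Proof. by rewrite rmorphN rmorphM. Qed.

Lemma coord_twist : twist_axioms cst da da' db db' al al' be be'.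
Proof.
have hhii : hh * 2 = 1 := hh2; have i2 := ii2.
split; try exact: derivation_comb.
1-6: by move=> f; rewrite /da /da' /db /db' ?NhhiiE ?hhiiE; exact: comb_comm.
all: rewrite /da /da' /db /db' /al /al' /be /be' !DE /=.
all: try (by ring).
all: try (by transitivity (hh * (1 + ii ^+ 2)); [ring | rewrite i2 subrr mulr0]).
all: by transitivity (hh * (1 - ii ^+ 2)); [ring | rewrite i2 opprK -mulr2n].
Qed.

Definition Eu f : A := \sum_(j < 4) X j * D j f.
Definition Lp f : A := \sum_(j < 4) D j (D j f).

Lemma LapE f : Lp f = 4 * Lap da da' db db' f.
Proof.
rewrite /Lap /Lp sum4 /da /da' /db /db' !(derD (hD _), D_hhM, D_iiM) ?mulNr ?(derN (hD _)).
rewrite -!(mulrA hh ii) !(D_hhM, D_iiM).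
rewrite (Dcomm I1 0) (Dcomm I3 I2).
transitivity ((hh * 2) ^+ 2 * (D 0 (D 0 f) - ii ^+ 2 * D I1 (D I1 f) + D I2 (D I2 f)
   - ii ^+ 2 * D I3 (D I3 f))); last by ring.
by rewrite hh2 ii2; ring.
Qed.

Lemma EuN f : Eu f = N1 da db al be f + N2 da' db' al' be' f.
Proof.
rewrite /Eu sum4 /N1 /N2 /da /da' /db /db' /al /al' /be /be'.
transitivity ((hh * 2) * (X 0 * D 0 f - ii ^+ 2 * (X I1 * D I1 f) + X I2 * D I2 f
  - ii ^+ 2 * (X I3 * D I3 f))); last by ring.
by rewrite hh2 ii2; ring.
Qed.

Lemma Eu_derivation : derivation cst Eu.
Proof.
have h f : Eu f = N1 da db al be f + N2 da' db' al' be' f := EuN f.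
have h1 := N1_derivation coord_twist; have h2 := N2_derivation coord_twist.
split=> [f g|f g|c]; rewrite !h ?(derD h1, derD h2, derM h1, derM h2, derC h1, derC h2); ring.
Qed.

Lemma D_Rhn j n : D j (Rh ^+ n) = - (n%:R * (X j * Rh ^+ (n + 2))).
Proof.
elim: n => [|n IH]; first by rewrite expr0 (der1E (hD j)) mul0r oppr0.
rewrite exprS (derM (hD j)) IH DRh -natr1 !addSn !exprS !exprD; ring.
Qed.

Lemma Eu_Rhn n : Eu (Rh ^+ n) = - n%:R * Rh ^+ n.
Proof.
rewrite /Eu; under eq_bigr => j _ do rewrite D_Rhn.
transitivity (- n%:R * Rh ^+ n * (Rh ^+ 2 * \sum_(j < 4) X j ^+ 2)); last by rewrite Rh2 mulr1.
rewrite !big_distrr; apply: eq_bigr => j _ /=; rewrite exprD; ring.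
Qed.

(* The radial factor turns the Euclidean Laplacian into that of the sphere. *)
Lemma Lp_Rhn n f : Eu f = n%:R * f ->
  Lp (Rh ^+ n * f) = - (n * (n + 2))%:R * (Rh ^+ (n + 2) * f) + Rh ^+ n * Lp f.
Proof.
move=> hE; rewrite {1}/Lp.
have e j : D j (D j (Rh ^+ n * f)) = - (n%:R * (Rh ^+ (n + 2) * f))
   + (n%:R * (n + 2)%:R * Rh ^+ (n + 2) * Rh ^+ 2 * f) * X j ^+ 2
   - 2 * n%:R * Rh ^+ (n + 2) * (X j * D j f) + Rh ^+ n * D j (D j f).
  rewrite !(derM (hD j), derD (hD j)) !D_Rhn !(derN (hD j)) !(derM (hD j)) !D_Rhn DX eqxx.
  have -> : D j n%:R = 0 by rewrite -(rmorph_nat cst n) (derC (hD j)).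
  rewrite mulr1n -addnA [Rh ^+ (n + (2 + 2))]exprD [Rh ^+ (2 + 2)]exprD ![Rh ^+ (n + 2)]exprD; ring.
rewrite (eq_bigr _ (fun j _ => e j)) !big_split /= sumr_const card_ord.
rewrite -!big_distrr /= sumrN -big_distrr /= -/(Eu f) hE -/(Lp f).
move: Rh2; set S := \sum_(j < 4) _ => h.
transitivity (- (n%:R * (Rh ^+ (n + 2) * f)) *+ 4 + n%:R * (n + 2)%:R * Rh ^+ (n + 2) * f * (Rh ^+ 2 * S)
  - 2 * n%:R * Rh ^+ (n + 2) * (n%:R * f) + Rh ^+ n * Lp f); first by ring.
by rewrite h natrM natrD; ring.
Qed.

(** The norm |x|, written as |x|^2 times 1/|x|: an inverse of [Rh] obtained without division in
    [A]. *)
Definition rr : A := Rh * \sum_(j < 4) X j ^+ 2.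
Lemma Rh_rr : Rh * rr = 1.
Proof. by rewrite /rr mulrA -expr2 Rh2. Qed.

Lemma Eu_rrn n : Eu (rr ^+ n) = n%:R * rr ^+ n.
Proof.
have h : Rh ^+ n * rr ^+ n = 1 by rewrite -exprMn Rh_rr expr1n.
have := congr1 Eu h; rewrite (derM Eu_derivation) (der1E Eu_derivation) Eu_Rhn => e.
have : rr ^+ n * (- n%:R * Rh ^+ n * rr ^+ n + Rh ^+ n * Eu (rr ^+ n)) = 0 by rewrite e mulr0.
move=> e2; apply/eqP; rewrite -subr_eq0; apply/eqP; rewrite -[RHS]e2.
transitivity ((Rh ^+ n * rr ^+ n) * (Eu (rr ^+ n) - n%:R * rr ^+ n)); last by ring.
by rewrite h mul1r.
Qed.

Lemma D_Eu j f : D j (Eu f) = Eu (D j f) + D j f.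
Proof.
rewrite /Eu (der_sum (hD j)).
rewrite (eq_bigr (fun i => X i * D i (D j f) + (i == j)%:R * D i f)); last first.
  by move=> i _; rewrite (derM (hD j)) DX Dcomm addrC.
rewrite big_split /=; congr (_ + _); rewrite (bigD1 j) //= eqxx mul1r big1 ?addr0 // => i /negPf ->.
by rewrite mul0r.
Qed.

Lemma Lp_Eu f : Lp (Eu f) = Eu (Lp f) + 2 * Lp f.
Proof.
have e j : D j (D j (Eu f)) = Eu (D j (D j f)) + 2 * D j (D j f).
  by rewrite D_Eu (derD (hD j)) D_Eu; ring.
by rewrite /Lp (eq_bigr _ (fun j _ => e j)) big_split /= -big_distrr /= (der_sum Eu_derivation).
Qed.

Hypothesis max_principle : forall w, Lp w = 0 -> Eu w = - w -> w = 0.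
Hypothesis D_const : forall f, (forall j, D j f = 0) -> exists c, f = cst c.

Lemma harmonic_vanish k f : Lp f = 0 -> Eu f = k%:R * f -> vanish da da' db db' k.+1 f.
Proof.
have Lap0 g : Lp g = 0 -> Lap da da' db db' g = 0.
  by rewrite LapE => /(cst_nat_mulI cst).
have Lp0 g : Lap da da' db db' g = 0 -> Lp g = 0 by rewrite LapE => ->; rewrite mulr0.
elim: k f => [|k IH] f hL hE.
  (* The first derivatives of a harmonic function of degree 0 have degree -1; here the maximum
     principle enters. *)
  have := @euler_der _ _ _ _ _ _ _ _ _ _ _ coord_twist 0 f.
  rewrite -EuN hE rmorph0 => /(_ erefl); rewrite -!EuN sub0r rmorphN1 !mulN1r => -[e1 e2 e3 e4].
  have [l1 l2 l3 l4] := Lap_der coord_twist (Lap0 _ hL).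
  by split; apply: max_principle => //; apply: Lp0.
have := @euler_der _ _ _ _ _ _ _ _ _ _ _ coord_twist k.+1%:R f.
rewrite -EuN hE rmorph_nat => /(_ erefl); rewrite -!EuN -natr1 addrK rmorph_nat => -[e1 e2 e3 e4].
have [l1 l2 l3 l4] := Lap_der coord_twist (Lap0 _ hL).
by split; apply: IH => //; apply: Lp0.
Qed.

Lemma coord_const f : vanish da da' db db' 1 f -> exists c, f = cst c.
Proof.
case=> /= e1 e2 e3 e4; apply: D_const => j.
have d0 : D 0 f = 0.
  transitivity ((hh * 2) * D 0 f); first by rewrite hh2 mul1r.
  by transitivity (da f + da' f); [rewrite /da /da'; ring | rewrite e1 e2 addr0].
have d1 : D I1 f = 0.
  transitivity (- ii ^+ 2 * (hh * 2) * D I1 f); first by rewrite hh2 ii2; ring.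
  by transitivity (ii * (da f - da' f)); [rewrite /da /da'; ring | rewrite e1 e2 subrr mulr0].
have d2 : D I2 f = 0.
  transitivity ((hh * 2) * D I2 f); first by rewrite hh2 mul1r.
  by transitivity (db f + db' f); [rewrite /db /db'; ring | rewrite e3 e4 addr0].
have d3 : D I3 f = 0.
  transitivity (- ii ^+ 2 * (hh * 2) * D I3 f); first by rewrite hh2 ii2; ring.
  by transitivity (ii * (db f - db' f)); [rewrite /db /db'; ring | rewrite e3 e4 subrr mulr0].
case: j => [[|[|[|[|j]]]] hj] //.
- by rewrite -[RHS]d0; congr (D _ f); apply: val_inj.
- by rewrite -[RHS]d1; congr (D _ f); apply: val_inj.
- by rewrite -[RHS]d2; congr (D _ f); apply: val_inj.
- by rewrite -[RHS]d3; congr (D _ f); apply: val_inj.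
Qed.

Theorem harmonic_coord_decomp k f : Lp f = 0 -> Eu f = k%:R * f ->
  exists2 P : 'I_k.+1 -> {poly C}, forall j, (size (P j) <= k.+1)%N &
    f = \sum_(j < k.+1) iter j (Tm da db al' be') (hform cst k (P j) al be).
Proof.
move=> hL hE; apply: (harmonic_decomp coord_twist coord_const).
- exact: harmonic_vanish.
- by rewrite -EuN.
-   by move: hL; rewrite LapE => /(cst_nat_mulI cst).
Qed.

End RealCoordinates.

(** * Octahedral invariants *)

(** The exponent of the second factor of B_i. The argument of [absz] is nonnegative for
    [i < nB k]. *)
Definition eB (k i : nat) : nat :=
  (absz (2%:Z * (ktilde k - i%:Z))%R + ((k %/ 2) %% 4 - (k %/ 2) %% 2) %/ 2)%N.

Lemma nB_ktilde k : (nB k)%:Z = ktilde k + 1.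
Proof.
rewrite /nB /ktilde; move: (k %/ 2)%N => m. lia.
Qed.

Lemma exps_of_index k i : ~~ odd k -> (i < nB k)%N ->
  (8 * (3 * i + (k %/ 2) %% 3) + 12 * eB k i + 18 * ((k %/ 2) %% 2) = k)%N.
Proof.
move=> ko; rewrite /eB /nB /ktilde.
have -> : k = (2 * (k %/ 2))%N by lia.
move: (k %/ 2)%N => m; rewrite mulKn //.
move=> hi.
have -> : absz (2%:Z * (((m %/ 2 + m %/ 3 + m %/ 4)%N)%:Z - m%:Z - i%:Z))%R = (2 * ((m %/ 2 + m %/ 3 + m %/ 4) - m - i))%N.
  lia.
lia.
Qed.

(** With m = k/2 the degree equation reads m = 4a + 6b + 9c. Modulo 2 it determines c, modulo 3 the
    residue of a, and modulo 4 the parity of b, as (m mod 4 - m mod 2)/2. These residues are the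
    constants in the exponents of B_i, so every monomial of degree [k] with [c <= 1] is one of the
    B_i. *)
Lemma index_of_exps k a b c : (8 * a + 12 * b + 18 * c = k)%N -> (c <= 1)%N ->
  [/\ (a %/ 3 < nB k)%N, (a = 3 * (a %/ 3) + (k %/ 2) %% 3)%N,
      b = eB k (a %/ 3) & c = ((k %/ 2) %% 2)%N].
Proof.
move=> e hc; rewrite /eB /nB /ktilde.
have -> : (k %/ 2 = 4 * a + 6 * b + 9 * c)%N by lia.
clear e k.
have [->|->] : c = 0%N \/ c = 1%N by lia.
- by split; lia.
- by split; lia.
Qed.

Section OctahedralForms.
Variable C : numFieldType.

Notation hf := (@hform C C idfun).

(** Klein's octahedral forms: the zeros of [tf] are the six vertices V_O, those of [Wf] the eight
    face centres, those of [chif] the twelve edge midpoints. [Ef] and [Vf] are the products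
    [tf ^+ 2] and [tf * chif]. *)
Definition tf (x y : C) := x ^+ 5 * y - x * y ^+ 5.
Definition Wf (x y : C) := x ^+ 8 + 14%:R * x ^+ 4 * y ^+ 4 + y ^+ 8.
Definition Ef (x y : C) := x ^+ 10 * y ^+ 2 - 2%:R * x ^+ 6 * y ^+ 6 + x ^+ 2 * y ^+ 10.
Definition Vf (x y : C) :=
  x ^+ 17 * y - 34%:R * x ^+ 13 * y ^+ 5 + 34%:R * x ^+ 5 * y ^+ 13 - x * y ^+ 17.
Definition chif (x y : C) :=
  x ^+ 12 - 33%:R * x ^+ 8 * y ^+ 4 - 33%:R * x ^+ 4 * y ^+ 8 + y ^+ 12.

(* Dehomogenised at y = 1. *)
Definition Tp5 : {poly C} := 'X^5 - 'X^1.
Definition Wp : {poly C} := 'X^8 + 14%:R *: 'X^4 + 'X^0.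
Definition Chip : {poly C} := 'X^12 - 33%:R *: 'X^8 - 33%:R *: 'X^4 + 'X^0.
Definition Ep := Tp5 ^+ 2.
Definition Vp := Tp5 * Chip.

Lemma Ef_tf x y : Ef x y = tf x y ^+ 2.
Proof. by rewrite /Ef /tf; ring. Qed.
Lemma Vf_tf x y : Vf x y = tf x y * chif x y.
Proof. by rewrite /Vf /tf /chif; ring. Qed.

Lemma hf_Tp5 x y : hf 6 Tp5 x y = tf x y.
Proof. by rewrite hformB !hformXn // /tf. Qed.
Lemma hf_Wp x y : hf 8 Wp x y = Wf x y.
Proof. by rewrite !hformD hformZ !hformXn //= /Wf; ring. Qed.
Lemma hf_Chip x y : hf 12 Chip x y = chif x y.
Proof. by rewrite hformD !hformB !hformZ !hformXn //= /chif; ring. Qed.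

Lemma size_Tp5 : size Tp5 = 6%N.
Proof. by rewrite size_polyDl ?size_polyXn // size_polyN size_polyXn. Qed.
Lemma size_polyD_le n (p q : {poly C}) :
  (size p <= n)%N -> (size q <= n)%N -> (size (p + q)%R <= n)%N.
Proof. by move=> hp hq; apply: (leq_trans (size_polyD _ _)); rewrite geq_max hp. Qed.
Lemma size_scaleXn_le n (c : C) i : (i < n)%N -> (size (c *: 'X^i)%R <= n)%N.
Proof. by move=> h; apply: (leq_trans (size_scale_leq _ _)); rewrite size_polyXn. Qed.

Lemma size_Wp : (size Wp <= 9)%N.
Proof. by rewrite !size_polyD_le ?size_scaleXn_le ?size_polyXn. Qed.
Lemma size_Chip : (size Chip <= 13)%N.
Proof. by rewrite !size_polyD_le ?size_polyN ?size_scaleXn_le ?size_polyXn. Qed.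

Lemma poly_zero_fun (p : {poly C}) : (forall z, p.[z] = 0) -> p = 0.
Proof.
move=> h; apply/eqP; apply: contraT => p0.
have := @max_poly_roots _ p [seq i%:R | i <- iota 0 (size p)] p0.
rewrite size_map size_iota ltnn => -> //.
  by apply/allP => z _; rewrite rootE h.
rewrite map_inj_uniq ?iota_uniq // => i j /eqP.
by rewrite eqr_nat => /eqP.
Qed.

Lemma hf_y1 k (p : {poly C}) z : (size p <= k.+1)%N -> hf k p z 1 = p.[z].
Proof. by move=> sp; rewrite hform_y1 // map_poly_id. Qed.

Lemma hf_inj k (p : {poly C}) : (size p <= k.+1)%N -> (forall z, hf k p z 1 = 0) -> p = 0.
Proof. by move=> sp h; apply: poly_zero_fun => z; rewrite -(@hf_y1 k). Qed.

Lemma horner_hform k p (u v : {poly C}) z :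
  (hform (@polyC C) k p u v).[z] = hf k p u.[z] v.[z].
Proof.
rewrite -[LHS]/(horner_eval z _) (@hform_rmorph _ _ _ _ _ idfun) //.
by move=> c; exact: hornerC.
Qed.

(** [tf] has zeros and cannot be cancelled pointwise. Along a line through the given point on which
    [tf] is not identically zero, both factors become polynomials in one parameter, and these form
    an integral domain. *)
Lemma tf_cancel l (q : {poly C}) (a b c d s : C) :
  (forall x y, tf x y * (hf l q (a * x + b * y) (c * x + d * y) - s * hf l q x y) = 0) ->
  forall x y, hf l q (a * x + b * y) (c * x + d * y) = s * hf l q x y.
Proof.
move=> h x y.
have line u v : exists2 p : {poly C}, p.[0] = u & p.[1] = v.
  by exists (u%:P + (v - u) *: 'X); rewrite !hornerE /=; ring.
(* The line runs from [(x, y)] at parameter 0 to [(2, 1)] at parameter 1, a point where [tf] takes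
   the nonzero value 30. *)
have [px px0 px1] := line x 2; have [py py0 py1] := line y 1.
pose tp := px ^+ 5 * py - px * py ^+ 5.
pose K := hform (@polyC C) l q (a *: px + b *: py) (c *: px + d *: py)
          - s *: hform (@polyC C) l q px py.
have Kz z : K.[z] = hf l q (a * px.[z] + b * py.[z]) (c * px.[z] + d * py.[z])
    - s * hf l q px.[z] py.[z].
  by rewrite hornerD hornerN hornerZ !horner_hform !hornerD !hornerZ.
have tpz z : tp.[z] = tf px.[z] py.[z].
  by rewrite /tp hornerD hornerN !(horner_exp, hornerM).
have tK : tp * K = 0.
  by apply: poly_zero_fun => z; rewrite hornerM Kz tpz h.
have tp0 : tp != 0.
  apply/eqP => e; have := tpz 1; rewrite e horner0.
  rewrite px1 py1; have -> : tf 2 1 = 30%:R by rewrite /tf; ring.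
  by move/eqP; rewrite eq_sym pnatr_eq0.
move/eqP: tK; rewrite mulf_eq0 (negPf tp0) => /eqP K0.
have := Kz 0; rewrite K0 horner0 px0 py0.
by move/esym/eqP; rewrite subr_eq0 => /eqP.
Qed.

Definition Bp k i : {poly C} :=
  Wp ^+ (3 * i + (k %/ 2) %% 3) * Ep ^+ eB k i * Vp ^+ ((k %/ 2) %% 2).

Definition inspan k (p : {poly C}) :=
  exists c : 'I_(nB k) -> C, p = \sum_(i < nB k) c i *: Bp k i.

Lemma inspan0 k : inspan k 0.
Proof. by exists (fun=> 0); rewrite big1 // => i _; rewrite scale0r. Qed.
Lemma inspanD k p q : inspan k p -> inspan k q -> inspan k (p + q).
Proof.
move=> [c ->] [d ->]; exists (fun i => c i + d i).
by rewrite -big_split; apply: eq_bigr => i _; rewrite scalerDl.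
Qed.
Lemma inspanZ k x p : inspan k p -> inspan k (x *: p).
Proof.
move=> [c ->]; exists (fun i => x * c i).
by rewrite scaler_sumr; apply: eq_bigr => i _; rewrite scalerA.
Qed.
Lemma inspan_sum k (I : Type) (r : seq I) (f : I -> {poly C}) :
  (forall i, inspan k (f i)) -> inspan k (\sum_(i <- r) f i).
Proof. by move=> h; apply: big_ind => //; [apply: inspan0 | apply: inspanD]. Qed.

Lemma inspan_mon k a b c : (8 * a + 12 * b + 18 * c = k)%N -> (c <= 1)%N ->
  inspan k (Wp ^+ a * Ep ^+ b * Vp ^+ c).
Proof.
move=> e hc; have [h1 h2 h3 h4] := index_of_exps e hc.
have -> : Wp ^+ a * Ep ^+ b * Vp ^+ c = Bp k (a %/ 3) by rewrite /Bp -h2 -h3 -h4.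
exists (fun i => (i == Ordinal h1)%:R).
rewrite (bigD1 (Ordinal h1)) //= eqxx scale1r big1 ?addr0 // => i /negPf ->.
by rewrite scale0r.
Qed.

Lemma inspan_mulE k p : ~~ odd k -> inspan k p -> inspan (k + 12) (p * Ep).
Proof.
move=> ko [c ->]; rewrite big_distrl; apply: inspan_sum => i /=.
rewrite -scalerAl; apply: inspanZ; rewrite /Bp.
set x := Wp ^+ _; set y := Ep ^+ _; set z := Vp ^+ _.
have -> : x * y * z * Ep = x * (Ep * y) * z by ring.
rewrite /x /y /z -exprS; apply: inspan_mon; last by lia.
have := exps_of_index ko (ltn_ord i); lia.
Qed.

(* At the vertex [0], [Ep] vanishes but [Wp] does not: evaluating there kills the terms one by one. *)
Lemma pow_indep n (c : nat -> C) :
  \sum_(i < n) c i *: ((Wp ^+ 3) ^+ i * (Ep ^+ 2) ^+ (n.-1 - i)) = 0 ->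
  forall i, (i < n)%N -> c i = 0.
Proof.
have T0 : Tp5.[0] = 0 by rewrite /Tp5 !hornerE /= !expr0n subr0.
have W0 : Wp.[0] = 1 by rewrite /Wp !hornerE /= !expr0n /= mulr0 !add0r.
have E0 : Ep ^+ 2 != 0 by rewrite /Ep !expf_eq0 /= -size_poly_eq0 size_Tp5.
elim: n => [//|n IH] /=; rewrite big_ord_recr /= subnn expr0 mulr1 => h.
have hlow : \sum_(i < n) c i *: ((Wp ^+ 3) ^+ i * (Ep ^+ 2) ^+ (n - i)) =
    (\sum_(i < n) c i *: ((Wp ^+ 3) ^+ i * (Ep ^+ 2) ^+ (n.-1 - i))) * Ep ^+ 2.
  rewrite big_distrl; apply: eq_bigr => i _ /=; have hi := ltn_ord i.
  by rewrite -scalerAl -mulrA -exprSr; congr (_ *: (_ * _ ^+ _)); lia.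
have cn : c n = 0.
  have := congr1 (horner^~ 0) h; rewrite hlow /= hornerD hornerM hornerZ !horner_exp T0 W0.
  by rewrite horner0 !expr0n /= mulr0 add0r !expr1n mulr1.
move: h; rewrite cn scale0r addr0 hlow => /eqP; rewrite mulf_eq0 (negPf E0) orbF => /eqP h.
by move=> i; rewrite ltnS leq_eqVlt => /orP [/eqP -> //|]; apply: IH.
Qed.

(** All B_i share a factor independent of [i]; cancelling it leaves products of powers of [Wp ^+ 3]
    and [Ep ^+ 2], the case of [pow_indep]. *)
Lemma Bp_indep k (c : 'I_(nB k) -> C) : \sum_(i < nB k) c i *: Bp k i = 0 ->
  forall i, c i = 0.
Proof.
move=> h i; pose c' j := if insub j is Some i' then c i' else 0.
have c'E (j : 'I_(nB k)) : c' j = c j by rewrite /c' valK.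
rewrite -c'E; apply: (@pow_indep (nB k)) => //.
have T0 : Tp5 != 0 by rewrite -size_poly_eq0 size_Tp5.
have W0 : Wp != 0.
  apply/eqP => e; have : Wp.[0] = 1 by rewrite /Wp !hornerE /= !expr0n /= mulr0 !add0r.
  by rewrite e horner0 => /eqP; rewrite eq_sym oner_eq0.
have X0 : Chip != 0.
  apply/eqP => e; have : Chip.[0] = 1 by rewrite /Chip !hornerE /= !expr0n /= !mulr0 !subr0 add0r.
  by rewrite e horner0 => /eqP; rewrite eq_sym oner_eq0.
pose m := (k %/ 2)%N.
pose f := Wp ^+ (m %% 3) * Ep ^+ ((m %% 4 - m %% 2) %/ 2) * Vp ^+ (m %% 2).
have f0 : f != 0 by rewrite /f /Vp /Ep !mulf_neq0 // !expf_neq0 // ?expf_neq0 ?mulf_neq0.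
apply: (mulIf f0); rewrite mul0r -[RHS]h big_distrl; apply: eq_bigr => j _ /=.
rewrite c'E -scalerAl; congr (_ *: _); rewrite /Bp /f -/m /eB.
have -> : absz (2%:Z * (ktilde k - j%:Z))%R = (2 * ((nB k).-1 - j))%N.
  by have := nB_ktilde k; have := ltn_ord j; lia.
by rewrite -!exprM !exprD; ring.
Qed.

Lemma size_polyM_le m n (p q : {poly C}) :
  (size p <= m.+1)%N -> (size q <= n.+1)%N -> (size (p * q)%R <= (m + n).+1)%N.
Proof. by move=> hp hq; apply: (leq_trans (size_polyMleq _ _)); lia. Qed.
Lemma size_Ep : (size Ep <= 13)%N.
Proof.
have sT : (size Tp5 <= 7)%N by rewrite size_Tp5.
exact: (@hformX C C idfun 6 2 Tp5 0 0 sT).2.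
Qed.
Lemma size_Vp : (size Vp <= 19)%N.
Proof. by apply: (leq_trans (size_polyMleq _ _)); have := size_Chip; rewrite size_Tp5; lia. Qed.

Lemma size_Bp k i : ~~ odd k -> (i < nB k)%N -> (size (Bp k i) <= k.+1)%N.
Proof.
move=> ko ik.
have [sE sV] := (size_Ep, size_Vp).
have ek := exps_of_index ko ik.
rewrite -[k in (_ <= k.+1)%N](_ :
  (((3 * i + (k %/ 2) %% 3) * 8 + eB k i * 12) + (k %/ 2) %% 2 * 18)%N = k); last by lia.
rewrite !size_polyM_le //.
- exact: (@hformX C C idfun 8 _ Wp 0 0 size_Wp).2.
- exact: (@hformX C C idfun 12 _ Ep 0 0 sE).2.
- exact: (@hformX C C idfun 18 _ Vp 0 0 sV).2.
Qed.

Lemma hf_Bp k i x y : ~~ odd k -> (i < nB k)%N -> hf k (Bp k i) x y =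
  Wf x y ^+ (3 * i + (k %/ 2) %% 3) * Ef x y ^+ eB k i * Vf x y ^+ ((k %/ 2) %% 2).
Proof.
move=> ko ik.
have [sE sV] := (size_Ep, size_Vp).
have hE : hf 12 Ep x y = Ef x y.
  by rewrite Ef_tf -[12%N]/(2 * 6)%N /Ep (hformX idfun _ _ _ _).1 ?size_Tp5 // hf_Tp5.
have hV : hf 18 Vp x y = Vf x y.
  by rewrite Vf_tf -[18%N]/(6 + 12)%N /Vp hformM ?size_Tp5 ?size_Chip // hf_Tp5 hf_Chip.
have [eW lW] := @hformX C C idfun 8 (3 * i + (k %/ 2) %% 3) Wp x y size_Wp.
have [eE lE] := @hformX C C idfun 12 (eB k i) Ep x y sE.
have [eV lV] := @hformX C C idfun 18 ((k %/ 2) %% 2) Vp x y sV.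
have ek := exps_of_index ko ik.
rewrite -[k in hf k _](_ : ((3 * i + (k %/ 2) %% 3) * 8 + eB k i * 12 + (k %/ 2) %% 2 * 18)%N = k);
  last by lia.
rewrite hformM ?size_polyM_le //.
by rewrite hformM // eW eE eV hf_Wp hE hV.
Qed.
Variables z8 r2 : C.
Hypotheses (z84 : z8 ^+ 4 = -1) (r22 : r2 ^+ 2 = 2%:R).

Let z80 : z8 != 0.
Proof. by apply/eqP => e; move/eqP: z84; rewrite e expr0n eq_sym oppr_eq0 oner_eq0. Qed.
Let r20 : r2 != 0.
Proof. by apply/eqP => e; move/eqP: r22; rewrite e expr0n eq_sym pnatr_eq0. Qed.

(* The three substitutions generate the binary octahedral group. *)
Definition octa k p (s : C) :=
  [/\ forall x y, hf k p (z8 * x + 0 * y) (0 * x + z8^-1 * y) = s * hf k p x y,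
      forall x y, hf k p (0 * x + 1 * y) (-1 * x + 0 * y) = 1 * hf k p x y &
      forall x y, hf k p (r2^-1 * x + r2^-1 * y) (- r2^-1 * x + r2^-1 * y) = s * hf k p x y].

Lemma octaB k p q s c : octa k p s -> octa k q s -> octa k (p - c *: q) s.
Proof.
move=> [p1 p2 p3] [q1 q2 q3].
by split=> x y; rewrite !hformB !hformZ (p1, p2, p3) (q1, q2, q3) /=; ring.
Qed.

Lemma octaM k l (p q : {poly C}) s s' : (size p <= k.+1)%N -> (size q <= l.+1)%N ->
  octa k p s -> octa l q s' -> octa (k + l) (p * q) (s * s').
Proof.
move=> sp sq [p1 p2 p3] [q1 q2 q3].
by split=> x y; rewrite !hformM // (p1, p2, p3) (q1, q2, q3); ring.
Qed.

Let z8V : z8^-1 = - z8 ^+ 3.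
Proof. by apply: (mulfI z80); rewrite mulfV // mulrN -exprS z84 opprK. Qed.
Let r2V : r2^-1 ^+ 2 = 2^-1.
Proof. by rewrite exprVn r22. Qed.

(** The first and third generators induce quarter turns of the octahedron, the second a half turn
    about an axis through two vertices. The sign [-1] is thus the character of the rotation group
    whose kernel is the tetrahedral group. *)
Lemma octa_T : octa 6 Tp5 (-1).
Proof.
split=> x y; rewrite !hf_Tp5 /tf.
- rewrite z8V; transitivity ((z8 ^+ 4) ^+ 4 * (- z8 ^+ 4 * (z8 ^+ 4 * (x * y ^+ 5)) * 0) + 
    (- (z8 ^+ 4) ^+ 2 * (x ^+ 5 * y) + (z8 ^+ 4) ^+ 4 * x * y ^+ 5)); first by ring.
  by rewrite z84; ring.
- by ring.
- transitivity ((r2^-1 ^+ 2) ^+ 3 * ((x + y) ^+ 5 * (y - x) - (x + y) * (y - x) ^+ 5)); first by ring.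
  by rewrite r2V; field.
Qed.

Lemma octa_W : octa 8 Wp 1.
Proof.
split=> x y; rewrite !hf_Wp /Wf.
- rewrite z8V; transitivity ((z8 ^+ 4) ^+ 2 * x ^+ 8 + 14%:R * (z8 ^+ 4) ^+ 4 * x ^+ 4 * y ^+ 4
   + (z8 ^+ 4) ^+ 6 * y ^+ 8); first by ring.
  by rewrite z84; ring.
- by ring.
- transitivity ((r2^-1 ^+ 2) ^+ 4 * ((x + y) ^+ 8 + 14%:R * (x + y) ^+ 4 * (y - x) ^+ 4
    + (y - x) ^+ 8)); first by ring.
  by rewrite r2V; field.
Qed.

Lemma octa_Chi : octa 12 Chip (-1).
Proof.
split=> x y; rewrite !hf_Chip /chif.
- rewrite z8V; transitivity ((z8 ^+ 4) ^+ 3 * x ^+ 12 - 33%:R * (z8 ^+ 4) ^+ 5 * x ^+ 8 * y ^+ 4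
    - 33%:R * (z8 ^+ 4) ^+ 7 * x ^+ 4 * y ^+ 8 + (z8 ^+ 4) ^+ 9 * y ^+ 12); first by ring.
  by rewrite z84; ring.
- by ring.
- transitivity ((r2^-1 ^+ 2) ^+ 6 * ((x + y) ^+ 12 - 33%:R * (x + y) ^+ 8 * (y - x) ^+ 4
    - 33%:R * (x + y) ^+ 4 * (y - x) ^+ 8 + (y - x) ^+ 12)); first by ring.
  by rewrite r2V; field.
Qed.

Lemma octa_Wn j : octa (j * 8) (Wp ^+ j) 1 /\ (size (Wp ^+ j) <= (j * 8).+1)%N.
Proof.
elim: j => [|j [IH sj]].
  rewrite mul0n expr0 size_poly1; split=> //.
  by split=> x y; rewrite /hform !big_ord1 coef1 /= !expr0; ring.
rewrite exprS mulSn -[1]mulr1; split; first by apply: octaM => //; [exact: size_Wp|exact: octa_W].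
by apply: (leq_trans (size_polyMleq _ _)); have := size_Wp; lia.
Qed.

Lemma z8_order n : z8 ^+ n = 1 -> (n %% 8 = 0)%N.
Proof.
rewrite {1}(divn_eq n 8) mulnC exprD exprM (_ : z8 ^+ 8 = 1); last first.
  by rewrite -[8%N]/(4 * 2)%N exprM z84; ring.
rewrite expr1n mul1r; have : (n %% 8 < 8)%N by rewrite ltn_mod.
move: (n %% 8)%N => r hr e; apply/eqP; apply: contraT => r0.
have N11 : (-1 : C) != 1 by rewrite eq_sym -subr_eq0 opprK -mulr2n pnatr_eq0.
have ro : odd r = false.
  apply: contraNF N11 => ro; have : (-1 : C) ^+ r = 1 by rewrite -z84 -exprM mulnC exprM e expr1n.
  by rewrite -signr_odd ro expr1 => ->.
have e2 : z8 ^+ (2 * r) = 1 by rewrite mulnC exprM e expr1n.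
move: hr r0 ro e e2; do 8?[case: r => [|r]] => // _ _ _ e e2; exfalso; move/eqP: N11; apply.
- by rewrite -z84.
- by rewrite -z84.
- by rewrite -[RHS]e2 -[(2 * 6)%N]/(4 * 3)%N exprM z84; ring.
Qed.

(** The top coefficient is the value at the vertex (1:0), which the first generator multiplies by
    [z8 ^+ k]. With [z8_order] this fixes [k] modulo 8. *)
Lemma octa_top k (p : {poly C}) s : octa k p s -> p`_k != 0 -> z8 ^+ k = s.
Proof.
case=> h _ _ pk; have := h 1 0; rewrite !mulr1 !mulr0 !addr0 hform10 /=.
rewrite -[X in hf k p X _]mulr1 -[X in hf k p _ X](mulr0 z8) hform_scale hform10 /=.
exact: mulIf.
Qed.

(** The generators carry (1:0) to the five other vertices, so a semi-invariant form that vanishes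
    there vanishes at all vertices and contains [t]. The quotient has the opposite sign because [t]
    has sign -1. *)
Lemma octa_divT k (p : {poly C}) s : (size p <= k.+1)%N -> octa k p s -> p`_k = 0 ->
  p = 0 \/ exists q : {poly C}, [/\ (6 <= k)%N, (size q <= (k - 6).+1)%N, p = q * Tp5 & octa (k - 6) q (- s)].
Proof.
move=> sp ho pk; have [h1 h2 h3] := ho.
have v10 : hf k p 1 0 = 0 by rewrite hform10.
have v01 : hf k p 0 1 = 0.
  by rewrite -[RHS]v10 -[hf k p 0 1]mul1r -h2; congr (hf _ _ _ _); ring.
have v11 : hf k p 1 1 = 0.
  have := h3 0 1; rewrite v01 !mulr0 !add0r.
  rewrite hform_scale => /eqP; rewrite mulf_eq0 expf_eq0 invr_eq0 (negPf r20) andbF.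
  by move/eqP.
have v1N : hf k p (-1) 1 = 0.
  have := h3 1 0; rewrite v10 mulr0 !mulr0 !addr0 mulNr -mulrN.
  rewrite hform_scale => /eqP; rewrite mulf_eq0 expf_eq0 invr_eq0 (negPf r20) andbF /=.
  move/eqP => e; rewrite -[X in hf k p _ X]opprK -[X in hf k p X _]mulN1r -[X in hf k p _ X]mulN1r.
  by rewrite hform_scale e mulr0.
have rot x : hf k p x 1 = 0 -> hf k p (z8 ^+ 2 * x) 1 = 0.
  move=> e; have := h1 x 1; rewrite e mulr0 !mul0r addr0 add0r.
  have -> : z8 * x = z8^-1 * (z8 ^+ 2 * x) by field.
  rewrite hform_scale => /eqP; rewrite mulf_eq0 expf_eq0 invr_eq0 (negPf z80) andbF.
  by move/eqP.
have vi := rot _ v11; have vNi := rot _ v1N; rewrite mulr1 in vi; rewrite mulrN1 in vNi.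
have N11 : (-1 : C) != 1 by rewrite eq_sym -subr_eq0 opprK -mulr2n pnatr_eq0.
pose I := z8 ^+ 2.
have I2 : I ^+ 2 = -1 by rewrite -exprM z84.
have I0 : I != 0 by rewrite expf_eq0 (negPf z80).
have I1 : I != 1 by apply: contra N11 => /eqP e; rewrite -I2 e expr1n.
have IN1 : I != -1 by apply: contra N11 => /eqP e; rewrite -I2 e sqrrN expr1n.
have INI : I != - I by rewrite -subr_eq0 opprK -mulr2n -mulr_natl mulf_neq0 // pnatr_eq0.
have dv : Tp5 %| p.
  have -> : Tp5 = \prod_(z <- [:: 0; 1; -1; I; - I]) ('X - z%:P).
    rewrite !big_cons big_nil.
    transitivity ('X * ('X^2 - 1%:P) * ('X^2 - (I ^+ 2)%:P)) => [|]; last first.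
      by rewrite !rmorphN rmorphXn /= rmorph1 rmorph0; ring.
    by rewrite I2 /Tp5 !rmorphN rmorph1; ring.
  apply: uniq_roots_dvdp; first by rewrite /= !rootE -!(@hf_y1 k) // v01 v11 v1N vi vNi eqxx.
  rewrite uniq_rootsE /= !inE !negb_or ![0 == _]eq_sym !oppr_eq0 I0 oner_eq0.
  by rewrite ![1 == _]eq_sym N11 I1 eqr_oppLR IN1 [-1 == I]eq_sym IN1 eqr_opp [1 == I]eq_sym I1 INI.
have [p0|p0] := eqVneq p 0; [by left|right].
have := divpK dv; set q := p %/ Tp5 => e.
have q0 : q != 0 by apply: contra p0 => /eqP q0; rewrite -e q0 mul0r.
(* The sixth vertex lies at infinity: the vanishing top coefficient lowers the size by one, so that
   the quotient by a polynomial of degree 5 still fits the form degree [k - 6]. *)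
have sqT : (size p <= k)%N.
  apply/leq_sizeP => j; rewrite leq_eqVlt => /orP [/eqP <- //|jk].
  by rewrite nth_default // (leq_trans sp).
have T0 : Tp5 != 0 by rewrite -size_poly_eq0 size_Tp5.
have sq : (size p = size q + 5)%N by rewrite -e size_mul // size_Tp5 !addnS addn0.
have sq0 : (0 < size q)%N by rewrite lt0n size_poly_eq0.
have k6 : (6 <= k)%N by clear - sq sqT sq0; lia.
have sq' : (size q <= (k - 6).+1)%N by clear - sq sqT; lia.
exists q; split=> //.
have [t1 t2 t3] := octa_T.
have hM x y : hf k p x y = hf (k - 6) q x y * tf x y.
  by rewrite -e -[k in LHS](subnK k6) hformM ?size_Tp5 // hf_Tp5.
split; apply: tf_cancel => x y.
- have := h1 x y; rewrite !hM; have := t1 x y; rewrite !hf_Tp5 => -> h.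
  have -> : tf x y * (hf (k - 6) q (z8 * x + 0 * y) (0 * x + z8^-1 * y) - - s * hf (k - 6) q x y)
    = - (hf (k - 6) q (z8 * x + 0 * y) (0 * x + z8^-1 * y) * (-1 * tf x y)) +
      s * (hf (k - 6) q x y * tf x y) by ring.
  by rewrite h addNr.
- have := h2 x y; rewrite !hM; have := t2 x y; rewrite !hf_Tp5 => -> h.
  by rewrite mulrBr [tf x y * _]mulrC -[tf x y in X in X - _]mul1r h; ring.
- have := h3 x y; rewrite !hM; have := t3 x y; rewrite !hf_Tp5 => -> h.
  have -> : tf x y * (hf (k - 6) q (r2^-1 * x + r2^-1 * y) (- r2^-1 * x + r2^-1 * y) - - s * hf (k - 6) q x y)
    = - (hf (k - 6) q (r2^-1 * x + r2^-1 * y) (- r2^-1 * x + r2^-1 * y) * (-1 * tf x y)) +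
      s * (hf (k - 6) q x y * tf x y) by ring.
  by rewrite h addNr.
Qed.

(** The degree in which no chi W^j is available to cancel the top coefficient c. By the generators c
    is also the value at (0:1), and each of the four vertices (u:1) with u^4 = 1 has value -4c.
    Comparing their sum with the coefficients gives -16c = 8c. *)
Lemma octa4 (p : {poly C}) : octa 4 p (-1) -> p`_4 = 0.
Proof.
case=> h1 h2 h3.
have v10 : hf 4 p 1 0 = p`_4 by rewrite hform10.
have v01 : hf 4 p 0 1 = p`_4.
  by rewrite -[RHS]v10 -[hf 4 p 0 1]mul1r -h2; congr (hf _ _ _ _); ring.
have v11 : hf 4 p 1 1 = - 4%:R * p`_4.
  have := h3 0 1; rewrite v01 !mulr0 !add0r hform_scale (_ : r2^-1 ^+ 4 = 2^-1 ^+ 2) => [e|]; last by rewrite -r2V -exprM.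
  have -> : hf 4 p 1 1 = 4%:R * (2^-1 ^+ 2 * hf 4 p 1 1) by field.
  by rewrite e; ring.
have rot x : hf 4 p (z8 ^+ 2 * x) 1 = hf 4 p x 1.
  have := h1 x 1; rewrite !mul0r addr0 add0r.
  have -> : z8 * x = z8^-1 * (z8 ^+ 2 * x) by field.
  by rewrite hform_scale exprVn z84 invrN1 => /mulfI -> //; rewrite oppr_eq0 oner_eq0.
have v0 := rot 1; have v1 := rot (z8 ^+ 2 * 1); have v2 := rot (z8 ^+ 2 * (z8 ^+ 2 * 1)).
(* Summing over the fourth roots of unity keeps only the coefficients of index 0 and 4. *)
have : 4%:R * hf 4 p 1 1 = 4%:R * (p`_4 + hf 4 p 0 1).
  transitivity (hf 4 p 1 1 + hf 4 p (z8 ^+ 2 * 1) 1 + hf 4 p (z8 ^+ 2 * (z8 ^+ 2 * 1)) 1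
     + hf 4 p (z8 ^+ 2 * (z8 ^+ 2 * (z8 ^+ 2 * 1))) 1); first by rewrite v2 v1 v0; ring.
  have e3 : z8 ^+ 2 * (z8 ^+ 2 * (z8 ^+ 2 * 1)) = - z8 ^+ 2.
    by transitivity (z8 ^+ 4 * z8 ^+ 2); [ring | rewrite z84; ring].
  have e2 : z8 ^+ 2 * (z8 ^+ 2 * 1) = -1 by rewrite mulr1 -exprD z84.
  rewrite e3 e2 mulr1; have I2 : (z8 ^+ 2) ^+ 2 = -1 by rewrite -exprM z84.
  move: (z8 ^+ 2) I2 => I I2; rewrite /hform !big_ord_recl !big_ord0 /= /bump /=.
  have -> : I ^+ 4 = 1 by rewrite -[4%N]/(2 * 2)%N exprM I2; ring.
  have -> : (- I) ^+ 4 = 1 by rewrite -[4%N]/(2 * 2)%N exprM sqrrN I2; ring.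
  have -> : (- I) ^+ 3 = I by rewrite exprS sqrrN I2; ring.
  have -> : I ^+ 3 = - I by rewrite exprS I2; ring.
  by rewrite !addn0 !add1n !sqrrN I2 !expr1n ?expr0n /=; ring.
rewrite v11 v01 => e; have : 24%:R * p`_4 = 0.
  transitivity (4%:R * (p`_4 + p`_4) - 4%:R * (- 4%:R * p`_4)); first by ring.
  by rewrite e subrr.
by move/eqP; rewrite mulf_eq0 pnatr_eq0 => /eqP.
Qed.

(** The fourth power of the first generator is minus the identity, which acts on forms of degree [k]
    by [(-1) ^+ k]. *)
Lemma octa_odd k (p : {poly C}) s : odd k -> (size p <= k.+1)%N -> s ^+ 2 = 1 -> octa k p s -> p = 0.
Proof.
move=> ko sp s1 [h _ _]; apply: (hf_inj sp) => z.
have h4 x y : hf k p (z8 ^+ 4 * x) (z8^-1 ^+ 4 * y) = hf k p x y.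
  have e x' y' : hf k p (z8 * x') (z8^-1 * y') = s * hf k p x' y'.
    by rewrite -h !mul0r addr0 add0r.
  rewrite !exprS !expr0 !mulr1 -!mulrA !e.
  have -> : forall u, s * (s * (s * (s * u))) = (s ^+ 2) ^+ 2 * u by move=> u; ring.
  by rewrite s1 expr1n mul1r.
have := h4 z 1; rewrite exprVn z84 invrN1 hform_scale -signr_odd ko expr1.
move=> e; have : 2%:R * hf k p z 1 = 0 by rewrite mulr_natl mulr2n -{1}e mulN1r addNr.
by move/eqP; rewrite mulf_eq0 pnatr_eq0 => /eqP.
Qed.

Theorem octa_span k (p : {poly C}) : (size p <= k.+1)%N -> octa k p 1 ->
  inspan k p /\ (odd k -> p = 0).
Proof.
elim/ltn_ind: k p => k IH p sp ho.
have [ko|ko] := boolP (odd k).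
  have -> : p = 0 by apply: octa_odd sp _ ho => //; rewrite expr1n.
  by split=> //; apply: inspan0.
split=> //.
(* A nonzero value at (1:0) forces 8 to divide [k], and [Wp] has value 1 there; subtracting a
   multiple of a power of [Wp] leaves a form vanishing at that vertex. *)
suff key (q : {poly C}) : (size q <= k.+1)%N -> octa k q 1 -> q`_k = 0 -> inspan k q.
  have [pk|pk] := eqVneq p`_k 0; first exact: key.
  have k8 := z8_order (octa_top ho pk).
  pose j := (k %/ 8)%N; have ej : (j * 8 = k)%N by rewrite /j; lia.
  have [oW sW] := octa_Wn j; rewrite ej in oW sW.
  have -> : p = (p - p`_k *: Wp ^+ j) + p`_k *: Wp ^+ j by rewrite subrK.
  apply: inspanD; last first.
    apply: inspanZ; have := @inspan_mon k j 0 0; rewrite !expr0 !mulr1; apply=> //; lia.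
  apply: key; last 2 first.
  - exact: octaB.
  - rewrite coefB coefZ (_ : (Wp ^+ j)`_k = 1) ?mulr1 ?subrr //.
    rewrite -[LHS]/(idfun _) -(hform10 idfun) -ej (hformX idfun _ _ _ size_Wp).1 hf_Wp /Wf.
    by rewrite expr1n !expr0n /= mulr0 !addr0 expr1n.
  by rewrite size_polyD_le // size_polyN (leq_trans (size_scale_leq _ _)).
move=> sq oq qk; have [->|[q1 [k6 sq1 -> oq1]]] := octa_divT sq oq qk.
  exact: inspan0.
(* The quotient by [t] has sign -1. If it vanishes at (1:0) as well, a second division splits off
   [Ep] and leaves an invariant form of degree [k - 12] for the induction. *)
have key2 (u : {poly C}) : (size u <= (k - 6).+1)%N -> octa (k - 6) u (-1) -> u`_(k - 6) = 0 ->
    inspan k (u * Tp5).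
  move=> su ou uk; have [->|[u1 [k12 su1 -> ou1]]] := octa_divT su ou uk.
    by rewrite mul0r; apply: inspan0.
  rewrite opprK in ou1; rewrite -mulrA -expr2 -/Ep.
  have ek : k = (k - 6 - 6 + 12)%N by lia.
  rewrite ek; apply: inspan_mulE; first by lia.
  have lk : (k - 6 - 6 < k)%N by clear - k6; lia.
  exact: (IH _ lk _ su1 ou1).1.
have [q1k|q1k] := eqVneq q1`_(k - 6) 0; first exact: key2.
have := octa_top oq1 q1k => z6.
(* Both [z8 ^+ (k - 6)] and [z8 ^+ 4] equal -1, so their product is 1. *)
have k64 : ((k - 6 + 4) %% 8 = 0)%N.
  by apply: z8_order; rewrite exprD z6 z84; ring.
(* Once degree 4 is excluded, [k - 6 = 12 + 8 j], and chi W^j serves to cancel the top coefficient.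
   Multiplied by [t] it becomes [Wp ^+ j * Vp], which is in the span. *)
have [k4|k4] := eqVneq (k - 6)%N 4%N.
  by move: q1k; rewrite k4 octa4 ?eqxx // -k4.
pose j := ((k - 18) %/ 8)%N; have ej : (12 + j * 8 = k - 6)%N by rewrite /j; lia.
have [oW sW] := octa_Wn j.
have := octaM size_Chip sW octa_Chi oW; rewrite ej mulr1 => oCW.
have sCW : (size (Chip * Wp ^+ j)%R <= (k - 6).+1)%N.
  apply: (leq_trans (size_polyMleq _ _)); have := size_Chip; lia.
have -> : q1 * Tp5 = (q1 - q1`_(k - 6) *: (Chip * Wp ^+ j)) * Tp5
    + q1`_(k - 6) *: (Wp ^+ j * Vp).
  by rewrite /Vp -!mul_polyC; ring.
apply: inspanD; last first.
  apply: inspanZ; have := @inspan_mon k j 0 1; rewrite !expr0 !mulr1 expr1; apply=> //; lia.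
apply: key2; last 2 first.
- exact: octaB.
- rewrite coefB coefZ (_ : (Chip * Wp ^+ j)`_(k - 6) = 1) ?mulr1 ?subrr //.
  rewrite -[LHS]/(idfun _) -(hform10 idfun) -ej hformM ?size_Chip // (hformX idfun _ _ _ size_Wp).1.
  rewrite hf_Wp hf_Chip /Wf /chif.
  by rewrite !expr1n !expr0n /= !mulr0 !addr0 !subr0 expr1n mulr1.
by rewrite size_polyD_le // size_polyN (leq_trans (size_scale_leq _ _)).
Qed.

End OctahedralForms.

(** * Smooth functions off the origin *)

Section Calculus.
Local Open Scope classical_set_scope.
Local Open Scope ring_scope.
Variables (R : realType) (V : normedModType R).
Implicit Types (f : V -> R) (x v w : V).

Lemma near_norm x (P : V -> Prop) :
  (\forall y \near x, P y) -> exists2 d : R, 0 < d & forall y, `|y - x| < d -> P y.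
Proof.
move=> /nbhs_normP [d d0 hd]; exists d => // y hy; apply: hd.
by rewrite /ball_ /= distrC.
Qed.

Lemma is_derive_cvg f x v (l : R) :
  (fun h : R => h^-1 * (f (x + h *: v) - f x)) @ 0^' --> l -> is_derive x v f l.
Proof.
move=> h.
have e : (fun h => h^-1 *: ((f \o shift x) (h *: v) - f x)) =
         (fun h : R => h^-1 * (f (x + h *: v) - f x)).
  by apply/funext => t /=; rewrite [t *: v + x]addrC.
split; first by rewrite /derivable e; apply: cvgP h.
by rewrite /derive e; apply/cvg_lim.
Qed.

Lemma cvg_is_derive f x v : derivable f x v ->
  (fun h : R => h^-1 * (f (x + h *: v) - f x)) @ 0^' --> 'D_v f x.
Proof.
have e : (fun h => h^-1 *: ((f \o shift x) (h *: v) - f x)) =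
         (fun h : R => h^-1 * (f (x + h *: v) - f x)).
  by apply/funext => t /=; rewrite [t *: v + x]addrC.
by rewrite /derivable /derive e.
Qed.

Lemma is_derive_translate f x v z l : is_derive (x + z) v f l ->
  is_derive x v (fun y => f (y + z)) l.
Proof.
have e : (fun h => h^-1 *: ((f \o shift (x + z)) (h *: v) - f (x + z))) =
  (fun h => h^-1 *: (((fun y => f (y + z)) \o shift x) (h *: v) - f (x + z))).
  by apply/funext => h /=; rewrite addrA.
by case; rewrite /derivable /derive e => h h'; split; rewrite /derivable /derive.
Qed.

Lemma is_derive_slice f x v t : derivable f (x + t *: v) v ->
  is_derive t 1 (fun s : R => f (x + s *: v)) ('D_v f (x + t *: v)).
Proof.
have e : (fun h => h^-1 *: ((f \o shift (x + t *: v)) (h *: v) - f (x + t *: v))) =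
  (fun h => h^-1 *: (((fun s : R => f (x + s *: v)) \o shift t) (h *: 1) - f (x + t *: v))).
  by apply/funext => h /=; rewrite [h *: 1]mulr1 scalerDl addrCA.
by rewrite /derivable => h; split; rewrite /derivable /derive -e.
Qed.

Lemma slice_mvt f x v (h : R) :
  (forall s : R, `|s| <= `|h| -> derivable f (x + s *: v) v) ->
  exists2 t : R, `|t| <= `|h| & f (x + h *: v) - f x = h * 'D_v f (x + t *: v).
Proof.
move=> hd; have [h0|h0] := leP 0 h.
  have hs s : s \in `[0, h] -> `|s| <= `|h|.
    by rewrite in_itv /= => /andP [s0 sh]; rewrite !ger0_norm.
  have [||t th] := @MVT_segment R (fun s => f (x + s *: v)) (fun s => 'D_v f (x + s *: v)) 0 h h0.
  - move=> s hs'; apply: is_derive_slice; apply: hd; apply: hs.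
    by apply: subset_itv_oo_cc.
  - apply: derivable_within_continuous => s /hs /hd hh; by have [] := is_derive_slice hh.
  by rewrite scale0r addr0 subr0 mulrC => e; exists t => //; apply: hs.
have hs s : s \in `[h, 0] -> `|s| <= `|h|.
  by rewrite in_itv /= => /andP [s0 sh]; rewrite !ler0_norm // ?lerN2 // ltW.
have [||t th] := @MVT_segment R (fun s => f (x + s *: v)) (fun s => 'D_v f (x + s *: v)) h 0 (ltW h0).
- move=> s hs'; apply: is_derive_slice; apply: hd; apply: hs.
  by apply: subset_itv_oo_cc.
- apply: derivable_within_continuous => s /hs /hd hh; by have [] := is_derive_slice hh.
rewrite scale0r addr0 sub0r mulrN => /eqP; rewrite -opprB eqr_opp => /eqP e.
by exists t; [apply: hs | rewrite e mulrC].
Qed.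

(** By the mean value theorem the increment along [w] is [h * c] times ['D_w f] at a nearby point,
    and ['D_w f] is continuous at [x]. Iterated over the basis, this leads from partial to
    directional derivatives. *)
Lemma is_derive_addv f x v w (c l : R) : is_derive x v f l ->
  (\forall y \near x, derivable f y w) -> {for x, continuous ('D_w f)} ->
  is_derive x (v + c *: w) f (l + c * 'D_w f x).
Proof.
move=> [dv <-] /near_norm [d1 d10 hd1] cw.
apply: is_derive_cvg.
have -> : (fun h : R => h^-1 * (f (x + h *: (v + c *: w)) - f x)) =
  (fun h : R => h^-1 * (f (x + h *: v) - f x)) \+
  (fun h : R => h^-1 * (f ((x + h *: v) + (h * c) *: w) - f (x + h *: v))).
  apply/funext => h /=; rewrite -mulrDr; congr (_ * _).
  by rewrite scalerDr scalerA addrA; ring.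
apply: cvgD; first exact: cvg_is_derive.
apply/cvgrPdist_lt => e e0.
pose e' := e / (`|c| + 1); have c1 : 0 < `|c| + 1 by rewrite ltr_wpDl.
have e'0 : 0 < e' by rewrite divr_gt0.
move/cvgrPdist_lt/(_ e' e'0)/near_norm : cw => [d2 d20 hd2].
pose M := `|v| + `|c| * `|w| + 1.
have M0 : 0 < M by rewrite ltr_wpDl // addr_ge0 // mulr_ge0.
pose d := Num.min d1 d2 / M; have d0 : 0 < d by rewrite divr_gt0 // lt_min d10.
near=> h.
have hnz : h != 0 by near: h; exact: nbhs_dnbhs_neq.
have hd : `|h| < d by near: h; exact: dnbhs0_lt.
have bound (s : R) : `|s| <= `|h * c| -> `|(x + h *: v) + s *: w - x| < Num.min d1 d2.
  move=> hs; rewrite -[x + _ + _]addrA [x + _]addrC addrK.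
  apply: (@le_lt_trans _ _ (`|h| * M)); last by rewrite -ltr_pdivlMr.
  apply: (le_trans (ler_normD _ _)); rewrite !normrZ.
  have : `|s| * `|w| <= `|h| * (`|c| * `|w|) by rewrite mulrA -normrM ler_wpM2r.
  move: (normr_ge0 h) => ? ?; rewrite /M !mulrDr mulr1; lra.
have [t ht ->] : exists2 t : R, `|t| <= `|h * c| &
    f (x + h *: v + (h * c) *: w) - f (x + h *: v) = h * c * 'D_w f (x + h *: v + t *: w).
  apply: slice_mvt => s /bound; rewrite lt_min => /andP [hs _]; exact: hd1.
rewrite [h^-1 * _]mulrA [h^-1 * _]mulrA mulVf // mul1r -mulrBr normrM.
have /bound := ht; rewrite lt_min => /andP [_ /hd2 hlt].
apply: (@le_lt_trans _ _ (`|c| * e')); first by rewrite ler_wpM2l // ltW.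
by rewrite /e' mulrCA gtr_pMr // ltr_pdivrMr // mul1r ltrDl.
Unshelve. all: by end_near. Qed.

Lemma is_derive_mvt f df x v (h : R) :
  (forall s : R, `|s| <= `|h| -> is_derive (x + s *: v) v f (df s)) ->
  exists2 t : R, `|t| <= `|h| & f (x + h *: v) - f x = h * df t.
Proof.
move=> hd; have [|t ht ->] := @slice_mvt f x v h.
  by move=> s /hd [g _]; exact: g.
by exists t => //; have [_ ->] := hd _ ht.
Qed.

(** Schwarz's theorem. The second difference [S] over a small parallelogram is [h ^+ 2] times one
    mixed derivative at a nearby point, and [h ^+ 2] times the other mixed derivative at another;
    continuity at [x] lets the parallelogram shrink. *)
Lemma derive_comm f fv fw fvw fwv x v w :
  (\forall y \near x, [/\ is_derive y v f (fv y), is_derive y w f (fw y),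
     is_derive y w fv (fvw y) & is_derive y v fw (fwv y)]) ->
  {for x, continuous fvw} -> {for x, continuous fwv} -> fvw x = fwv x.
Proof.
move=> /near_norm [d1 d10 hd1] c1 c2; apply/eqP; rewrite -subr_eq0 -normr_le0.
apply/ler_addgt0Pl => e e0; rewrite addr0.
have e20 : 0 < e / 2 by rewrite divr_gt0.
move/cvgrPdist_lt/(_ _ e20)/near_norm : c1 => [d2 d20 hd2].
move/cvgrPdist_lt/(_ _ e20)/near_norm : c2 => [d3 d30 hd3].
pose D := Num.min d1 (Num.min d2 d3).
have D0 : 0 < D by rewrite !lt_min d10 d20.
pose M := `|v| + `|w| + 1.
have M0 : 0 < M by rewrite ltr_wpDl // addr_ge0.
have [h h0 hM] : exists2 h : R, 0 < h & h * M < D.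
  exists (D / M / 2); first by rewrite !divr_gt0.
  by rewrite mulrAC divfK ?gt_eqF // ltr_pdivrMr // ltr_pMr // ltr1n.
have bound (s t : R) : `|s| <= `|h| -> `|t| <= `|h| -> `|x + s *: v + t *: w - x| < D.
  move=> hs ht; rewrite -[x + _ + _]addrA [x + _]addrC addrK.
  apply: (@le_lt_trans _ _ (`|h| * M)); last by rewrite gtr0_norm.
  apply: (le_trans (ler_normD _ _)); rewrite !normrZ.
  have : `|s| * `|v| <= `|h| * `|v| by rewrite ler_wpM2r.
  have : `|t| * `|w| <= `|h| * `|w| by rewrite ler_wpM2r.
  by move: (normr_ge0 h) => ? ? ?; rewrite /M !mulrDr mulr1; lra.
have h00 : `|0 : R| <= `|h| by rewrite normr0.
have hh : `|h| <= `|h| by [].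
have b1 s t : `|s| <= `|h| -> `|t| <= `|h| -> `|x + s *: v + t *: w - x| < d1.
  by move=> hs ht; apply: (lt_le_trans (bound _ _ hs ht)); rewrite ge_min lexx.
pose S := f (x + h *: v + h *: w) - f (x + h *: v) - (f (x + h *: w) - f x).
have [s hs es] : exists2 s, `|s| <= `|h| & S =
    h * (fv (x + s *: v + h *: w) - fv (x + s *: v)).
  have [|s hs e'] := @is_derive_mvt (fun y => f (y + h *: w) - f y)
    (fun s => fv (x + s *: v + h *: w) - fv (x + s *: v)) x v h.
    move=> r hr; have := b1 r 0 hr h00; rewrite scale0r addr0 => /hd1 [g1 _ _ _].
    have [g2 _ _ _] := hd1 _ (b1 r h hr hh).
    by apply: is_deriveB; apply: is_derive_translate.
  by exists s.
have [t ht et] : exists2 t, `|t| <= `|h| &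
    fv (x + s *: v + h *: w) - fv (x + s *: v) = h * fvw (x + s *: v + t *: w).
  apply: (@is_derive_mvt fv (fun t => fvw (x + s *: v + t *: w))) => t ht.
  by have [_ _ g _] := hd1 _ (b1 s t hs ht); exact: g.
have [s' hs' es'] : exists2 s, `|s| <= `|h| & S =
    h * (fw (x + s *: w + h *: v) - fw (x + s *: w)).
  have [|r hr e'] := @is_derive_mvt (fun y => f (y + h *: v) - f y)
    (fun s => fw (x + s *: w + h *: v) - fw (x + s *: w)) x w h.
    move=> r hr; have := b1 0 r h00 hr; rewrite scale0r addr0 => /hd1 [_ g1 _ _].
    have [_ g2 _ _] := hd1 _ (b1 h r hh hr); rewrite addrAC in g2.
    by apply: is_deriveB; apply: is_derive_translate.
  exists r => //; rewrite -e' /S [x + h *: w + _]addrAC.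
  move: (f _) (f _) (f _) (f _) => *; ring.
have [t' ht' et'] : exists2 t, `|t| <= `|h| &
    fw (x + s' *: w + h *: v) - fw (x + s' *: w) = h * fwv (x + s' *: w + t *: v).
  apply: (@is_derive_mvt fw (fun t => fwv (x + s' *: w + t *: v))) => t' ht'.
  by rewrite addrAC; have [_ _ _ g] := hd1 _ (b1 t' s' ht' hs'); exact: g.
have hn : h != 0 by rewrite gt_eqF.
have key : fvw (x + s *: v + t *: w) = fwv (x + t' *: v + s' *: w).
  by apply: (mulfI hn); apply: (mulfI hn); rewrite -et -es es' et' addrAC.
have b2 := bound _ _ hs ht; have b3 := bound _ _ ht' hs'.
move: b2 b3; rewrite !lt_min => /and3P [_ /hd2 g2 _] /and3P [_ _ /hd3 g3].
rewrite -key in g3; apply: ltW; apply: (le_lt_trans (ler_distD (fvw (x + s *: v + t *: w)) _ _)).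
by rewrite [X in _ < X]splitr ltrD // distrC.
Qed.

End Calculus.

(** * Functions of class C^n off the origin, the norm, the maximum principle *)

Section SmoothFunctions.
Local Open Scope classical_set_scope.
Local Open Scope ring_scope.
Variable R : realType.
Notation pt := (pt R).
Implicit Types (f g : pt -> R) (u v : pt).

Lemma nz_near u : u != 0 -> \forall v \near u, v != 0.
Proof.
move=> u0; apply/nbhs_normP; exists `|u|; first by rewrite /= normr_gt0.
move=> v /=; rewrite /ball_ /=; apply: contraTneq => ->.
by rewrite subr0 ltxx.
Qed.

Definition C1nz g := forall u, u != 0 ->
  {for u, continuous g} /\ (forall j, derivable g u (ebasis R j)).

(** [smooth_nz] cut off at order [n], with the first derivative peeled off, so that closure under
    products is an induction on [n]. *)
Fixpoint Cnz n g :=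
  C1nz g /\ (if n is n'.+1 then forall j, Cnz n' (rpd j g) else True).

Lemma CnzC1 n g : Cnz n g -> C1nz g. Proof. by case: n => [|n] []. Qed.

Lemma smooth_nzP g : smooth_nz g <-> forall n, Cnz n g.
Proof.
have rc s j h : itpd (rcons s j) h = itpd s (rpd j h) by rewrite /itpd -cats1 foldr_cat.
split=> [h n|h s].
  elim: n g h => [|n IH] g h; (split; first by move=> u u0; exact: (h [::] u u0)); first exact: I.
  by move=> j; apply: IH => s u u0; rewrite -rc; apply: h.
elim/last_ind: s g h => [|s j IH] g h u u0; first exact: (h 0%N).1.
by rewrite rc; apply: IH => // n; have [_ +] := h n.+1; apply.
Qed.

Lemma rpd_ext j f g : (forall u, u != 0 -> f u = g u) ->
  forall u, u != 0 -> rpd j f u = rpd j g u.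
Proof.
move=> fg u u0; rewrite /rpd; apply: near_eq_derive.
by apply: filterS (nz_near u0) => v; apply: fg.
Qed.

Lemma C1nz_ext f g : (forall u, u != 0 -> f u = g u) -> C1nz f -> C1nz g.
Proof.
move=> fg hf u u0; have [cf df] := hf u u0.
have nfg : {near u, f =1 g} by apply: filterS (nz_near u0) => v; apply: fg.
split; last by move=> j; apply: near_eq_derivable (df j).
rewrite /prop_for /continuous_at -fg //; apply: cvg_trans cf.
exact: (near_eq_cvg nfg).
Qed.

Lemma Cnz_ext n f g : (forall u, u != 0 -> f u = g u) -> Cnz n f -> Cnz n g.
Proof.
elim: n f g => [|n IH] f g fg [h1 h2]; (split; first exact: C1nz_ext h1); first exact: I.
by move=> j; apply: IH (h2 j); apply: rpd_ext.
Qed.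

Lemma Cnz_cst n c : Cnz n (fun=> c).
Proof.
have h1 d : C1nz (fun=> d) by move=> u _; split=> [|j]; [exact: cst_continuous|exact: derivable_cst].
elim: n c => [|n IH] c; (split; first exact: h1); first exact: I.
move=> j.
by apply: (@Cnz_ext _ (fun=> 0) _ _ (IH 0)) => u _; rewrite /rpd derive_cst.
Qed.

Lemma is_derive_coord i u v : is_derive u v (fun w : pt => w 0 i) (v 0 i).
Proof.
apply: is_derive_cvg.
apply: cvg_near_cst; near=> h; have h0 : h != 0 by near: h; exact: nbhs_dnbhs_neq.
by rewrite !mxE addrAC subrr add0r mulrA mulVf // mul1r.
Unshelve. all: by end_near. Qed.

Lemma ebasisE i j : ebasis R i 0 j = (j == i)%:R.
Proof. by rewrite mxE eqxx. Qed.

Lemma rpd_coord i j u : rpd j (fun w : pt => w 0 i) u = (i == j)%:R.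
Proof. by have [_ e] := is_derive_coord i u (ebasis R j); rewrite /rpd e ebasisE. Qed.

Lemma C1nz_coord i : C1nz (fun w : pt => w 0 i).
Proof.
move=> u _; split; first exact: coord_continuous.
by move=> j; have [] := is_derive_coord i u (ebasis R j).
Qed.

Lemma Cnz_coord n i : Cnz n (fun w : pt => w 0 i).
Proof.
case: n => [|n]; (split; first exact: C1nz_coord); first exact: I.
by move=> j; apply: Cnz_ext (Cnz_cst n (i == j)%:R) => u _; rewrite rpd_coord.
Qed.

Lemma rpdD j f g : C1nz f -> C1nz g -> forall u, u != 0 ->
  rpd j (fun w => f w + g w) u = rpd j f u + rpd j g u.
Proof.
by move=> hf hg u u0; apply: (@deriveD _ _ _ f g u); [apply: (hf u u0).2 | apply: (hg u u0).2].
Qed.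
Lemma rpdM j f g : C1nz f -> C1nz g -> forall u, u != 0 ->
  rpd j (fun w => f w * g w) u = rpd j f u * g u + f u * rpd j g u.
Proof.
move=> hf hg u u0; rewrite addrC [rpd j f u * _]mulrC.
by apply: (@deriveM _ _ f g u); [apply: (hf u u0).2 | apply: (hg u u0).2].
Qed.
Lemma C1nzD f g : C1nz f -> C1nz g -> C1nz (fun w => f w + g w).
Proof.
move=> hf hg u u0; have [cf df] := hf u u0; have [cg dg] := hg u u0; split.
  exact: (@continuousD _ _ _ f g).
by move=> j; apply: (@derivableD _ _ _ f g).
Qed.
Lemma C1nzM f g : C1nz f -> C1nz g -> C1nz (fun w => f w * g w).
Proof.
move=> hf hg u u0; have [cf df] := hf u u0; have [cg dg] := hg u u0; split.
  exact: (@continuousM _ _ f g).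
by move=> j; apply: (@derivableM _ _ f g).
Qed.
Lemma CnzD n f g : Cnz n f -> Cnz n g -> Cnz n (fun w => f w + g w).
Proof.
elim: n f g => [|n IH] f g [hf hf'] [hg hg']; (split; first exact: C1nzD); first exact: I.
move=> j; apply: Cnz_ext (IH _ _ (hf' j) (hg' j)) => u u0.
by rewrite rpdD.
Qed.
Lemma CnzS n f : Cnz n.+1 f -> Cnz n f.
Proof.
elim: n f => [|n IH] f [h1 h2]; first by split.
by split=> [|j]; [exact: h1 | apply: IH; apply: h2].
Qed.
Lemma CnzM n f g : Cnz n f -> Cnz n g -> Cnz n (fun w => f w * g w).
Proof.
elim: n f g => [|n IH] f g hf hg; have [hf1 hf2] := hf; have [hg1 hg2] := hg;
  (split; first exact: C1nzM); first exact: I.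
move=> j; apply: (@Cnz_ext _ (fun u => rpd j f u * g u + f u * rpd j g u)).
  by move=> u u0; rewrite rpdM.
apply: CnzD; apply: IH.
- exact: hf2.
- exact: CnzS.
- exact: CnzS.
- exact: hg2.
Qed.

Definition sqn u : R := \sum_(j < 4) u 0 j ^+ 2.
Definition rho u : R := (enorm u)^-1.

Lemma sqn_gt0 u : u != 0 -> 0 < sqn u.
Proof.
move=> u0; rewrite lt_def sumr_ge0 ?andbT => [|i _]; last exact: sqr_ge0.
apply: contra u0; rewrite psumr_eq0 => [/allP h|i _]; last exact: sqr_ge0.
apply/eqP/rowP => i; rewrite mxE; have /h := mem_index_enum i.
by rewrite /= sqrf_eq0 => /eqP.
Qed.
Lemma enorm_gt0 u : u != 0 -> 0 < enorm u.
Proof. by move=> /sqn_gt0; rewrite sqrtr_gt0. Qed.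
Lemma rho_gt0 u : u != 0 -> 0 < rho u.
Proof. by move=> /enorm_gt0; rewrite invr_gt0. Qed.
Lemma enorm2 u : enorm u ^+ 2 = sqn u.
Proof. by rewrite sqr_sqrtr // sumr_ge0 // => i _; exact: sqr_ge0. Qed.
Lemma rho2 u : u != 0 -> rho u ^+ 2 * sqn u = 1.
Proof. by move=> u0; rewrite exprVn enorm2 mulVf // gt_eqF // sqn_gt0. Qed.

Lemma Cnz_sqn n : Cnz n sqn.
Proof.
suff h (r : seq 'I_4) : Cnz n (fun u => \sum_(j <- r) u 0 j ^+ 2) by exact: h.
elim: r => [|j r IH].
  by apply: Cnz_ext (Cnz_cst n 0) => u _; rewrite big_nil.
apply: (@Cnz_ext _ (fun u => u 0 j * u 0 j + \sum_(j <- r) u 0 j ^+ 2)).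
  by move=> u _; rewrite big_cons expr2.
by apply: CnzD; [apply: CnzM; exact: Cnz_coord | exact: IH].
Qed.

Lemma C1nz_rho : C1nz rho.
Proof.
move=> u u0; have [cs ds] := (CnzC1 (Cnz_sqn 0)) u u0.
have s0 := sqn_gt0 u0; have e0 := enorm_gt0 u0.
split.
  apply: (@continuousV _ _ (fun v => enorm v)); first by rewrite gt_eqF.
  exact: (@continuous_comp _ _ _ sqn (@Num.sqrt R) u cs (@sqrt_continuous R _)).
move=> j; apply: (@derivableV _ _ (fun v => enorm v)); first by rewrite gt_eqF.
apply/derivable1P; apply/derivable1_diffP.
apply: (@differentiable_comp _ _ _ _ (fun h : R => sqn (h *: ebasis R j + u)) (@Num.sqrt R)).
  by apply/derivable1_diffP; apply: (derivable1P sqn u _).1; exact: ds.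
apply/derivable1_diffP; rewrite scale0r add0r.
by have [] := is_derive1_sqrt s0.
Qed.

Lemma rpd_sqn j u : u != 0 -> rpd j sqn u = 2 * u 0 j.
Proof.
move=> u0; rewrite /rpd /sqn.
have h (i : 'I_4) : is_derive u (ebasis R j) (fun w : pt => w 0 i ^+ 2)
    (2 * u 0 i * (i == j)%:R).
  have := @is_deriveX _ _ (fun w : pt => w 0 i) 2 u (ebasis R j) _ (is_derive_coord i u _).
  move=> h0; apply: is_derive_eq h0 _; rewrite ebasisE /GRing.scale /=; ring.
have := @is_derive_sum _ _ _ 4 (fun i (w : pt) => w 0 i ^+ 2) u (ebasis R j) _ h.
rewrite (_ : \sum_(i < 4) _ = fun w : pt => \sum_(i < 4) w 0 i ^+ 2); last first.
  by apply/funext => w; rewrite fct_sumE.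
case=> _ ->; rewrite (bigD1 j) //= eqxx mulr1 big1 ?addr0 // => i /negPf ->.
by rewrite mulr0.
Qed.

(** Obtained by differentiating [rho u ^+ 2 * sqn u = 1]. The result is again a polynomial in the
    coordinates and [rho], which makes smoothness of [rho] an induction. *)
Lemma rpd_rho j u : u != 0 -> rpd j rho u = - u 0 j * rho u ^+ 3.
Proof.
move=> u0; have hr := C1nz_rho; have hs := CnzC1 (Cnz_sqn 0).
have : rpd j (fun v => rho v * rho v * sqn v) u = 0.
  rewrite (@rpd_ext j _ (fun=> 1)) //; first by rewrite /rpd derive_cst.
  by move=> v v0; rewrite -expr2 rho2.
rewrite (@rpdM j (fun v => rho v * rho v) sqn (C1nzM hr hr) hs u u0).
rewrite (rpdM j hr hr u0) rpd_sqn // => e.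
have s0 : sqn u != 0 by rewrite gt_eqF // sqn_gt0.
have r0 : rho u != 0 by rewrite gt_eqF // rho_gt0.
have r2 := rho2 u0.
move: e; set p := rpd j rho u; set r := rho u in r0 r2 *; set q := sqn u in s0 r2 * => e.
have e' : p * r * q = - u 0 j * r ^+ 2 by lra.
have -> : p = (p * r * q) * r by transitivity (p * (r ^+ 2 * q)); [rewrite r2 mulr1 | ring].
by rewrite e'; ring.
Qed.

Lemma Cnz_rho n : Cnz n rho.
Proof.
elim: n => [|n IH]; (split; first exact: C1nz_rho); first exact: I.
move=> j; apply: (@Cnz_ext _ (fun u => (-1 * u 0 j) * (rho u * (rho u * rho u)))).
  by move=> u u0; rewrite rpd_rho //; ring.
apply: CnzM; first by apply: CnzM; [exact: Cnz_cst|exact: Cnz_coord].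
by apply: CnzM; [exact: IH | apply: CnzM; exact: IH].
Qed.

Lemma rpd_comm i j f : Cnz 2 f -> forall u, u != 0 -> rpd i (rpd j f) u = rpd j (rpd i f) u.
Proof.
move=> hf u u0.
apply: (@derive_comm _ _ f (rpd j f) (rpd i f) (rpd i (rpd j f)) (rpd j (rpd i f)) u
  (ebasis R j) (ebasis R i)); last 2 first.
- exact: (((hf.2 j).2 i).1 u u0).1.
- exact: (((hf.2 i).2 j).1 u u0).1.
apply: filterS (nz_near u0) => v v0.
have h1 := hf.1; have h2 k := (hf.2 k).1.
by split; apply: derivableP; [exact: (h1 v v0).2|exact: (h1 v v0).2|
  exact: (h2 j v v0).2|exact: (h2 i v v0).2].
Qed.

Lemma is_derive_dir f u v : Cnz 1 f -> u != 0 ->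
  is_derive u v f (\sum_(j < 4) v 0 j * rpd j f u).
Proof.
move=> hf u0; have [h1 h2] := hf.
have step (r : seq 'I_4) : is_derive u (\sum_(j <- r) v 0 j *: ebasis R j) f
    (\sum_(j <- r) v 0 j * rpd j f u).
  elim: r => [|j r IH]; first by rewrite !big_nil; exact: is_derive0.
  rewrite !big_cons addrC [X in is_derive _ _ _ X]addrC; apply: is_derive_addv => //.
    by apply: filterS (nz_near u0) => w w0; exact: (h1 w w0).2.
  exact: ((h2 j).1 u u0).1.
have := step (index_enum _); rewrite -(row_sum_delta v); exact.
Qed.

Lemma is_derive_line f u v t : Cnz 1 f -> u + t *: v != 0 ->
  is_derive t 1 (fun s : R => f (u + s *: v)) (\sum_(j < 4) v 0 j * rpd j f (u + t *: v)).
Proof.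
move=> hf h; have [h1 <-] := is_derive_dir v hf h.
exact: is_derive_slice.
Qed.

Lemma line_mvt f u v : Cnz 1 f -> (forall t, 0 <= t <= 1 -> u + t *: v != 0) ->
  exists2 t : R, 0 <= t <= 1 & f (u + v) - f u = \sum_(j < 4) v 0 j * rpd j f (u + t *: v).
Proof.
move=> hf h.
have [||t th] := @MVT_segment R (fun s => f (u + s *: v))
  (fun t => \sum_(j < 4) v 0 j * rpd j f (u + t *: v)) 0 1 ler01.
- move=> t /subset_itv_oo_cc; rewrite in_itv /= => ht; apply: is_derive_line => //; exact: h.
- apply: derivable_within_continuous => t; rewrite in_itv /= => ht.
  by have [] := is_derive_line hf (h t ht).
rewrite scale1r scale0r addr0 subr0 mulr1 => e; exists t => //.
Qed.

(** The complement of the origin is connected by segments: the one from [u] to a basis vector misses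
    0 unless [u] is a negative multiple of that vector, and then a detour through another basis
    vector is taken. *)
Lemma rpd0_const f : Cnz 1 f -> (forall j u, u != 0 -> rpd j f u = 0) ->
  forall u, u != 0 -> f u = f (ebasis R 0).
Proof.
move=> hf h0.
have seg u v : (forall t, 0 <= t <= 1 -> u + t *: (v - u) != 0) -> f u = f v.
  move=> huv; have [t ht] := line_mvt hf huv.
  rewrite big1 => [|j _]; last by rewrite h0 ?mulr0 // huv.
  by rewrite [u + _]addrC subrK => /eqP; rewrite subr_eq0 => /eqP.
have go u (i : 'I_4) : ~~ (u 0 i <= 0) || [exists j, (j != i) && (u 0 j != 0)] ->
    f u = f (ebasis R i).
  move=> hu; apply: seg => t /andP [t0 t1]; apply/eqP => /rowP e.
  have e1 : t = 1 \/ u 0 i <= 0.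
    have := e i; rewrite !mxE !eqxx => e'.
    have [->|t1'] := eqVneq t 1; [by left|right].
    have lt1 : t < 1 by rewrite lt_neqAle t1'.
    have : (1 - t) * u 0 i <= 0 by rewrite mulr1n in e'; nra.
    by rewrite pmulr_rle0 // subr_gt0.
  have ij j : j != i -> t = 1 \/ u 0 j = 0.
    move=> ji; have := e j; rewrite !mxE eqxx /= (negPf ji) => e'.
    have [->|t1'] := eqVneq t 1; [by left|right].
    have : (1 - t) * u 0 j = 0 by rewrite mulr0n in e'; lra.
    by move/eqP; rewrite mulf_eq0 subr_eq0 eq_sym (negPf t1') => /eqP.
  have t1' : t = 1.
    have /orP [h|/existsP [j /andP [ji uj]]] := hu; first by case: e1 => // h'; rewrite h' in h.
    by case: (ij j ji) => // uj0; rewrite uj0 eqxx in uj.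
  by have := e i; rewrite t1' !mxE !eqxx mulr1n => e'; lra.
have e10 : f (ebasis R 1) = f (ebasis R 0).
  apply: go; apply/orP; right; apply/existsP; exists 1.
  by apply/andP; split=> //; rewrite ebasisE eqxx pnatr_eq0.
move=> u u0; have [h|h] := boolP (~~ (u 0 0 <= 0) || [exists j, (j != 0) && (u 0 j != 0)]).
  exact: go.
rewrite -e10; apply: go; apply/orP; right; apply/existsP; exists 0; rewrite /=.
move: h; rewrite negb_or => /andP [_ /existsPn h].
apply: contra u0 => /eqP u00; apply/eqP/rowP => j; rewrite mxE.
by have [->//|j0] := eqVneq j 0; have := h j; rewrite j0 /= negbK => /eqP.
Qed.

Definition euler f u : R := \sum_(j < 4) u 0 j * rpd j f u.

Lemma hom0_euler f u : Cnz 1 f -> u != 0 ->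
  (forall t, 0 < t -> f (t *: u) = f u) -> euler f u = 0.
Proof.
move=> hf u0 hh.
have h0 : u + (0 : R) *: u != 0 by rewrite scale0r addr0.
have [_] := is_derive_line hf h0; rewrite scale0r addr0 -/(euler f u) => <-.
rewrite (near_eq_derive (g := cst (f u))) ?derive_cst //; near=> s.
rewrite /cst -(hh (1 + s)) ?scalerDl ?scale1r //.
have : `|s| < 1.
  near: s; apply/nbhs_normP; exists 1; first exact: ltr01.
  by move=> s; rewrite /ball_ /= sub0r normrN.
by rewrite ltr_norml => /andP [h _]; rewrite -ltrBlDl sub0r.
Unshelve. all: by end_near. Qed.

(** The derivative of [f] along the segment from [u] to [t *: u] is a multiple of [euler f], and the
    mean value theorem applies. *)
Lemma euler0_hom f u t : Cnz 1 f -> (forall u, u != 0 -> euler f u = 0) ->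
  u != 0 -> 0 < t -> f (t *: u) = f u.
Proof.
move=> hf he u0 t0.
have cs s : 0 <= s <= 1 -> 0 < 1 + s * (t - 1) by move=> /andP [s0 s1]; nra.
have es s : u + s *: ((t - 1) *: u) = (1 + s * (t - 1)) *: u.
  by rewrite scalerA scalerDl scale1r.
have [|s hs] := @line_mvt f u ((t - 1) *: u) hf.
  by move=> s hs; rewrite es scaler_eq0 negb_or u0 andbT gt_eqF // cs.
have -> : u + (t - 1) *: u = t *: u by rewrite scalerBl scale1r [u + _]addrC subrK.
rewrite es; set c := 1 + _ => e; have c0 : 0 < c by apply: cs.
have cu : c *: u != 0 by rewrite scaler_eq0 negb_or u0 andbT gt_eqF.
apply/eqP; rewrite -subr_eq0 e.
have := he _ cu; rewrite /euler => e0.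
have -> : \sum_(j < 4) ((t - 1) *: u) 0 j * rpd j f (c *: u) =
    (t - 1) / c * \sum_(j < 4) (c *: u) 0 j * rpd j f (c *: u).
  rewrite big_distrr; apply: eq_bigr => j _ /=; rewrite !mxE.
  by field; rewrite gt_eqF.
by rewrite e0 mulr0.
Qed.

(** If the second derivative were positive, the symmetrised function
    [F s = f (p + s e) + f (p - s e)], with derivative [g s - g (- s)], would increase from its
    value [2 f p] at 0. Through the symmetrisation the value of the first derivative at [p]
    cancels. *)
Lemma second_deriv_max f (p : pt) j : Cnz 2 f -> p != 0 -> (forall u, u != 0 -> f u <= f p) ->
  rpd j (rpd j f) p <= 0.
Proof.
move=> hf p0 hmax; rewrite leNgt; apply/negP => a0.
set a := rpd j (rpd j f) p in a0.
pose e := ebasis R j; pose g (s : R) := rpd j f (p + s *: e).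
have hf1 : Cnz 1 f := CnzS hf.
have := cvg_is_derive (((hf.2 j).1 p p0).2 j); rewrite -/(rpd j (rpd j f) p) -/e -/a.
have a20 : 0 < a / 2 by rewrite divr_gt0.
move/cvgrPdist_lt/(_ _ a20); rewrite near_withinE => /near_norm [d1 d10 hd1].
have [d2 d20 hd2] := near_norm (nz_near p0).
pose K := `|e| + 1; have K0 : 0 < K by rewrite ltr_wpDl.
pose h : R := Num.min d1 (d2 / K) / 2.
have h0 : 0 < h by rewrite divr_gt0 // lt_min d10 divr_gt0.
have hd : h < Num.min d1 (d2 / K).
  by rewrite ltr_pdivrMr // ltr_pMr ?ltr1n // lt_min d10 divr_gt0.
have [hlt1 hlt2] : h < d1 /\ h < d2 / K by move: hd; rewrite lt_min => /andP.
have nz (s : R) : `|s| <= h -> p + s *: e != 0.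
  move=> hs; apply: hd2; rewrite [p + _]addrC addrK normrZ.
  apply: (@le_lt_trans _ _ (h * `|e|)); first by rewrite ler_wpM2r.
  apply: (@le_lt_trans _ _ (h * K)); first by rewrite ler_wpM2l ?ltW // ltrDl.
  by rewrite -ltr_pdivlMr.
have slope (s : R) : 0 < `|s| -> `|s| < d1 -> a / 2 < s^-1 * (g s - g 0).
  move=> s0 s1; have := hd1 s; rewrite subr0 => /(_ s1); rewrite -normr_gt0 => /(_ s0).
  rewrite /g scale0r addr0 ltr_norml => /andP [_ hh]; lra.
pose F (s : R) := f (p + s *: e) + f (p + s *: (- e)).
have dF (s : R) : `|s| <= h -> is_derive s 1 F (g s - g (- s)).
  move=> hs; have n1 := nz s hs; have n2 : p + s *: (- e) != 0.
    by rewrite scalerN -scaleNr; apply: nz; rewrite normrN.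
  apply: is_deriveD.
    have := is_derive_line hf1 n1; rewrite (bigD1 j) //= ebasisE eqxx mul1r.
    rewrite big1 ?addr0 // => i ij; by rewrite ebasisE (negPf ij) mul0r.
  have := is_derive_line hf1 n2; rewrite (bigD1 j) //= mxE ebasisE eqxx mulN1r.
  rewrite big1 ?addr0 => [|i ij]; last by rewrite mxE ebasisE (negPf ij) oppr0 mul0r.
  by rewrite /g scalerN scaleNr.
have habs (s : R) : 0 <= s <= h -> `|s| <= h by move=> /andP [s0 sh]; rewrite ger0_norm.
have [||c] := @MVT R F (fun s => g s - g (- s)) 0 h h0.
- by move=> s /subset_itv_oo_cc; rewrite in_itv /= => hs; apply: dF; apply: habs.
- apply: derivable_within_continuous => s; rewrite in_itv /= => hs.
  by have [] := dF s (habs s hs).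
rewrite in_itv /= => /andP [c0 ch]; rewrite subr0 => eF.
have F0 : F 0 = f p + f p by rewrite /F !scale0r !addr0.
have Fh : F h <= f p + f p.
  apply: lerD; apply: hmax; first by apply: nz; rewrite gtr0_norm.
  by rewrite scalerN -scaleNr; apply: nz; rewrite normrN gtr0_norm.
have s1 := slope c; have s2 := slope (- c).
rewrite normrN gtr0_norm // in s1 s2; have cd : c < d1 := lt_trans ch hlt1.
have {}s1 := s1 c0 cd; have {}s2 := s2 c0 cd.
have g1 : a / 2 * c < g c - g 0 by rewrite [c^-1 * _]mulrC in s1; rewrite -ltr_pdivlMr.
have g2 : a / 2 * c < g 0 - g (- c).
  rewrite -ltr_pdivlMr //; by move: s2; rewrite invrN mulNr -mulrN opprB [c^-1 * _]mulrC.
have : 0 < (g c - g (- c)) * h.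
  rewrite pmulr_lgt0 //; have ac := mulr_gt0 a20 c0.
  rewrite -(subrKA (g 0)); apply: addr_gt0; [exact: lt_trans ac g1 | exact: lt_trans ac g2].
by rewrite -eF F0 ltNge subr_le0 Fh.
Qed.

Lemma compact_sphere : compact [set u : pt | sqn u = 1].
Proof.
apply: bounded_closed_compact.
  exists 1; split; first by rewrite num_real.
  move=> M M1 u /= hu; apply: le_trans (ltW M1).
  rewrite [leLHS]/Num.norm /= mx_normrE; apply/bigmax_leP; split=> //= [[i j]] _ /=.
  rewrite ord1 -(@ler_pXn2r _ 2) ?nnegrE // expr1n real_normK ?num_real // -hu /sqn (bigD1 j) //=.
  by rewrite lerDl sumr_ge0 // => k _; exact: sqr_ge0.
have cs : continuous sqn.
  move=> u; have h (r : seq 'I_4) : {for u, continuous (fun u : pt => \sum_(j <- r) u 0 j ^+ 2)}.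
    elim: r => [|j r IH].
      rewrite (_ : (fun u : pt => _) = cst 0); first exact: cst_continuous.
      by apply/funext => v; rewrite big_nil.
    rewrite (_ : (fun u : pt => _) = (fun u : pt => u 0 j * u 0 j + \sum_(j <- r) u 0 j ^+ 2)).
      apply: (@continuousD _ _ _ (fun u : pt => u 0 j * u 0 j) _ _ _ IH).
      by apply: (@continuousM _ _ (fun u : pt => u 0 j)); exact: coord_continuous.
    by apply/funext => v; rewrite big_cons expr2.
  exact: h.
have -> : [set u : pt | sqn u = 1] = sqn @^-1` [set 1] by [].
by move/continuous_closedP: cs; apply; exact: closed_eq.
Qed.

Lemma hom_max_principle w : (forall n, Cnz n w) ->
  (forall u, u != 0 -> \sum_(j < 4) rpd j (rpd j w) u = 0) ->
  (forall u t, u != 0 -> 0 < t -> w (t *: u) = t^-1 * w u) ->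
  forall u, u != 0 -> w u <= 0.
Proof.
move=> hw hL hh.
have e0 : sqn (ebasis R 0) = 1.
  rewrite /sqn (bigD1 0) //= ebasisE eqxx expr1n big1 ?addr0 // => i /negPf i0.
  by rewrite ebasisE i0 expr0n.
have nz u : sqn u = 1 -> u != 0.
  move=> h; apply/eqP => u0; move/eqP: h; rewrite u0 /sqn big1 => [|i _]; last by rewrite mxE expr0n.
  by rewrite eq_sym oner_eq0.
have [||p hp hmax] := @EVT_max_rV R 4 w [set u : pt | sqn u = 1] _ compact_sphere.
- by exists (ebasis R 0).
- apply: continuous_in_subspaceT => u /set_mem /= /nz u0; exact: ((CnzC1 (hw 0%N)) u u0).1.
move/set_mem : hp => /= hp; have p0 := nz p hp.
have bnd u : u != 0 -> w u <= w p * rho u.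
  move=> u0; have r0 := rho_gt0 u0.
  have : w (rho u *: u) <= w p.
    apply: hmax; apply/mem_set => /=; rewrite /sqn -(rho2 u0) /sqn big_distrr.
    by apply: eq_bigr => j _ /=; rewrite mxE exprMn.
  by rewrite hh // ler_pdivrMl // mulrC.
suff wp : w p <= 0.
  by move=> u u0; apply: le_trans (bnd u u0) _; rewrite pmulr_lle0 // rho_gt0.
rewrite leNgt; apply/negP => M0.
pose f u := w u + (- w p) * rho u.
have hf n : Cnz n f by apply: CnzD; [exact: hw | apply: CnzM; [exact: Cnz_cst | exact: Cnz_rho]].
have rp : rho p = 1 by rewrite /rho /enorm -/(sqn p) hp sqrtr1 invr1.
have hf' u : u != 0 -> f u <= f p.
  by move=> u0; rewrite /f rp; have := bnd u u0; lra.
(* Summed over [j], the factors [1 - 3 * p 0 j ^+ 2] give 4 - 3 = 1, as [p] lies on the sphere. So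
   the Laplacian of [f] at its maximum [p] equals [w p], which cannot be positive. *)
have key j : rpd j (rpd j f) p = rpd j (rpd j w) p + w p * (1 - 3 * p 0 j ^+ 2).
  have C1r := C1nz_rho.
  have e1 u : u != 0 -> rpd j f u = rpd j w u + (w p * u 0 j) * (rho u * (rho u * rho u)).
    move=> u0; have C1c := CnzC1 (Cnz_cst 0 (- w p)).
    rewrite /f (@rpdD j w (fun u => - w p * rho u) (CnzC1 (hw 0%N)) (C1nzM C1c C1r) u u0).
    rewrite (@rpdM j (fun=> - w p) rho C1c C1r u u0).
    by rewrite rpd_rho // /rpd derive_cst; ring.
  have e2 := @rpd_ext j _ _ e1 p p0; rewrite e2.
  have C1wj : C1nz (rpd j w) := ((hw 1%N).2 j).1.
  have C1c : C1nz (fun u : pt => w p * u 0 j).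
    by apply: C1nzM; [exact: CnzC1 (Cnz_cst 0 _) | exact: C1nz_coord].
  have C1r2 : C1nz (fun u => rho u * rho u) := C1nzM C1r C1r.
  have C1r3 : C1nz (fun u => rho u * (rho u * rho u)) := C1nzM C1r C1r2.
  rewrite (@rpdD j (rpd j w) (fun u => w p * u 0 j * (rho u * (rho u * rho u))) C1wj (C1nzM C1c C1r3) p p0).
  rewrite (@rpdM j (fun u => w p * u 0 j) _ C1c C1r3 p p0).
  rewrite (@rpdM j rho (fun u => rho u * rho u) C1r C1r2 p p0) (@rpdM j rho rho C1r C1r p p0).
  rewrite (@rpdM j (fun=> w p) (fun u => u 0 j) (CnzC1 (Cnz_cst 0 _)) (@C1nz_coord j) p p0).
  rewrite rpd_coord eqxx rpd_rho // rp [rpd j (fun=> w p) p]derive_cst /=; ring.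
have : \sum_(j < 4) rpd j (rpd j f) p <= 0.
  by apply: sumr_le0 => j _; apply: second_deriv_max.
under eq_bigr => j _ do rewrite key.
rewrite big_split /= hL // add0r -big_distrr /= sumrB -big_distrr /= -/(sqn p) hp.
by rewrite sumr_const card_ord; lra.
Qed.

End SmoothFunctions.

(** * The ring of complex functions smooth off the origin *)

Section SmoothRing.
Local Open Scope classical_set_scope.
Local Open Scope ring_scope.
Local Open Scope complex_scope.
Variable R : realType.
Notation pt := (pt R).
Notation C := R[i].
Notation e0 := (ebasis R 0).

(* Elements of the ring are functions on R^4 that are smooth off the origin; the
   normalisation [f 0 = f e0] makes them determined by their values off the origin. *)
Definition smoothC (f : pt -> C) : Prop :=
  [/\ forall n, Cnz n (fun u => complex.Re (f u)),
      forall n, Cnz n (fun u => complex.Im (f u)) & f 0 = f e0].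

Definition csm (h : pt -> C) := (forall n, Cnz n (fun u => complex.Re (h u))) /\
  (forall n, Cnz n (fun u => complex.Im (h u))).

Definition smp : {pred pt -> C} := fun f => `[< smoothC f >].

Lemma smp_subring : subring_closed smp.
Proof.
have zN f : smoothC f -> smoothC (- f).
  move=> [h1 h2 h3]; split=> [n|n|].
  - apply: (@Cnz_ext _ _ (fun u => -1 * complex.Re (f u))) => [u _|].
      by rewrite mulN1r -[(- f) u]/(- f u); case: (f u).
    by apply: CnzM; [exact: Cnz_cst | exact: h1].
  - apply: (@Cnz_ext _ _ (fun u => -1 * complex.Im (f u))) => [u _|].
      by rewrite mulN1r -[(- f) u]/(- f u); case: (f u).
    by apply: CnzM; [exact: Cnz_cst | exact: h2].
  - by rewrite /GRing.opp /= h3.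
split.
- by apply/asboolP; split=> [n|n|] //=; exact: Cnz_cst.
- move=> f g /asboolP [f1 f2 f3] /asboolP /zN [g1 g2 g3]; apply/asboolP; split=> [n|n|].
  + apply: (@Cnz_ext _ _ (fun u => complex.Re (f u) + complex.Re ((- g) u))) => [u _|].
      by rewrite -raddfD.
    by apply: CnzD; [exact: f1 | exact: g1].
  + apply: (@Cnz_ext _ _ (fun u => complex.Im (f u) + complex.Im ((- g) u))) => [u _|].
      by rewrite -raddfD.
    by apply: CnzD; [exact: f2 | exact: g2].
  + by rewrite -[(f - g) 0]/(f 0 + (- g) 0) f3 g3.
- move=> f g /asboolP [f1 f2 f3] /asboolP [g1 g2 g3]; apply/asboolP; split=> [n|n|].
  + apply: (@Cnz_ext _ _ (fun u => complex.Re (f u) * complex.Re (g u) +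
        (-1 * complex.Im (f u)) * complex.Im (g u))) => [u _|].
      rewrite -[(f * g) u]/(f u * g u); case: (f u) (g u) => [a b] [c d] /=; ring.
    apply: CnzD; first by apply: CnzM; [exact: f1 | exact: g1].
    by apply: CnzM; [apply: CnzM; [exact: Cnz_cst | exact: f2] | exact: g2].
  + apply: (@Cnz_ext _ _ (fun u => complex.Re (f u) * complex.Im (g u) +
        complex.Im (f u) * complex.Re (g u))) => [u _|].
      rewrite -[(f * g) u]/(f u * g u); case: (f u) (g u) => [a b] [c d] /=; ring.
    by apply: CnzD; apply: CnzM; [exact: f1 | exact: g2 | exact: f2 | exact: g1].
  + by rewrite -[(f * g) 0]/(f 0 * g 0) f3 g3.
Qed.

HB.instance Definition _ := GRing.isSubringClosed.Build (pt -> C) smp smp_subring.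

Record smf := MkSmf { smfun : pt -> C; _ : smfun \in smp }.
HB.instance Definition _ := [isSub for smfun].
HB.instance Definition _ := [Choice of smf by <:].
HB.instance Definition _ := [SubChoice_isSubComNzRing of smf by <:].

Implicit Types (f g : smf) (u v : pt) (h : pt -> C).

Lemma smfun_eq f g : (forall u, u != 0 -> smfun f u = smfun g u) -> f = g.
Proof.
move=> h; apply: val_inj; apply/funext => u /=.
have [->|u0] := eqVneq u 0; last exact: h.
have e00 : e0 != 0.
  apply/eqP => /rowP /(_ 0) /eqP; rewrite ebasisE mxE eqxx oner_eq0 //.
have [/asboolP [_ _ ->] /asboolP [_ _ ->]] := (valP f, valP g).
exact: h.
Qed.

Lemma smfun_csm f : csm (smfun f).
Proof. by have /asboolP [h1 h2 _] := valP f; split. Qed.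

(** Total in [h]: the value at 0 is reset to the normalised one, and a function that is not smooth
    is sent to 0. In this way partial differentiation becomes an operator on the ring. *)
Definition smf_mk h : smf := insubd 0 (fun u => if u == 0 then h e0 else h u).

Lemma smf_mkE h u : csm h -> u != 0 -> smfun (smf_mk h) u = h u.
Proof.
move=> [h1 h2] u0; rewrite /smf_mk insubdK ?(negPf u0) //.
have e00 : (e0 == 0) = false.
  apply/eqP => /rowP /(_ 0) /eqP; rewrite ebasisE mxE eqxx oner_eq0 //.
apply/asboolP; split=> [n|n|].
- by apply: Cnz_ext (h1 n) => v v0; rewrite (negPf v0).
- by apply: Cnz_ext (h2 n) => v v0; rewrite (negPf v0).
- by rewrite eqxx e00.
Qed.

Lemma smfunD f g u : smfun (f + g) u = smfun f u + smfun g u. Proof. by []. Qed.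
Lemma smfunM f g u : smfun (f * g) u = smfun f u * smfun g u. Proof. by []. Qed.
Lemma cst_smp (c : C) : (fun _ : pt => c) \in smp.
Proof. by apply/asboolP; split=> // n; exact: Cnz_cst. Qed.
Definition smf_cst (c : C) : smf := MkSmf (cst_smp c).

Fact smf_cst_is_zmod_morphism : zmod_morphism smf_cst.
Proof. by move=> c d; apply: val_inj. Qed.
Fact smf_cst_is_monoid_morphism : monoid_morphism smf_cst.
Proof. by split=> [|c d]; apply: val_inj. Qed.
HB.instance Definition _ := GRing.isZmodMorphism.Build C smf smf_cst smf_cst_is_zmod_morphism.
HB.instance Definition _ := GRing.isMonoidMorphism.Build C smf smf_cst smf_cst_is_monoid_morphism.

Lemma smf_cstE c u : smfun (smf_cst c) u = c. Proof. by []. Qed.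

End SmoothRing.

(* Sealing the ring behind its evaluation map keeps unification from unfolding the
   concrete ring operations and the derivatives. *)
Record smooth_model (R : realType) := SmoothModel {
  sm_ring :> comNzRingType;
  cstf : {rmorphism R[i] -> sm_ring};
  smval : sm_ring -> pt R -> R[i];
  mksmf : (pt R -> R[i]) -> sm_ring;
  smvalD : forall f g u, smval (f + g) u = smval f u + smval g u;
  smvalM : forall f g u, smval (f * g) u = smval f u * smval g u;
  smval_cst : forall c u, smval (cstf c) u = c;
  smval_csm : forall f, csm (smval f);
  smf_eq : forall f g, (forall u, u != 0 -> smval f u = smval g u) -> f = g;
  mksmfE : forall h u, csm h -> u != 0 -> smval (mksmf h) u = h u }.

Definition smf_model (R : realType) : smooth_model R :=
  SmoothModel (@smfunD R) (@smfunM R) (@smf_cstE R) (@smfun_csm R) (@smfun_eq R) (@smf_mkE R).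

(** * Derivations, coordinate functions and the norm in the ring *)

Section SmoothModel.
Local Open Scope ring_scope.
Local Open Scope complex_scope.
Variable R : realType.
Variable M : smooth_model R.
Notation pt := (pt R).
Notation C := R[i].
Notation e0 := (ebasis R 0).
Notation cstf := (@cstf R M).
Notation mksmf := (@mksmf R M).
Implicit Types (f g : M) (u v : pt) (h : pt -> C).

Lemma smval0 u : smval (0 : M) u = 0. Proof. by rewrite -(rmorph0 cstf) smval_cst. Qed.
Lemma smval1 u : smval (1 : M) u = 1. Proof. by rewrite -(rmorph1 cstf) smval_cst. Qed.
Lemma smvalN f u : smval (- f) u = - smval f u.
Proof. by apply: (@addrI _ (smval f u)); rewrite -smvalD !subrr smval0. Qed.
Lemma smvalX f n u : smval (f ^+ n) u = smval f u ^+ n.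
Proof. by elim: n => [|n IH]; rewrite ?expr0 ?smval1 // !exprS smvalM IH. Qed.
Lemma smval_sum (I : Type) (r : seq I) (P : pred I) (F : I -> M) u :
  smval (\sum_(i <- r | P i) F i) u = \sum_(i <- r | P i) smval (F i) u.
Proof. by elim/big_rec2: _ => [|i x y _ <-]; rewrite ?smval0 ?smvalD. Qed.
Lemma smval_nat n u : smval (n%:R : M) u = n%:R.
Proof. by rewrite -(rmorph_nat cstf) smval_cst. Qed.

Lemma csm_cpd h j : csm h -> csm (cpd j h).
Proof. by move=> [h1 h2]; split=> n; [have [_ +] := h1 n.+1|have [_ +] := h2 n.+1]; exact. Qed.

Definition Dj j f : M := mksmf (cpd j (smval f)).

Lemma DjE j f u : u != 0 -> smval (Dj j f) u = cpd j (smval f) u.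
Proof. by move=> u0; rewrite mksmfE //; apply: csm_cpd; exact: smval_csm. Qed.

Lemma cpd_ext j h h' : (forall u, u != 0 -> h u = h' u) ->
  forall u, u != 0 -> cpd j h u = cpd j h' u.
Proof.
by move=> e u u0; congr (_ +i* _); apply: rpd_ext => // v v0; rewrite e.
Qed.

Lemma Dj_mksmf j h u : csm h -> u != 0 -> smval (Dj j (mksmf h)) u = cpd j h u.
Proof.
by move=> hh u0; rewrite DjE //; apply: cpd_ext => // v v0; rewrite mksmfE.
Qed.

Lemma csmC1 h : csm h -> C1nz (fun u => complex.Re (h u)) /\ C1nz (fun u => complex.Im (h u)).
Proof. by case=> h1 h2; split; [exact: CnzC1 (h1 0%N) | exact: CnzC1 (h2 0%N)]. Qed.

Lemma cpdD j h h' u : csm h -> csm h' -> u != 0 ->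
  cpd j (fun v => h v + h' v) u = cpd j h u + cpd j h' u.
Proof.
move=> /csmC1 [r1 i1] /csmC1 [r2 i2] u0; rewrite /cpd.
have -> : (fun w => complex.Re (h w + h' w)) = (fun w => complex.Re (h w) + complex.Re (h' w)).
  by apply/funext => w; rewrite raddfD.
have -> : (fun w => complex.Im (h w + h' w)) = (fun w => complex.Im (h w) + complex.Im (h' w)).
  by apply/funext => w; rewrite raddfD.
by rewrite (rpdD j r1 r2 u0) (rpdD j i1 i2 u0).
Qed.

Lemma cpdM j h h' u : csm h -> csm h' -> u != 0 ->
  cpd j (fun v => h v * h' v) u = cpd j h u * h' u + h u * cpd j h' u.
Proof.
move=> /csmC1 [r1 i1] /csmC1 [r2 i2] u0; rewrite /cpd.
have C1N := CnzC1 (Cnz_cst 0 (-1 : R)).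
have -> : (fun w => complex.Re (h w * h' w)) = (fun w =>
    complex.Re (h w) * complex.Re (h' w) + -1 * (complex.Im (h w) * complex.Im (h' w))).
  by apply/funext => w; case: (h w) (h' w) => [a b] [c d] /=; ring.
have -> : (fun w => complex.Im (h w * h' w)) = (fun w =>
    complex.Re (h w) * complex.Im (h' w) + complex.Im (h w) * complex.Re (h' w)).
  by apply/funext => w; case: (h w) (h' w) => [a b] [c d] /=; ring.
rewrite (rpdD j (C1nzM r1 r2) (C1nzM C1N (C1nzM i1 i2)) u0) (rpdD j (C1nzM r1 i2) (C1nzM i1 r2) u0).
rewrite (rpdM j C1N (C1nzM i1 i2) u0) (rpdM j r1 r2 u0) (rpdM j i1 i2 u0).
rewrite (rpdM j r1 i2 u0) (rpdM j i1 r2 u0) [rpd j (fun=> -1) u]derive_cst.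
move: (rpd j _ u) (rpd j _ u) (rpd j _ u) (rpd j _ u) => p q r s.
case: (h u) (h' u) => [a b] [c d] /=.
by apply/eqP; rewrite eq_complex /=; apply/andP; split; apply/eqP; ring.
Qed.

Lemma cpd_cst j (c : C) u : cpd j (fun=> c) u = 0.
Proof. by rewrite /cpd /rpd !derive_cst. Qed.

Lemma Dj_derivation j : derivation cstf (Dj j).
Proof.
split=> [f g|f g|c]; apply: smf_eq => u u0.
- rewrite smvalD !DjE // -(cpdD j (smval_csm f) (smval_csm g) u0).
  by apply: cpd_ext u0 => v _; exact: smvalD.
- rewrite smvalD !smvalM !DjE // -(cpdM j (smval_csm f) (smval_csm g) u0).
  by apply: cpd_ext u0 => v _; exact: smvalM.
- rewrite DjE // smval0 -[RHS](@cpd_cst j c u); apply: cpd_ext u0 => v _; exact: smval_cst.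
Qed.

Lemma DjDj i j f u : u != 0 -> smval (Dj i (Dj j f)) u = cpd i (cpd j (smval f)) u.
Proof.
by move=> u0; rewrite DjE //; apply: cpd_ext u0 => v v0; rewrite DjE.
Qed.

Lemma Dj_comm i j f : Dj i (Dj j f) = Dj j (Dj i f).
Proof.
apply: smf_eq => u u0; have hf := smval_csm f; have [h1 h2] := hf.
have E1 := DjDj i j f u0; have E2 := DjDj j i f u0.
have E3 := congr2 (@Complex R) (rpd_comm i j (h1 2%N) u0) (rpd_comm i j (h2 2%N) u0).
apply: (etrans E1).
apply: (etrans _ (esym E2)).
exact: (congr2 (@Complex R) (rpd_comm i j (h1 2%N) u0) (rpd_comm i j (h2 2%N) u0)).
Qed.

Lemma csm_real (h : pt -> R) : (forall n, Cnz n h) -> csm (fun u => (h u)%:C).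
Proof. by move=> hh; split=> n; [exact: hh | exact: Cnz_cst]. Qed.

Lemma cpd_real j (h : pt -> R) u : cpd j (fun u => (h u)%:C) u = (rpd j h u)%:C.
Proof. by rewrite /cpd /= [rpd j (fun=> 0) u]derive_cst. Qed.

Definition Xj j : M := mksmf (fun u => (u 0 j)%:C).
Definition Rh : M := mksmf (fun u => (rho u)%:C).

Lemma csm_coord j : csm (fun u : pt => (u 0 j)%:C).
Proof. by apply: csm_real => n; exact: Cnz_coord. Qed.
Lemma csm_rho : csm (fun u : pt => (rho u)%:C).
Proof. by apply: csm_real => n; exact: Cnz_rho. Qed.

Lemma XjE j u : u != 0 -> smval (Xj j) u = (u 0 j)%:C.
Proof. by move=> u0; rewrite mksmfE //; exact: csm_coord. Qed.
Lemma RhE u : u != 0 -> smval Rh u = (rho u)%:C.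
Proof. by move=> u0; rewrite mksmfE //; exact: csm_rho. Qed.

Lemma Dj_Xj i j : Dj i (Xj j) = (j == i)%:R.
Proof.
apply: smf_eq => u u0; rewrite Dj_mksmf //; last exact: csm_coord.
by rewrite cpd_real rpd_coord smval_nat; case: (j == i).
Qed.

Lemma Dj_Rh j : Dj j Rh = - Xj j * Rh ^+ 3.
Proof.
apply: smf_eq => u u0; rewrite Dj_mksmf //; last exact: csm_rho.
rewrite cpd_real rpd_rho // smvalM smvalN smvalX XjE // RhE //.
by rewrite rmorphM rmorphN rmorphXn.
Qed.

Lemma Rh_sq : Rh ^+ 2 * (\sum_(j < 4) Xj j ^+ 2) = 1.
Proof.
apply: smf_eq => u u0; rewrite smvalM smvalX RhE // smval_sum smval1.
under eq_bigr => j _ do rewrite smvalX XjE // -rmorphXn.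
by rewrite -rmorph_sum -rmorphXn -rmorphM /= -/(sqn u) rho2.
Qed.

Lemma Dj_const f : (forall j, Dj j f = 0) -> exists c, f = cstf c.
Proof.
move=> h; have hz j u : u != 0 -> cpd j (smval f) u = 0.
  by move=> u0; rewrite -DjE // h smval0.
have [h1 h2] := smval_csm f.
exists (smval f e0); apply: smf_eq => u u0; rewrite smval_cst.
have e1 := @rpd0_const _ _ (h1 1%N) (fun j w nw => congr1 (@complex.Re R) (hz j w nw)) u u0.
have e2 := @rpd0_const _ _ (h2 1%N) (fun j w nw => congr1 (@complex.Im R) (hz j w nw)) u u0.
by move: e1 e2 => /=; case: (smval f u) (smval f e0) => [a b] [c d] /= -> ->.
Qed.

Notation EuS := (Eu Dj Xj).

Lemma EuE f u : u != 0 -> smval (EuS f) u =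
  euler (fun v => complex.Re (smval f v)) u +i* euler (fun v => complex.Im (smval f v)) u.
Proof.
move=> u0; rewrite smval_sum /euler.
rewrite (eq_bigr (fun j => (u 0 j)%:C * cpd j (smval f) u)); last first.
  by move=> j _; rewrite smvalM XjE // DjE.
rewrite /cpd; elim/big_rec3: _ => [//|j x y z _ ->].
by apply/eqP; rewrite eq_complex /=; apply/andP; split; apply/eqP; ring.
Qed.

Lemma hom0_Eu f : (forall u t, u != 0 -> 0 < t -> smval f (t *: u) = smval f u) -> EuS f = 0.
Proof.
move=> h; have [h1 h2] := smval_csm f; apply: smf_eq => u u0; rewrite EuE // smval0.
by rewrite !hom0_euler // => t t0; rewrite h.
Qed.

Lemma Eu0_hom f u t : EuS f = 0 -> u != 0 -> 0 < t -> smval f (t *: u) = smval f u.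
Proof.
move=> h u0 t0; have [h1 h2] := smval_csm f.
have he v : v != 0 -> euler (fun v => complex.Re (smval f v)) v = 0 /\
    euler (fun v => complex.Im (smval f v)) v = 0.
  by move=> v0; have := EuE f v0; rewrite h smval0 => -[<- <-].
have e1 := euler0_hom (h1 1%N) (fun w nw => (he w nw).1) u0 t0.
have e2 := euler0_hom (h2 1%N) (fun w nw => (he w nw).2) u0 t0.
by move: e1 e2 => /=; case: (smval f (t *: u)) (smval f u) => [a b] [c d] /= -> ->.
Qed.

End SmoothModel.

(** * Homogeneity and the decomposition of harmonic functions *)

Section ComplexCoordinates.
Local Open Scope ring_scope.
Local Open Scope complex_scope.
Variable R : realType.
Notation pt := (pt R).
Notation C := R[i].
Variable M : smooth_model R.
Implicit Types (f g w : M) (u : pt).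

Notation cst := (@cstf R M).
Notation D := (@Dj R M).
Notation X := (@Xj R M).
Notation I1 := (1 : 'I_4).
Notation I2 := (2%:R : 'I_4).
Notation I3 := (3%:R : 'I_4).

Let hD := @Dj_derivation R M.

Notation Rh := (@Rh R M).
Notation EuS := (Eu D X).
Notation LpS := (Lp D).
Notation rrS := (rr X Rh).

Lemma sqr_i : 'i ^+ 2 = -1 :> C.
Proof. by rewrite sqr_i. Qed.

Lemma EuS_derivation : derivation cst EuS.
Proof. exact: (Eu_derivation sqr_i hD (@Dj_comm R M) (@Dj_Xj R M)). Qed.
Lemma EuS_Rhn n : EuS (Rh ^+ n) = - n%:R * Rh ^+ n.
Proof. exact: (Eu_Rhn hD (@Dj_Rh R M) (@Rh_sq R M)). Qed.
Lemma EuS_rrn n : EuS (rrS ^+ n) = n%:R * rrS ^+ n.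
Proof. exact: (Eu_rrn sqr_i hD (@Dj_comm R M) (@Dj_Xj R M) (@Dj_Rh R M) (@Rh_sq R M)). Qed.
Lemma Rh_rrS : Rh * rrS = 1.
Proof. exact: (Rh_rr (@Rh_sq R M)). Qed.

Lemma rho_scale t u : 0 < t -> rho (t *: u) = t^-1 * rho u.
Proof.
move=> t0; rewrite /rho /enorm -invfM; congr (_^-1).
under eq_bigr => j _ do rewrite mxE exprMn.
by rewrite -big_distrr /= sqrtrM ?sqr_ge0 // sqrtr_sqr gtr0_norm.
Qed.

Lemma scale_nz t u : 0 < t -> u != 0 -> t *: u != 0.
Proof. by move=> t0 u0; rewrite scaler_eq0 negb_or u0 andbT gt_eqF. Qed.

Lemma rr_rho u : u != 0 -> smval rrS u = ((rho u)^-1)%:C.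
Proof.
move=> u0; have := congr1 (fun f : M => smval f u) Rh_rrS; rewrite smvalM smval1 RhE //.
have r0 : (rho u)%:C != 0 by rewrite (fmorph_eq0 (real_complex R)) gt_eqF // rho_gt0.
by move=> e; apply: (mulfI r0); rewrite e -rmorphM mulfV ?gt_eqF // rho_gt0.
Qed.

(** Multiplication by [Rh ^+ k] reduces the claim to degree 0, which is [Eu0_hom]. *)
Lemma Eu_hom k f u t : EuS f = k%:R * f -> u != 0 -> 0 < t ->
  smval f (t *: u) = (t ^+ k)%:C * smval f u.
Proof.
move=> hE u0 t0; have tu0 := scale_nz t0 u0.
have E0 : EuS (Rh ^+ k * f) = 0.
  by rewrite (derM EuS_derivation) EuS_Rhn hE; ring.
have := Eu0_hom E0 u0 t0; rewrite !smvalM !smvalX !RhE // rho_scale // => e.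
have r0 : (rho u ^+ k)%:C != 0.
  by rewrite (fmorph_eq0 (real_complex R)) expf_eq0 gt_eqF ?andbF // rho_gt0.
apply: (mulfI r0).
transitivity ((t ^+ k)%:C * (((t^-1 * rho u)%:C) ^+ k * smval f (t *: u))).
  rewrite mulrA -rmorphXn -rmorphM -exprMn mulrA mulfV ?gt_eqF // mul1r //.
by rewrite e -rmorphXn /=; ring.
Qed.

(** The maximum principle is real and one-sided, so it is applied to the real and imaginary parts of
    both [w] and [- w]. *)
Lemma harmonic_degm1 w : LpS w = 0 -> EuS w = - w -> w = 0.
Proof.
suff key f : LpS f = 0 -> EuS f = - f ->
    forall u, u != 0 -> complex.Re (smval f u) <= 0 /\ complex.Im (smval f u) <= 0.
  move=> hL hE; apply: smf_eq => u u0; have [r1 i1] := key w hL hE u u0.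
  have [] := key (- w) _ _ u u0.
  - by rewrite /Lp (eq_bigr (fun j => - D j (D j w))) ?sumrN -?/(LpS w) ?hL ?oppr0 // => j _;
      rewrite !(derN (hD j)).
  - by rewrite (derN EuS_derivation) hE.
  rewrite smvalN smval0; case: (smval w u) r1 i1 => [a b] /= r1 i1; rewrite !oppr_le0 => r2 i2.
  by congr (_ +i* _); apply/eqP; rewrite eq_le ?r1 ?r2 ?i1 ?i2.
move=> hL hE.
have E0 : EuS (rrS * f) = 0.
  by have := EuS_rrn 1; rewrite expr1 => e; rewrite (derM EuS_derivation) e hE; ring.
have hom u t : u != 0 -> 0 < t -> smval f (t *: u) = (t^-1)%:C * smval f u.
  move=> u0 t0; have tu0 := scale_nz t0 u0.
  have := Eu0_hom E0 u0 t0.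
  rewrite smvalM.
  rewrite [RHS]smvalM.
  rewrite (rr_rho u0) (rr_rho tu0) (rho_scale _ t0) => e.
  have r0 : ((rho u)^-1)%:C != 0.
    by rewrite (fmorph_eq0 (real_complex R)) invr_eq0 gt_eqF // rho_gt0.
  apply: (mulfI r0); rewrite mulrCA -e invfM !invrK rmorphM /=.
  have tt : (t^-1)%:C * t%:C = 1 :> C by rewrite -rmorphM mulVf ?gt_eqF.
  by rewrite !mulrA tt mul1r.
have [h1 h2] := smval_csm f.
have hLu u : u != 0 -> \sum_(j < 4) cpd j (cpd j (smval f)) u = 0.
  move=> u0; rewrite -[RHS](smval0 M u) -hL smval_sum; apply: eq_bigr => j _.
  exact: (esym (DjDj j j f u0)).
move=> u u0; split.
- apply: (@hom_max_principle R (fun v => complex.Re (smval f v)) h1) u0 => [v v0|v t v0 t0].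
    by have := congr1 (@complex.Re R) (hLu v v0); rewrite raddf_sum.
  by rewrite hom //; case: (smval f v) => a b /=; rewrite mul0r subr0.
- apply: (@hom_max_principle R (fun v => complex.Im (smval f v)) h2) u0 => [v v0|v t v0 t0].
    by have := congr1 (@complex.Im R) (hLu v v0); rewrite raddf_sum.
  by rewrite hom //; case: (smval f v) => a b /=; rewrite mul0r addr0.
Qed.

Theorem harmonic_smf_decomp k f : LpS f = 0 -> EuS f = k%:R * f ->
  exists2 P : 'I_k.+1 -> {poly C}, forall j, (size (P j) <= k.+1)%N &
    f = \sum_(j < k.+1) iter j (Tm (da 'i cst D) (db 'i cst D) (al' 'i cst X) (be' 'i cst X))
          (hform cst k (P j) (al 'i cst X) (be 'i cst X)).
Proof.
move=> hL hE.
exact: (harmonic_coord_decomp sqr_i hD (@Dj_comm R M) (@Dj_Xj R M) harmonic_degm1 (@Dj_const R M) hL hE).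
Qed.

End ComplexCoordinates.

(** * The binary octahedral group *)

Section OctahedralMatrices.
Variable C : numFieldType.
Implicit Types a b x y u s : C.

Lemma tf_scale u x y : tf (u * x) (u * y) = u ^+ 6 * tf x y.
Proof. by rewrite /tf; ring. Qed.

(** [a'] and [b'] stand for the conjugates of [a] and [b], which keeps the computation algebraic.
    The same sign [k] occurs for [tf] and [chif], so that [tf ^+ 2] and [tf * chif] are
    invariant. *)
Definition octa_subst a a' b b' := exists2 k : C, k ^+ 2 = 1 &
  forall x y, [/\ tf (a * x + b * y) (- b' * x + a' * y) = k * tf x y,
    Wf (a * x + b * y) (- b' * x + a' * y) = Wf x y &
    chif (a * x + b * y) (- b' * x + a' * y) = k * chif x y].

Lemma octa_subst_diag a a' : a * a' = 1 -> a ^+ 4 = a' ^+ 4 -> octa_subst a a' 0 0.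
Proof.
move=> e1 e4; have e8 : a ^+ 4 * a' ^+ 4 = 1 by rewrite -exprMn e1 expr1n.
have a8 : a ^+ 4 * a ^+ 4 = 1 by rewrite {2}e4.
exists (a ^+ 4); first by rewrite expr2.
move=> x y; rewrite /tf /Wf /chif; split.
- transitivity ((a * a') * (a ^+ 4 * x ^+ 5 * y - a' ^+ 4 * x * y ^+ 5)); first by ring.
  by rewrite e1 -e4; ring.
- transitivity (a ^+ 4 * a ^+ 4 * x ^+ 8 + 14%:R * (a * a') ^+ 4 * x ^+ 4 * y ^+ 4 +
    a' ^+ 4 * a' ^+ 4 * y ^+ 8); first by ring.
  by rewrite e1 -e4 a8; ring.
- transitivity (a ^+ 4 * (a ^+ 4 * a ^+ 4) * x ^+ 12 - 33%:R * (a * a') ^+ 4 * a ^+ 4 * x ^+ 8 * y ^+ 4 -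
    33%:R * (a * a') ^+ 4 * a' ^+ 4 * x ^+ 4 * y ^+ 8 + a' ^+ 4 * (a' ^+ 4 * a' ^+ 4) * y ^+ 12); first by ring.
  by rewrite e1 -e4 a8; ring.
Qed.

Lemma octa_subst_anti b b' : b * b' = 1 -> b ^+ 4 = b' ^+ 4 -> octa_subst 0 0 b b'.
Proof.
move=> e1 e4; have [k k2 h] := octa_subst_diag e1 e4.
exists k => // x y; have [h1 h2 h3] := h y (- x).
have -> : 0 * x + b * y = b * y + 0 * (- x) by ring.
have -> : - b' * x + 0 * y = - 0 * y + b' * (- x) by ring.
by rewrite h1 h2 h3; split; rewrite /tf /Wf /chif; ring.
Qed.

(** Up to the scalar [a] the matrix has rows [(1, s)] and [(- v, v * s)] with fourth roots of unity
    [s = b / a] and [v = b' / a]. Besides [s ^+ 4 = v ^+ 4 = 1] the computation uses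
    [v * s * a ^+ 2 = 2^-1] and 16 a^8 = 1; the latter makes -4 a^4 a square root of 1. *)
Lemma octa_subst_mix a a' b b' : a * a' = 2^-1 -> b * b' = 2^-1 ->
  a ^+ 4 = a' ^+ 4 -> a ^+ 4 = b ^+ 4 -> octa_subst a a' b b'.
Proof.
move=> e1 e2 e3 e4.
have a0 : a != 0 by apply: contra_eq_neq e1 => ->; rewrite mul0r eq_sym invr_eq0 pnatr_eq0.
have b0 : b != 0 by apply: contra_eq_neq e2 => ->; rewrite mul0r eq_sym invr_eq0 pnatr_eq0.
have a8 : 16%:R * (a ^+ 4) ^+ 2 = 1.
  by rewrite expr2 {2}e3 -exprMn e1; field.
have ea : a' = (2%:R * a)^-1 by rewrite invfM -e1 mulrC mulKf.
have eb : b' = (2%:R * b)^-1 by rewrite invfM -e2 mulrC mulKf.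
have a2 : 2%:R != 0 :> C by rewrite pnatr_eq0.
pose s := b / a; have s4 : s ^+ 4 = 1 by rewrite exprMn exprVn -e4 mulfV // expf_neq0.
pose v := b' / a; have v4 : v ^+ 4 = 1.
  have b'4 : b' ^+ 4 = a ^+ 4.
    rewrite eb exprVn exprMn -e4; apply: (mulfI (expf_neq0 4 a0)).
    rewrite invfM mulrCA mulfV ?expf_neq0 // mulr1.
    apply: (mulfI (_ : (16%:R : C) != 0)); first by rewrite pnatr_eq0.
    by rewrite -expr2 a8 -natrX mulfV // pnatr_eq0.
  by rewrite exprMn exprVn b'4 mulfV // expf_neq0.
have E1 x y : a * x + b * y = a * (x + s * y) by rewrite /s; field.
have E2 x y : - b' * x + a' * y = a * v * (- x + s * y).
  by rewrite /v /s ea eb; field; rewrite a0 b0.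
have vs : v * s * a ^+ 2 = 2^-1 by rewrite /v /s -e2; field.
exists (- 4%:R * a ^+ 4).
  by rewrite -[RHS]a8; ring.
move=> x y; rewrite E1 E2 /tf /Wf /chif; split.
- transitivity (a ^+ 4 * (v * s * a ^+ 2) * ((x + s * y) ^+ 5 * (- x + s * y)
     - (x + s * y) * (- x + s * y) ^+ 5 * v ^+ 4) / s); first by field; rewrite /s mulf_neq0 // invr_neq0.
  have s0 : s != 0 by rewrite /s mulf_neq0 // invr_neq0.
  rewrite vs v4 mulr1.
  transitivity (- 8%:R * a ^+ 4 * 2^-1 * (x ^+ 5 * y - s ^+ 4 * (x * y ^+ 5))); first by field.
  by rewrite s4; field.
- transitivity ((a ^+ 4) ^+ 2 * ((x + s * y) ^+ 8 + 14%:R * (x + s * y) ^+ 4 * (- x + s * y) ^+ 4 * v ^+ 4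
    + (- x + s * y) ^+ 8 * (v ^+ 4) ^+ 2)); first by ring.
  rewrite v4.
  transitivity (16%:R * (a ^+ 4) ^+ 2 * (x ^+ 8 + 14%:R * x ^+ 4 * s ^+ 4 * y ^+ 4 + (s ^+ 4) ^+ 2 * y ^+ 8)).
    by ring.
  by rewrite a8 s4; ring.
- transitivity (a ^+ 4 * (a ^+ 4) ^+ 2 * ((x + s * y) ^+ 12 - 33%:R * (x + s * y) ^+ 8 * (- x + s * y) ^+ 4 * v ^+ 4
    - 33%:R * (x + s * y) ^+ 4 * (- x + s * y) ^+ 8 * (v ^+ 4) ^+ 2 + (- x + s * y) ^+ 12 * (v ^+ 4) ^+ 3)); first by ring.
  rewrite v4.
  transitivity (- 4%:R * a ^+ 4 * (16%:R * (a ^+ 4) ^+ 2) * (x ^+ 12 - 33%:R * x ^+ 8 * (s ^+ 4) * y ^+ 4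
    - 33%:R * x ^+ 4 * (s ^+ 4) ^+ 2 * y ^+ 8 + (s ^+ 4) ^+ 3 * y ^+ 12)); first by ring.
  by rewrite a8 s4; ring.
Qed.

(* The images of the vertices (1:0) and (1:1) pin the matrix down to the 48 elements. *)
Lemma octa_substP a a' b b' : a * a' + b * b' = 1 ->
  a * a' \is Num.real -> (a ^+ 4 = b' ^+ 4 -> b ^+ 4 = a' ^+ 4) ->
  (b = 0 -> b' = 0) -> (a = 0 -> a' = 0) -> (b' = 0 -> b = 0) -> 
  tf a (- b') = 0 -> tf (a + b) (- b' + a') = 0 -> octa_subst a a' b b'.
Proof.
move=> e1 re cj bb aa bb' t1 t2.
have [a0|a0] := eqVneq a 0.
  have a'0 := aa a0; move: e1 t2; rewrite a0 a'0 mul0r !add0r addr0 => e1 t2.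
  apply: octa_subst_anti => //; move: t2; rewrite /tf => t2.
  have : (b * b') * (b ^+ 4 - b' ^+ 4) = 0 by rewrite -[RHS]oppr0 -[in RHS]t2; ring.
  by rewrite e1 mul1r => /eqP; rewrite subr_eq0 => /eqP.
have [b'0|b'0] := eqVneq b' 0.
  have b0 := bb' b'0; move: e1 t2; rewrite b0 b'0 mulr0 !addr0 oppr0 add0r => e1 t2.
  apply: octa_subst_diag => //; move: t2; rewrite /tf => t2.
  have : (a * a') * (a ^+ 4 - a' ^+ 4) = 0 by rewrite -[in RHS]t2; ring.
  by rewrite e1 mul1r => /eqP; rewrite subr_eq0 => /eqP.
have e4 : a ^+ 4 = b' ^+ 4.
  have : (a * b') * (a ^+ 4 - b' ^+ 4) = 0 by rewrite -[RHS]oppr0 -[in RHS]t1 /tf; ring.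
  by move/eqP; rewrite !mulf_eq0 (negPf a0) (negPf b'0) /= subr_eq0 => /eqP.
have e4' := cj e4.
(* Here [s] plays the role of |a|^2. As [s] is real, [s ^+ 4 = (1 - s) ^+ 4] leaves only s = 1/2,
   the factor [s ^+ 2 + (1 - s) ^+ 2] being positive. *)
have half : a * a' = 2^-1.
  set s := a * a' in re e1 *; have bs : b * b' = 1 - s by rewrite -e1; ring.
  have es : s ^+ 4 = (1 - s) ^+ 4 by rewrite -bs !exprMn e4 e4'; ring.
  have : (2%:R * s - 1) * (s ^+ 2 + (1 - s) ^+ 2) = 0.
    transitivity (s ^+ 4 - (1 - s) ^+ 4); first by ring.
    by rewrite es subrr.
  move/eqP; rewrite mulf_eq0 => /orP [|].
    by rewrite subr_eq0 => /eqP h; rewrite -[s](mulKf (_ : 2%:R != 0 :> C)) ?pnatr_eq0 // h mulr1.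
  rewrite gt_eqF //; have sr : 1 - s \is Num.real by rewrite rpredB ?rpred1.
  rewrite lt_def addr_ge0 ?real_exprn_even_ge0 // andbT.
  apply/eqP => h0; have : 2%:R * (s ^+ 2 + (1 - s) ^+ 2) = (2%:R * s - 1) ^+ 2 + 1 by ring.
  rewrite h0 mulr0 => /eqP; rewrite eq_sym gt_eqF // ltr_wpDl ?ltr01 //.
  by rewrite real_exprn_even_ge0 // rpredB ?rpred1 // rpredM ?rpred_nat.
have half' : b * b' = 2^-1.
  have -> : b * b' = 1 - a * a' by rewrite -e1; ring.
  by rewrite half; field.
have a'0 : a' != 0 by apply: contra_eq_neq half => ->; rewrite mulr0 eq_sym invr_eq0 pnatr_eq0.
have b0 : b != 0 by apply: contraNneq b'0 => b0; rewrite bb.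
have key : a ^+ 4 = b ^+ 4.
  have h : (a + b) * (- b' + a') * ((a + b) ^+ 4 - (- b' + a') ^+ 4) = 0 by rewrite -[RHS]t2 /tf; ring.
  (* [- b' + a' = a'/b (b - a)] since [a a' = b b']. *)
  have eb : - b' + a' = a' / b * (b - a).
    have -> : b' = a * a' / b by rewrite half -half' mulrAC mulfV // mul1r.
    by field.
  have q4 : (a' / b) ^+ 4 = 1 by rewrite exprMn exprVn -e4' mulfV // expf_neq0.
  move: h; rewrite eb exprMn q4 mul1r.
  have -> : (a + b) * (a' / b * (b - a)) * ((a + b) ^+ 4 - (b - a) ^+ 4) =
     (8%:R * (a' / b) * (a * b)) * (b ^+ 4 - a ^+ 4) by ring.
  move/eqP; rewrite mulf_eq0 !mulf_eq0 pnatr_eq0 invr_eq0 (negPf a'0) (negPf b0) (negPf a0) /=.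
  by rewrite subr_eq0 => /eqP.
by apply: octa_subst_mix => //; rewrite key e4'.
Qed.

Lemma octa_subst_inv a a' b b' : octa_subst a a' b b' -> forall x y,
  [/\ Wf (a * x + b * y) (- b' * x + a' * y) = Wf x y,
      Ef (a * x + b * y) (- b' * x + a' * y) = Ef x y &
      Vf (a * x + b * y) (- b' * x + a' * y) = Vf x y].
Proof.
case=> k k2 h x y; have [h1 h2 h3] := h x y.
rewrite h2 !Ef_tf !Vf_tf h1 h3; split=> //; first by rewrite exprMn k2 mul1r.
by rewrite mulrACA -expr2 k2 mul1r.
Qed.

End OctahedralMatrices.

(** * Modes *)

Section ModesOctahedral.
Local Open Scope ring_scope.
Local Open Scope complex_scope.
Variable R : realType.
Notation pt := (pt R).
Notation C := R[i].
Local Notation "x ^*" := (conjc x) : ring_scope.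
Variable M : smooth_model R.
Implicit Types (f g : M) (u v : pt).

Notation cst := (@cstf R M).
Notation D := (@Dj R M).
Notation X := (@Xj R M).
Notation Rh := (@Rh R M).
Notation EuS := (Eu D X).
Notation LpS := (Lp D).
Notation rrS := (rr X Rh).
Notation a1 := (al 'i cst X).
Notation a1' := (al' 'i cst X).
Notation b1 := (be 'i cst X).
Notation b1' := (be' 'i cst X).
Notation TmS := (Tm (da 'i cst D) (db 'i cst D) a1' b1').

Let hD := @Dj_derivation R M.
Let tw := coord_twist (@sqr_i R) hD (@Dj_comm R M) (@Dj_Xj R M).

Lemma toR4_alpha (a b : C) : alpha (toR4 a b) = a.
Proof. by rewrite /alpha /cx /cy !mxE /=; case: a. Qed.
Lemma toR4_beta (a b : C) : beta (toR4 a b) = b.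
Proof. by rewrite /beta /cz /cw !mxE /=; case: b. Qed.

Lemma actpt_alpha h v : alpha (actpt h v) = h 0 0 * alpha v + h 0 1 * beta v.
Proof.
rewrite /actpt toR4_alpha mxE !big_ord_recl big_ord0 addr0 !mxE /=.
by congr (_ * _ + h _ _ * _); apply: val_inj.
Qed.
Lemma actpt_beta h v : beta (actpt h v) = h 1 0 * alpha v + h 1 1 * beta v.
Proof.
rewrite /actpt toR4_beta mxE !big_ord_recl big_ord0 addr0 !mxE /=.
by congr (_ * _ + h _ _ * _); apply: val_inj.
Qed.

Lemma pt_eq u v : alpha u = alpha v -> beta u = beta v -> u = v.
Proof.
move=> [e0 e1] [e2 e3]; apply/rowP => -[[|[|[|[|j]]]] hj] //.
- by have := e0; rewrite /cx; congr (u _ _ = v _ _); apply: val_inj.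
- by have := e1; rewrite /cy; congr (u _ _ = v _ _); apply: val_inj.
- by have := e2; rewrite /cz; congr (u _ _ = v _ _); apply: val_inj.
- by have := e3; rewrite /cw; congr (u _ _ = v _ _); apply: val_inj.
Qed.

Lemma alpha0 : alpha (0 : pt) = 0. Proof. by rewrite /alpha /cx /cy !mxE. Qed.
Lemma beta0 : beta (0 : pt) = 0. Proof. by rewrite /beta /cz /cw !mxE. Qed.

Lemma ptP0 u : (u != 0) = ~~ ((alpha u == 0) && (beta u == 0)).
Proof.
congr (~~ _); apply/eqP/andP => [->|[/eqP ha /eqP hb]]; first by rewrite alpha0 beta0 eqxx.
by apply: pt_eq; rewrite ?ha ?hb ?alpha0 ?beta0.
Qed.

Lemma sqn4 u : sqn u = cx u ^+ 2 + cy u ^+ 2 + cz u ^+ 2 + cw u ^+ 2.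
Proof. by rewrite /sqn sum4. Qed.

Lemma onS3P u : onS3 u <-> sqn u = 1.
Proof. by rewrite sqn4. Qed.

Lemma sqn_ab u : (sqn u)%:C = alpha u * (alpha u)^* + beta u * (beta u)^*.
Proof.
rewrite sqn4 /alpha /beta; apply/eqP; rewrite eq_complex /=; apply/andP; split; apply/eqP; ring.
Qed.

Lemma onS3_nz u : onS3 u -> u != 0.
Proof.
move/onS3P => h; apply/eqP => u0; move/eqP: h; rewrite u0 /sqn big1 => [|i _]; last by rewrite mxE expr0n.
by rewrite eq_sym oner_eq0.
Qed.
Lemma onS3_rho u : onS3 u -> rho u = 1.
Proof. by move/onS3P => h; rewrite /rho /enorm -/(sqn u) h sqrtr1 invr1. Qed.
Lemma onS3_scale u : u != 0 -> onS3 (rho u *: u).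
Proof.
move=> u0; apply/onS3P; rewrite -(rho2 u0) /sqn big_distrr; apply: eq_bigr => j _.
by rewrite mxE exprMn.
Qed.

Lemma smval_a1 u : u != 0 -> smval a1 u = alpha u.
Proof.
move=> u0; rewrite /al smvalD smvalM !XjE // smval_cst /alpha /cx /cy.
by apply/eqP; rewrite eq_complex /=; apply/andP; split; apply/eqP; ring.
Qed.
Lemma smval_a1' u : u != 0 -> smval a1' u = (alpha u)^*.
Proof.
move=> u0; rewrite /al' smvalD smvalN smvalM !XjE // smval_cst /alpha /cx /cy.
by apply/eqP; rewrite eq_complex /=; apply/andP; split; apply/eqP; ring.
Qed.
Lemma smval_b1 u : u != 0 -> smval b1 u = beta u.
Proof.
move=> u0; rewrite /be smvalD smvalM !XjE // smval_cst /beta /cz /cw.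
by apply/eqP; rewrite eq_complex /=; apply/andP; split; apply/eqP; ring.
Qed.
Lemma smval_b1' u : u != 0 -> smval b1' u = (beta u)^*.
Proof.
move=> u0; rewrite /be' smvalD smvalN smvalM !XjE // smval_cst /beta /cz /cw.
by apply/eqP; rewrite eq_complex /=; apply/andP; split; apply/eqP; ring.
Qed.

Lemma smval_hform k p f g u :
  smval (hform cst k p f g) u = hform idfun k p (smval f u) (smval g u).
Proof.
rewrite /hform smval_sum; apply: eq_bigr => i _.
by rewrite !smvalM !smvalX smval_cst.
Qed.

Lemma twistm_smval h f u : (forall v, v != 0 -> h v = smval f v) -> u != 0 ->
  twistm h u = smval (TmS f) u.
Proof.
move=> hf u0.
have comb (c d : C) (i j : 'I_4) : smval (cst c * D i f + cst d * D j f) u =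
    c * cpd i h u + d * cpd j h u.
  rewrite smvalD !smvalM !smval_cst.
  by rewrite (DjE i f u0) (DjE j f u0) (cpd_ext i hf u0) (cpd_ext j hf u0).
have ea : smval (da 'i cst D f) u = dalpha h u.
  by rewrite /da NhhiiE comb /dalpha; ring.
have eb : smval (db 'i cst D f) u = dbeta h u.
  by rewrite /db NhhiiE comb /dbeta; ring.
rewrite /twistm /Tm smvalD !smvalM smvalN.
by rewrite ea eb (smval_a1' u0) (smval_b1' u0).
Qed.

Lemma sibling_smval h f j u : (forall v, v != 0 -> h v = smval f v) -> u != 0 ->
  sibling j h u = smval (iter j TmS f) u.
Proof.
move=> hf; elim: j u => [|j IH] u u0; first exact: hf.
by rewrite /sibling iterS (@twistm_smval _ (iter j TmS f)).
Qed.

Lemma EuS_iterTm k g j : holo (da 'i cst D) (da' 'i cst D) (db 'i cst D) (db' 'i cst D) a1 b1 k g ->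
  EuS (iter j TmS g) = k%:R * iter j TmS g.
Proof.
move=> hg; rewrite (EuN cst D X (@sqr_i R)) (iterTm_N1 tw j hg) (iterTm_N2 tw j hg); ring.
Qed.

Lemma LpS_iterTm k g j : holo (da 'i cst D) (da' 'i cst D) (db 'i cst D) (db' 'i cst D) a1 b1 k g ->
  LpS (iter j TmS g) = 0.
Proof.
move=> hg; rewrite (LapE (@sqr_i R) hD (@Dj_comm R M)) (Lap_iterTm tw j (holo_Lap tw hg)) mulr0 //.
Qed.

(** Off the origin the degree-0 extension of [F] is [Rh ^+ k * f], so [Lp_Rhn] yields the spherical
    eigenvalue. *)
Lemma smf_mode k (F : cfun R) f : LpS f = 0 -> EuS f = k%:R * f ->
  (forall u, u != 0 -> F u = smval f u) ->
  smoothS3 F /\ forall v, onS3 v -> lapS3 F v = - ((k * (k + 2))%:R) * F v.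
Proof.
move=> hL hE hF.
have eG u : u != 0 -> ext0 F u = smval (Rh ^+ k * f) u.
  move=> u0; rewrite /ext0 hF; last exact: scale_nz (rho_gt0 u0) u0.
  by rewrite (Eu_hom hE u0 (rho_gt0 u0)) smvalM smvalX RhE // rmorphXn.
have [h1 h2] := smval_csm (Rh ^+ k * f); split.
  split; apply/smooth_nzP => n; [apply: Cnz_ext (h1 n) | apply: Cnz_ext (h2 n)] => u u0;
    by rewrite eG.
move=> v hv; have v0 := onS3_nz hv.
have -> : lapS3 F v = smval (LpS (Rh ^+ k * f)) v.
  rewrite /lapS3 /Lp smval_sum; apply: eq_bigr => j _; rewrite (DjDj j j _ v0).
  exact: (cpd_ext j (cpd_ext j eG) v0).
rewrite (Lp_Rhn hD (@Dj_Xj R M) (@Dj_Rh R M) (@Rh_sq R M) hE) hL mulr0 addr0.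
rewrite !smvalM smvalX RhE // onS3_rho // expr1n mul1r -hF //; congr (_ * _).
by rewrite smvalN smval_nat.
Qed.

Lemma mode_smf k (F : cfun R) : smoothS3 F ->
  (forall v, onS3 v -> lapS3 F v = - ((k * (k + 2))%:R) * F v) ->
  exists f, [/\ LpS f = 0, EuS f = k%:R * f & forall v, onS3 v -> F v = smval f v].
Proof.
move=> [s1 s2] hlap.
have hc : csm (ext0 F) by split=> n; [move/smooth_nzP: s1; exact | move/smooth_nzP: s2; exact].
pose G := mksmf M (ext0 F).
have GE u : u != 0 -> smval G u = ext0 F u by exact: mksmfE.
have hom u t : u != 0 -> 0 < t -> smval G (t *: u) = smval G u.
  move=> u0 t0; rewrite !GE //; last exact: scale_nz.
  rewrite /ext0 -/(rho (t *: u)) -/(rho u) rho_scale // scalerA; congr (F _); congr (_ *: _).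
  by field; rewrite !gt_eqF // enorm_gt0.
have EG : EuS G = 0 by apply: hom0_Eu.
pose N : M := (k * (k + 2))%:R.
have ELG : EuS (LpS G) = - 2 * LpS G.
  have := Lp_Eu (@sqr_i R) hD (@Dj_comm R M) (@Dj_Xj R M) G; rewrite EG.
  rewrite {1}/Lp big1 => [|j _]; last by rewrite !(der0 (hD _)).
  move/esym/eqP; rewrite addr_eq0 => /eqP ->; ring.
(* The eigenvalue equation is given on the sphere only. [LpS G] has degree -2, so the factor
   [rrS ^+ 2] makes the left side homogeneous of degree 0, and it vanishes along every ray. *)
have key : rrS ^+ 2 * LpS G + N * G = 0.
  pose H := rrS ^+ 2 * LpS G + N * G.
  have hE := @EuS_derivation R M.
  have EH : EuS H = 0.
    rewrite (derD hE) (derM hE) (der_nat hE) EG ELG (EuS_rrn M 2); ring.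
  apply: smf_eq => u u0; rewrite -/H -(Eu0_hom EH u0 (rho_gt0 u0)).
  have su := onS3_scale u0; move: (rho u *: u) su => v hv; have v0 := onS3_nz hv.
  rewrite /H smvalD (smvalM (rrS ^+ 2)) (smvalM N) smvalX (rr_rho M v0) (onS3_rho hv) invr1 expr1n mul1r (GE v v0).
  have -> : smval (LpS G) v = lapS3 F v.
    rewrite /lapS3 /Lp smval_sum; apply: eq_bigr => j _; rewrite (DjDj j j _ v0).
    exact: (cpd_ext j (cpd_ext j GE) v0).
  have -> : ext0 F v = F v by rewrite /ext0 -/(rho v) onS3_rho // scale1r.
  by rewrite hlap // /N smval_nat smval0; ring.
pose f := rrS ^+ k * G.
have Rr := @Rh_rrS R M.
have Ef : EuS f = k%:R * f.
  by rewrite /f (derM (@EuS_derivation R M)) EG EuS_rrn; ring.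
have Gf : G = Rh ^+ k * f by rewrite /f mulrA -exprMn Rr expr1n mul1r.
exists f; split=> //.
- have := Lp_Rhn hD (@Dj_Xj R M) (@Dj_Rh R M) (@Rh_sq R M) Ef; rewrite -Gf -/N => e.
  have e2 : LpS G = - N * (Rh ^+ 2 * G).
    have h : Rh ^+ 2 * (rrS ^+ 2 * LpS G + N * G) = 0 by rewrite key mulr0.
    apply/eqP; rewrite -subr_eq0; apply/eqP; rewrite -[RHS]h.
    transitivity ((Rh * rrS) ^+ 2 * LpS G + N * (Rh ^+ 2 * G)); last by ring.
    by rewrite Rr; ring.
  have e3 : Rh ^+ k * LpS f = 0.
    apply: (@addrI _ (- N * (Rh ^+ (k + 2) * f))); rewrite -e addr0 e2 {1}Gf exprD; ring.
  have : rrS ^+ k * (Rh ^+ k * LpS f) = 0 by rewrite e3 mulr0.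
  by rewrite mulrA -exprMn mulrC [rrS * _]mulrC Rr expr1n mulr1.
move=> v hv; have v0 := onS3_nz hv.
rewrite /f smvalM smvalX (rr_rho M v0) (onS3_rho hv) invr1 expr1n mul1r (GE v v0) /ext0 -/(rho v).
by rewrite (onS3_rho hv) scale1r.
Qed.

End ModesOctahedral.

(** * Matrices of SU(2) and the vertices of the octahedron *)

Section SU2.
Local Open Scope ring_scope.
Local Open Scope complex_scope.
Variable R : realType.
Notation C := R[i].
Local Notation "x ^*" := (conjc x) : ring_scope.
Implicit Types (g : 'M[C]_2) (m n x y : C).

Lemma SU2_entries g : inSU2 g ->
  [/\ g 1 0 = - (g 0 1)^*, g 1 1 = (g 0 0)^* & g 0 0 * (g 0 0)^* + g 0 1 * (g 0 1)^* = 1].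
Proof.
case=> /matrixP h; rewrite (expand_det_row _ 0) => hd.
have e i j : g i 0 * (g j 0)^* + g i 1 * (g j 1)^* = (i == j)%:R.
  have := h i j; rewrite !mxE !big_ord_recl big_ord0 addr0 !mxE => <-.
  by congr (_ + g _ _ * (g _ _)^*); apply: val_inj.
have e00 := e 0 0; have e10 := e 1 0; rewrite /= in e00 e10.
have {}hd : g 0 0 * g 1 1 - g 0 1 * g 1 0 = 1.
  rewrite -[RHS]hd !big_ord_recl big_ord0 addr0 /cofactor !det_mx11 !mxE /=.
  have -> : lift 0 0 = 1 :> 'I_2 by apply: val_inj.
  have -> : lift 1 0 = 0 :> 'I_2 by apply: val_inj.
  by rewrite addn0 expr0 expr1; ring.
move: e00 e10 hd; move: (g 0 0) (g 0 1) (g 1 0) (g 1 1) => a b c d e00 e10 hd.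
split=> //.
- transitivity (c * (a * a^* + b * b^*)); first by rewrite e00 mulr1.
  transitivity (a * (c * a^* + d * b^*) - b^* * (a * d - b * c)); first by ring.
  by rewrite e10 hd mulr0 mulr1 sub0r.
- transitivity (d * (a * a^* + b * b^*)); first by rewrite e00 mulr1.
  transitivity (a^* * (a * d - b * c) + b * (c * a^* + d * b^*)); first by ring.
  by rewrite e10 hd mulr0 mulr1 addr0.
Qed.

Lemma SU2_inv g : inSU2 g ->
  [/\ invmx g 0 0 = (g 0 0)^*, invmx g 0 1 = - g 0 1,
      invmx g 1 0 = (g 0 1)^* & invmx g 1 1 = g 0 0].
Proof.
move=> hg; have [e1 e2 _] := SU2_entries hg; have [hm _] := hg.
have -> : invmx g = adjmx g.
  have [gu _] := mulmx1_unit hm.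
  by rewrite -[invmx g]mulmx1 -hm mulmxA mulVmx // mul1mx.
by rewrite !mxE e1 e2 rmorphN /= !conjcK.
Qed.

Definition su2 m n : 'M[C]_2 :=
  \matrix_(i, j) (if i == 0 then (if j == 0 then m else n) else (if j == 0 then - n^* else m^*)).

Lemma su2_inSU2 m n : m * m^* + n * n^* = 1 -> inSU2 (su2 m n).
Proof.
move=> h; split.
  apply/matrixP => i j; rewrite !mxE !big_ord_recl big_ord0 addr0 !mxE /=.
  case: i => [[|[|i]] hi] //; case: j => [[|[|j]] hj] //=; rewrite ?rmorphN /= ?conjcK -?h; ring.
rewrite (expand_det_row _ 0) !big_ord_recl big_ord0 addr0 /cofactor !det_mx11 !mxE /=.
by rewrite addn0 expr0 expr1 -[RHS]h; ring.
Qed.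

Lemma VO_tf (z : C) : VO (Some z) = (tf z 1 == 0).
Proof.
have i2 : 'i ^+ 2 = -1 :> C := @sqr_i R.
have -> : tf z 1 = z * (z - 1) * (z + 1) * (z - 'i) * (z + 'i).
  transitivity (z * (z ^+ 2 - 1) * (z ^+ 2 - 'i ^+ 2)); last by ring.
  by rewrite i2 /tf; ring.
rewrite !mulf_eq0 !subr_eq0 !addr_eq0 /VO.
by rewrite [Some z == None]/= orbF.
Qed.

(** Membership in V_O becomes the vanishing of [tf] on homogeneous coordinates, which treats
    infinity like the finite points. *)
Lemma mobius_tf g p : VO (mobius g p) =
  (let: (x, y) := if p is Some z then (z, 1) else (1, 0) in
   tf (g 0 0 * x + g 0 1 * y) (g 1 0 * x + g 1 1 * y) == 0).
Proof.
have key (a b : C) : VO (if b == 0 then None else Some (a / b)) = (tf a b == 0).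
  have [->|b0] := eqVneq b 0; first by rewrite /tf expr0n !mulr0 subrr eqxx.
  rewrite VO_tf; have -> : tf a b = b ^+ 6 * tf (a / b) 1.
    by rewrite -tf_scale mulr1 mulrC divfK.
  by rewrite mulf_eq0 expf_eq0 (negPf b0).
by case: p => [z|] /=; rewrite ?mulr1 ?mulr0 ?addr0 key.
Qed.

Lemma inOstar_tf g : inOstar g -> forall x y,
  (tf (g 0 0 * x + g 0 1 * y) (g 1 0 * x + g 1 1 * y) == 0) = (tf x y == 0).
Proof.
case=> _ h x y; have hN := h None; have hS (z : C) := h (Some z).
have [->|y0] := eqVneq y 0.
  have -> : tf x 0 == 0 by rewrite /tf expr0n !mulr0 subrr.
  have := hN; rewrite mobius_tf !mulr1 !mulr0 !addr0 [RHS]/= => /eqP e.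
  by rewrite ![_ * x]mulrC tf_scale e mulr0 eqxx.
have := hS (x / y); rewrite mobius_tf VO_tf !mulr1 => e.
have -> : g 0 0 * x + g 0 1 * y = y * (g 0 0 * (x / y) + g 0 1) by field.
have -> : g 1 0 * x + g 1 1 * y = y * (g 1 0 * (x / y) + g 1 1) by field.
have -> : tf x y = y ^+ 6 * tf (x / y) 1 by rewrite -tf_scale mulr1 mulrC divfK.
by rewrite tf_scale !(mulf_eq0 (y ^+ 6)) expf_eq0 (negPf y0) /= e.
Qed.

Lemma su2_inOstar m n : m * m^* + n * n^* = 1 ->
  (forall x y, (tf (m * x + n * y) (- n^* * x + m^* * y) == 0) = (tf x y == 0)) ->
  inOstar (su2 m n).
Proof.
move=> hmn h; split; first exact: su2_inSU2.
case=> [z|]; rewrite mobius_tf !mxE /= h ?VO_tf //.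
by rewrite /tf expr0n !mulr0 subrr eqxx.
Qed.

Lemma Ostar_subst g : inOstar g ->
  octa_subst (g 0 0) (g 0 0)^* (g 0 1) (g 0 1)^*.
Proof.
move=> hg; have [e1 e2 e3] := SU2_entries hg.1; have ht := inOstar_tf hg.
move: ht; rewrite e1 e2; move: (g 0 0) (g 0 1) e3 => a b e3 ht.
apply: octa_substP => //.
- apply: ger0_real; clear; case: a => r i; rewrite lecE /=; apply/andP; split.
    by apply/eqP; ring.
  by rewrite mulrN opprK -!expr2 addr_ge0 ?sqr_ge0.
- by move=> e; have := congr1 (@conjc R) e; rewrite !rmorphXn /= conjcK => ->.
- by move=> ->; rewrite rmorph0.
- by move=> ->; rewrite rmorph0.
- by move=> e; rewrite -[b](conjcK b) e rmorph0.
- have := ht 1 0; rewrite !mulr1 !mulr0 !addr0 => e; apply/eqP; rewrite e.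
  by rewrite /tf expr0n !mulr0 subrr.
- have := ht 1 1; rewrite !mulr1 => e; apply/eqP; rewrite e.
  by rewrite /tf !expr1n subrr.
Qed.

End SU2.

(** * The group action on harmonic polynomials; the basis of modes *)

Section Pullback.
Local Open Scope ring_scope.
Local Open Scope complex_scope.
Variable R : realType.
Variable M : smooth_model R.
Notation pt := (pt R).
Notation C := R[i].
Local Notation "x ^*" := (conjc x) : ring_scope.
Implicit Types (f g : M) (u v : pt).

Notation cst := (@cstf R M).
Notation D := (@Dj R M).
Notation X := (@Xj R M).
Notation a1 := (al 'i cst X).
Notation a1' := (al' 'i cst X).
Notation b1 := (be 'i cst X).
Notation b1' := (be' 'i cst X).
Notation TmS := (Tm (da 'i cst D) (db 'i cst D) a1' b1').

Let hD := @Dj_derivation R M.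
Let tw := coord_twist (@sqr_i R) hD (@Dj_comm R M) (@Dj_Xj R M).

Lemma alpha_scale (t : R) u : alpha (t *: u) = t%:C * alpha u.
Proof.
rewrite /alpha /cx /cy !mxE.
by apply/eqP; rewrite eq_complex /=; apply/andP; split; apply/eqP; ring.
Qed.
Lemma beta_scale (t : R) u : beta (t *: u) = t%:C * beta u.
Proof.
rewrite /beta /cz /cw !mxE.
by apply/eqP; rewrite eq_complex /=; apply/andP; split; apply/eqP; ring.
Qed.
Lemma actpt_scale (h : 'M[C]_2) (t : R) u : actpt h (t *: u) = t *: actpt h u.
Proof.
apply: pt_eq.
  rewrite [RHS]alpha_scale [in RHS](actpt_alpha h u) (actpt_alpha h (t *: u)).
  rewrite (alpha_scale t u) (beta_scale t u).
  by move: (h 0 0) (h 0 1) (alpha u) (beta u) t%:C => *; ring.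
rewrite [RHS]beta_scale [in RHS](actpt_beta h u) (actpt_beta h (t *: u)).
rewrite (alpha_scale t u) (beta_scale t u).
by move: (h 1 0) (h 1 1) (alpha u) (beta u) t%:C => *; ring.
Qed.

Section Matrix.
Variable h : 'M[C]_2.
Hypothesis h10 : h 1 0 = - (h 0 1)^*.
Hypothesis h11 : h 1 1 = (h 0 0)^*.
Hypothesis hdet : h 0 0 * (h 0 0)^* + h 0 1 * (h 0 1)^* = 1.

Lemma actpt_sqn u : sqn (actpt h u) = sqn u.
Proof.
apply: (@complexI R); rewrite !sqn_ab actpt_alpha actpt_beta h10 h11.
have := hdet; move: (h 0 0) (h 0 1) (alpha u) (beta u) => m n x y e.
rewrite -[RHS]mul1r -e.
rewrite !rmorphD !rmorphM rmorphN /= !conjcK; ring.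
Qed.

Lemma actpt_nz u : u != 0 -> actpt h u != 0.
Proof.
move=> u0; apply/eqP => e; have := actpt_sqn u; rewrite e => /esym/eqP.
rewrite /sqn [X in _ == X]big1 => [|i _]; last by rewrite mxE expr0n.
by rewrite gt_eqF // sqn_gt0.
Qed.

Lemma actpt_S3 u : onS3 u -> onS3 (actpt h u).
Proof. by move=> /onS3P hu; apply/onS3P; rewrite actpt_sqn. Qed.

Let m := h 0 0.
Let n := h 0 1.
(** With [pb], [pa'] and [pb'], the coordinate functions composed with [actpt h]. The conjugate ones
    are separate definitions, since the ring carries no conjugation. *)
Definition pa := cst m * a1 + cst n * b1.
Definition pb := cst (- n^*) * a1 + cst m^* * b1.
Definition pa' := cst m^* * a1' + cst n^* * b1'.
Definition pb' := cst (- n) * a1' + cst m * b1'.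

Lemma pull_smval f g : pull cst a1 a1' b1 b1' pa pa' pb pb' f g ->
  forall u, u != 0 -> smval g u = smval f (actpt h u).
Proof.
elim=> {f g} [c|||||f f' g g' _ hf _ hg|f f' g g' _ hf _ hg] u u0; have hu := actpt_nz u0.
- by rewrite !smval_cst.
- by rewrite smval_a1 // actpt_alpha smvalD !smvalM !smval_cst smval_a1 // smval_b1.
- rewrite smval_a1' // actpt_alpha smvalD !smvalM !smval_cst smval_a1' // smval_b1' //.
  by rewrite rmorphD !rmorphM.
- by rewrite smval_b1 // actpt_beta smvalD !smvalM !smval_cst smval_a1 // smval_b1 // h10 h11.
- rewrite smval_b1' // actpt_beta smvalD !smvalM !smval_cst smval_a1' // smval_b1' //.
  by rewrite rmorphD !rmorphM h10 h11 rmorphN /= !conjcK.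
- by rewrite !smvalD hf // hg.
- by rewrite !smvalM hf // hg.
Qed.

Lemma iterTm_actpt k p j u : u != 0 ->
  smval (iter j TmS (hform cst k p a1 b1)) (actpt h u) = smval (iter j TmS (hform cst k p pa pb)) u.
Proof.
move=> u0; symmetry; apply: pull_smval u0.
have [ta tb ta' tb'] := Tm_coord tw; have hT := Tm_derivation tw.
apply: (pull_iterTm_hform tw); rewrite (derD hT) !(derMc hT) ?ta ?tb ?ta' ?tb' /pa' /pb'.
- by rewrite rmorphN; ring.
- by rewrite rmorphN; ring.
- by rewrite !mulr0 addr0.
- by rewrite !mulr0 addr0.
Qed.

Lemma pab_holo k p : holo (da 'i cst D) (da' 'i cst D) (db 'i cst D) (db' 'i cst D) a1 b1 k
  (hform cst k p pa pb).
Proof. exact: (hform_lin_holo tw). Qed.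

Lemma smval_pab k p u : u != 0 -> smval (hform cst k p pa pb) u =
  hform idfun k p (m * alpha u + n * beta u) (- n^* * alpha u + m^* * beta u).
Proof.
move=> u0; rewrite smval_hform /pa /pb !smvalD !smvalM !smval_cst.
by rewrite smval_a1 // smval_b1.
Qed.

(** The decomposition of the transform of [f] minus that of [f] is a sum of powers of [Tm] applied
    to the differences between transformed and original forms, and [twist_indep] makes every
    difference zero. *)
Lemma inv_forms k (P : 'I_k.+1 -> {poly C}) f :
  f = \sum_(j < k.+1) iter j TmS (hform cst k (P j) a1 b1) ->
  (forall u, u != 0 -> smval f (actpt h u) = smval f u) ->
  forall j x y, hform idfun k (P j) (m * x + n * y) (- n^* * x + m^* * y) = hform idfun k (P j) x y.
Proof.
move=> ef hinv.
pose gg (i : nat) : M := if insub i is Some j then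
  hform cst k (P j) pa pb - hform cst k (P j) a1 b1 else 0.
have ggE (j : 'I_k.+1) : gg j = hform cst k (P j) pa pb - hform cst k (P j) a1 b1.
  by rewrite /gg valK.
have gg0 (j : 'I_k.+1) : gg j = 0.
  apply: (twist_indep tw (k := k) (g := gg)); last by rewrite -ltnS.
    move=> i ik; have -> : gg i = gg (Ordinal (ik : (i < k.+1)%N)) by [].
    rewrite ggE; have [p1 p2 p3] := pab_holo k (P (Ordinal (ik : (i < k.+1)%N))).
    have [q1 q2 q3] := hform_ab_holo tw k (P (Ordinal (ik : (i < k.+1)%N))).
    split.
    - by rewrite (derB (tw_der2 tw)) p1 q1 subrr.
    - by rewrite (derB (tw_der4 tw)) p2 q2 subrr.
    - by rewrite (derB (N1_derivation tw)) p3 q3 mulrBr.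
  transitivity (\sum_(j < k.+1) (iter j TmS (hform cst k (P j) pa pb)
       - iter j TmS (hform cst k (P j) a1 b1))).
    by apply: eq_bigr => i _; rewrite ggE (iterTmB tw).
  apply: smf_eq => u u0; rewrite smval0 sumrB smvalD smvalN -ef -hinv // ef !smval_sum.
  rewrite -sumrB big1 // => i _; rewrite iterTm_actpt // subrr //.
move=> j x y; have [xy0|xy0] := boolP ((x == 0) && (y == 0)).
  by move/andP: xy0 => [/eqP -> /eqP ->]; rewrite !mulr0 !addr0.
have u0 : toR4 x y != 0 by rewrite ptP0 toR4_alpha toR4_beta.
have := congr1 (fun f : M => smval f (toR4 x y)) (gg0 j).
rewrite ggE smvalD smvalN smval0 smval_pab // smval_hform smval_a1 // smval_b1 //.
by rewrite toR4_alpha toR4_beta => /eqP; rewrite subr_eq0 => /eqP.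
Qed.

End Matrix.

Lemma Bpoly_smval k i u : ~~ odd k -> (i < nB k)%N -> u != 0 ->
  Bpoly k i u = smval (hform cst k (Bp C k i) a1 b1) u.
Proof.
by move=> ko ik u0; rewrite smval_hform smval_a1 // smval_b1 // hf_Bp.
Qed.

Lemma sibling_Bpoly k i j u : ~~ odd k -> (i < nB k)%N -> u != 0 ->
  sibling j (Bpoly k i) u = smval (iter j TmS (hform cst k (Bp C k i) a1 b1)) u.
Proof.
by move=> ko ik u0; apply: sibling_smval u0 => v v0; apply: Bpoly_smval.
Qed.

(** The substitution is by the inverse of [g], as in [Ract]. Invariance under [g] is used at the
    transformed point [(x', y')], which [g] carries back to [(x, y)]. *)
Lemma Bp_inv (g : 'M[C]_2) k i x y : inOstar g -> ~~ odd k -> (i < nB k)%N ->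
  hform idfun k (Bp C k i) ((g 0 0)^* * x + - g 0 1 * y) ((g 0 1)^* * x + g 0 0 * y) =
  hform idfun k (Bp C k i) x y.
Proof.
move=> hg ko ik; rewrite !hf_Bp //.
have [_ _ e] := SU2_entries hg.1.
pose x' := (g 0 0)^* * x + - g 0 1 * y; pose y' := (g 0 1)^* * x + g 0 0 * y.
have [h1 h2 h3] := octa_subst_inv (Ostar_subst hg) x' y'.
have ex : g 0 0 * x' + g 0 1 * y' = x.
  by rewrite /x' /y' -[RHS]mul1r -e; ring.
have ey : - (g 0 1)^* * x' + (g 0 0)^* * y' = y.
  by rewrite /x' /y' -[RHS]mul1r -e; ring.
by move: h1 h2 h3; rewrite ex ey => <- <- <-.
Qed.

Lemma sibling_mode k i j : ~~ odd k -> (i < nB k)%N -> mode k (sibling j (@Bpoly R k i)).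
Proof.
move=> ko ik; set F := sibling j _; pose f := iter j TmS (hform cst k (Bp C k i) a1 b1).
have hF u : u != 0 -> F u = smval f u by move=> u0; apply: sibling_Bpoly.
have hho := hform_ab_holo tw k (Bp C k i).
have [h1 h2] := smf_mode (LpS_iterTm j hho) (EuS_iterTm j hho) hF.
split=> //; split=> // m hm v hv; rewrite /Ract.
have [i00 i01 i10 i11] := SU2_inv hm.1; have [_ _ e] := SU2_entries hm.1.
have v0 := onS3_nz hv.
have H10 : invmx m 1 0 = - (invmx m 0 1)^* by rewrite i10 i01 rmorphN opprK.
have H11 : invmx m 1 1 = (invmx m 0 0)^* by rewrite i11 i00 conjcK.
have Hdet : invmx m 0 0 * (invmx m 0 0)^* + invmx m 0 1 * (invmx m 0 1)^* = 1.
  by rewrite i00 i01 rmorphN /= conjcK -[RHS]e; ring.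
rewrite !hF //; last exact: actpt_nz.
rewrite /f iterTm_actpt //; congr (smval (iter j TmS _) v); apply: smf_eq => u u0.
rewrite smval_pab // smval_hform smval_a1 // smval_b1 // -[RHS](Bp_inv _ _ hm ko ik) i00 i01.
by rewrite rmorphN /= opprK conjcK.
Qed.

Lemma sqrt2_sq : (Num.sqrt 2 : R) ^+ 2 = 2.
Proof. by rewrite sqr_sqrtr // ler0n. Qed.

Definition r2 : C := (Num.sqrt 2)%:C.
(** The primitive eighth root of unity whose square is i: the diagonal matrix with entries [z8] and
    [z8^-1] induces multiplication by i on the Riemann sphere. *)
Definition z8 : C := r2^-1 * (1 + 'i%C).

Lemma r2_sq : r2 ^+ 2 = 2%:R.
Proof. by rewrite /r2 -rmorphXn /= sqrt2_sq rmorph_nat. Qed.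
Lemma r2_conj : (r2^-1)^* = r2^-1.
Proof. by rewrite conjc_inv; congr (_^-1); exact: conjc_real. Qed.
Lemma r2N_conj : (- r2^-1)^* = - r2^-1.
Proof. by transitivity (- (r2^-1)^*); [exact: rmorphN | rewrite r2_conj]. Qed.
Lemma z8_sq : z8 ^+ 2 = 'i%C.
Proof.
rewrite /z8 exprMn exprVn r2_sq.
transitivity (2^-1 * (1 + 2 * 'i%C + 'i%C ^+ 2) : C); first by ring.
by rewrite (sqr_i R); field.
Qed.
Lemma z8_4 : z8 ^+ 4 = -1.
Proof. by rewrite -[4%N]/(2 * 2)%N exprM z8_sq (sqr_i R). Qed.
Lemma z8_conj : z8 * z8^* = 1.
Proof.
have e1 : (1 + 'i%C : C)^* = 1 - 'i%C.
  by apply/eqP; rewrite eq_complex /=; apply/andP; split; apply/eqP; ring.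
have -> : z8^* = r2^-1 * (1 - 'i%C).
  transitivity ((r2^-1)^* * (1 + 'i%C : C)^*); first exact: rmorphM.
  by rewrite r2_conj e1.
rewrite /z8.
transitivity (r2^-1 ^+ 2 * (1 - 'i%C ^+ 2)); first by ring.
by rewrite (sqr_i R) exprVn r2_sq; field.
Qed.

Lemma mode_octa k (F : cfun R) (P : 'I_k.+1 -> {poly C}) f :
  Ostar_invariant F -> (forall v, onS3 v -> F v = smval f v) ->
  Eu D X f = k%:R * f ->
  f = \sum_(j < k.+1) iter j TmS (hform cst k (P j) a1 b1) ->
  forall j, octa z8 r2 k (P j) 1.
Proof.
move=> hinv hF hE ef.
(* Since [Ract] uses the inverse, the group element is [su2 m^* (- n)], whose inverse has first row
   [(m, n)]. It belongs to O^* as soon as it multiplies [tf] by nonzero scalars. *)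
have key m n : m * m^* + n * n^* = 1 ->
    (forall x y, exists2 c : C, c != 0 &
      tf (m^* * x + - n * y) (- (- n)^* * x + m^*^* * y) = c * tf x y) ->
    forall j x y, hform idfun k (P j) (m * x + n * y) (- n^* * x + m^* * y) = hform idfun k (P j) x y.
  move=> hmn htf; pose g : 'M[C]_2 := su2 m^* (- n).
  have hmn' : m^* * m^*^* + - n * (- n)^* = 1 by rewrite rmorphN /= conjcK -[RHS]hmn; ring.
  have hg : inOstar g.
    apply: su2_inOstar => // x y; have [c c0 ->] := htf x y.
    by rewrite mulf_eq0 (negPf c0).
  have [i00 i01 i10 i11] := SU2_inv hg.1.
  have g00 : g 0 0 = m^* by rewrite mxE.
  have g01 : g 0 1 = - n by rewrite mxE.
  rewrite g00 conjcK in i00; rewrite g01 opprK in i01; rewrite g01 rmorphN /= in i10.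
  rewrite g00 in i11.
  have H10 : invmx g 1 0 = - (invmx g 0 1)^* by rewrite i10 i01.
  have H11 : invmx g 1 1 = (invmx g 0 0)^* by rewrite i11 i00.
  have Hdet : invmx g 0 0 * (invmx g 0 0)^* + invmx g 0 1 * (invmx g 0 1)^* = 1 by rewrite i00 i01.
  (* Invariance is given on the sphere; homogeneity of degree [k] extends it along the rays. *)
  have hu u : u != 0 -> smval f (actpt (invmx g) u) = smval f u.
    move=> u0; have r0 := rho_gt0 u0; have r1 : 0 < (rho u)^-1 by rewrite invr_gt0.
    pose v := rho u *: u; have hv : onS3 v := onS3_scale u0.
    have v0 := onS3_nz hv; have av0 := actpt_nz H10 H11 Hdet v0.
    have uv : u = (rho u)^-1 *: v by rewrite /v scalerA mulVf ?scale1r // gt_eqF.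
    have acts : actpt (invmx g) u = (rho u)^-1 *: actpt (invmx g) v.
      by rewrite -actpt_scale -uv.
    rewrite acts (Eu_hom hE av0 r1) {2}uv (Eu_hom hE v0 r1); congr (_ * _).
    rewrite -!hF //; last exact: (actpt_S3 H10 H11 Hdet).
    exact: hinv.
  have := inv_forms H10 H11 Hdet ef hu; rewrite i00 i01; exact.
have z0 : z8 != 0.
  by apply/eqP => e; move/eqP: z8_4; rewrite e expr0n eq_sym oppr_eq0 oner_eq0.
have zc : z8^* = z8^-1 by apply: (mulfI z0); rewrite z8_conj mulfV.
have N10 : (-1 : C) != 0 by rewrite oppr_eq0 oner_eq0.
move=> j; split=> x y; rewrite [RHS]mul1r.
- rewrite -[RHS](key z8 0 _ _ j x y); first by rewrite rmorph0 oppr0 zc.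
    by rewrite z8_conj mul0r addr0.
  move=> x' y'; exists (-1) => //; rewrite oppr0 rmorph0 oppr0 conjcK zc.
  transitivity ((z8^-1 * z8) * (z8^-1 ^+ 4 * x' ^+ 5 * y' - z8 ^+ 4 * x' * y' ^+ 5)).
    by rewrite /tf; ring.
  by rewrite mulVf // exprVn z8_4 invrN1 /tf; ring.
- rewrite -[RHS](key 0 1 _ _ j x y); first by rewrite rmorph0 rmorph1.
    by rewrite rmorph1 mul0r add0r mulr1.
  move=> x' y'; exists 1; first exact: oner_neq0.
  by rewrite rmorphN !rmorph0 rmorph1 /= /tf; ring.
- rewrite -[RHS](key r2^-1 r2^-1 _ _ j x y); first by rewrite r2_conj.
    by rewrite r2_conj -expr2 exprVn r2_sq; field.
  move=> x' y'; exists (-1) => //; rewrite !r2_conj r2N_conj opprK.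
  transitivity ((r2^-1 ^+ 2) ^+ 3 * ((x' - y') ^+ 5 * (x' + y') - (x' - y') * (x' + y') ^+ 5)).
    by rewrite /tf; ring.
  by rewrite exprVn r2_sq /tf; field.
Qed.

Lemma mode_decomp k (F : cfun R) : mode k F -> exists2 P : 'I_k.+1 -> {poly C},
  forall j, inspan k (P j) /\ (odd k -> P j = 0) &
  forall v, onS3 v -> F v = \sum_(j < k.+1) smval (iter j TmS (hform cst k (P j) a1 b1)) v.
Proof.
move=> [hs [hi hl]]; have [f [hL hE hF]] := mode_smf M hs hl.
have [P sP ef] := harmonic_smf_decomp hL hE.
have ho := mode_octa hi hF hE ef.
exists P; first by move=> j; apply: (octa_span z8_4 r2_sq (sP j) (ho j)).
by move=> v hv; rewrite hF // ef smval_sum.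
Qed.

Lemma odd_mode_eq0 k (F : cfun R) v : odd k -> mode k F -> onS3 v -> F v = 0.
Proof.
move=> ko /mode_decomp [P hP hF] hv; rewrite hF // big1 // => j _; have [_ ->//] := hP j.
by rewrite -[0 : {poly C}](scale0r 0) hformZ (iterTm_cst tw) rmorph0 mul0r smval0.
Qed.

Lemma sibling_sum k (c : 'I_(nB k) -> 'I_k.+1 -> C) v : ~~ odd k -> v != 0 ->
  \sum_(i < nB k) \sum_(j < k.+1) c i j * sibling j (@Bpoly R k i) v =
  smval (\sum_(j < k.+1) iter j TmS (hform cst k (\sum_(i < nB k) c i j *: Bp C k i) a1 b1)) v.
Proof.
move=> ko v0; rewrite exchange_big smval_sum; apply: eq_bigr => j _ /=.
rewrite hform_sum (iterTm_sum tw) smval_sum; apply: eq_bigr => i _.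
by rewrite hformZ (iterTm_cst tw) smvalM smval_cst sibling_Bpoly.
Qed.

(** Independence splits in two: [twist_indep] separates the sibling orders [j], and for each [j]
    [Bp_indep] separates the B_i. *)
Lemma sibling_indep k (c : 'I_(nB k) -> 'I_k.+1 -> C) : ~~ odd k ->
  (forall v, onS3 v ->
     \sum_(i < nB k) \sum_(j < k.+1) c i j * sibling j (@Bpoly R k i) v = 0) ->
  forall i j, c i j = 0.
Proof.
move=> ko hc i j.
pose p j := \sum_(i < nB k) c i j *: Bp C k i.
pose gg (l : nat) : M := if insub l is Some j then hform cst k (p j) a1 b1 else 0.
have ggE (l : 'I_k.+1) : gg l = hform cst k (p l) a1 b1 by rewrite /gg valK.
have ggh l : (l <= k)%N -> holo (da 'i cst D) (da' 'i cst D) (db 'i cst D) (db' 'i cst D) a1 b1 k (gg l).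
  move=> lk; have -> : gg l = gg (Ordinal (lk : (l < k.+1)%N)) by [].
  by rewrite ggE; apply: (hform_ab_holo tw).
have s0 : \sum_(l < k.+1) iter l TmS (gg l) = 0.
  set f := \sum_(l < k.+1) _.
  have hE : Eu D X f = k%:R * f.
    rewrite /f (der_sum (EuS_derivation M)) big_distrr; apply: eq_bigr => l _.
    by rewrite (EuS_iterTm l (ggh l _)) // -ltnS.
  apply: smf_eq => u u0; rewrite smval0.
  have hv := onS3_scale u0; have v0 := onS3_nz hv.
  have := hc _ hv; rewrite sibling_sum // => e.
  have f0 : smval f (rho u *: u) = 0.
    by rewrite -[RHS]e; congr (smval _ _); apply: eq_bigr => l _; rewrite ggE.
  move: f0; rewrite (Eu_hom hE u0 (rho_gt0 u0)) => /eqP.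
  rewrite mulf_eq0 (fmorph_eq0 (real_complex R)) expf_eq0 gt_eqF ?rho_gt0 // andbF.
  by move/eqP.
have g0 := twist_indep tw ggh s0 (ltn_ord j : (j <= k)%N).
apply: (@Bp_indep C k (fun i => c i j)); rewrite -/(p j).
have sp : (size (p j) <= k.+1)%N.
  apply: (leq_trans (size_sum _ _ _)); apply/bigmax_leqP => l _.
  by apply: (leq_trans (size_scale_leq _ _)); apply: size_Bp.
apply: (hf_inj sp) => z; have u0 : toR4 z 1 != 0.
  by rewrite ptP0 toR4_alpha toR4_beta oner_eq0 andbF.
have := congr1 (fun f : M => smval f (toR4 z 1)) g0.
by rewrite ggE smval0 smval_hform (smval_a1 M u0) (smval_b1 M u0) toR4_alpha toR4_beta.
Qed.

Lemma mode_span k (F : cfun R) : ~~ odd k -> mode k F ->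
  exists c : 'I_(nB k) -> 'I_k.+1 -> C, forall v, onS3 v ->
    F v = \sum_(i < nB k) \sum_(j < k.+1) c i j * sibling j (@Bpoly R k i) v.
Proof.
move=> ko /mode_decomp [P hP hF]; have [c hc] := fin_all_exists (fun j => (hP j).1).
exists (fun i j => c j i) => v hv; have v0 := onS3_nz hv.
rewrite hF // sibling_sum // smval_sum; apply: eq_bigr => j _.
by rewrite -hc.
Qed.

End Pullback.

Theorem theorem11p1 (R : realType) (k : nat) :
  (odd k ->
     forall F : cfun R, mode k F -> forall v : pt R, onS3 v -> F v = 0)
  /\
  (~~ odd k ->
     (* the number of B_i's is k~ + 1 (so there are none iff k~ = -1) *)
     ((nB k)%:Z = ktilde k + 1)
     /\
     (* every sibling twist_-^j B_i (restricted to S^3) is a mode *)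
     (forall (i : 'I_(nB k)) (j : 'I_k.+1),
        mode k (sibling j (@Bpoly R k i)))
     /\
     (* linear independence on S^3 over C *)
     (forall c : 'I_(nB k) -> 'I_k.+1 -> R[i],
        (forall v : pt R, onS3 v ->
           \sum_(i < nB k) \sum_(j < k.+1)
              c i j * sibling j (@Bpoly R k i) v = 0) ->
        forall i j, c i j = 0)
     /\
     (* spanning *)
     (forall F : cfun R, mode k F ->
        exists c : 'I_(nB k) -> 'I_k.+1 -> R[i],
          forall v : pt R, onS3 v ->
            F v = \sum_(i < nB k) \sum_(j < k.+1)
                    c i j * sibling j (@Bpoly R k i) v)).
Proof.
pose M := smf_model R; split=> [ko F hF v hv|ko]; first exact: (odd_mode_eq0 M ko hF hv).
split; first exact: nB_ktilde.
split; first by move=> i j; apply: (sibling_mode M).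
split=> [c hc i j|F hF]; first exact: (sibling_indep M ko hc).
exact: (mode_span M ko hF).
Qed.
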